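(* Let $(X_n)_{n\ge1}$ be a sequence of data matrices with bounded condition number, $\limsup_{n\to\infty}\ell_{n,1}/\ell_{n,p}<\infty$, and let $(S_{m,n})_{m,n\ge1}$ be a sequence of sketching matrices. Suppose that for any $(b_n)_{n\ge1}$ with $b_n\in\mathbb R^p$, $\|b_n\|=1$ for all $n$, the sequences $(U_nb_n,U_nb_n)_{n\ge1}$ and $(U_nb_n,\bar\varepsilon_n)_{n\ge1}$ satisfy Condition $\mathfrak P$. (a) Under conditions (Bounded) and (1-dim) of the context, the sketch-and-solve least squares estimator satisfies $$m^{1/2}\tau_{m,n}^{-1/2}\big(V_nL_n^{-1}M_nL_n^{-1}V_n^\top\big)^{-1/2}\|\varepsilon_n\|^{-1}(\hat\beta^{\mathrm s}_{m,n}-\beta_n)\Rightarrow\mathcal N(0,I_p),$$ with $M_n$ from (1-dim). (b) Under conditions (Bounded) and (1-dim), with $M_n^{\mathrm{pa}}$ from (1-dim), the partial sketching least squares estimator satisfies $$m^{1/2}\tau_{m,n}^{-1/2}\big(V_nL_n^{-1}M_n^{\mathrm{pa}}L_n^{-1}V_n^\top\big)^{-1/2}\|X_n\beta_n\|^{-1}(\hat\beta^{\mathrm{pa}}_{m,n}-\beta_n)\Rightarrow\mathcal N(0,I_p).$$ (c) In the special case that condition (1-dim') of the context holds for $\alpha\in\{0,1\}$, one further has $$m^{1/2}\tau_{m,n}^{-1/2}\|\tilde\varepsilon_{m,n}\|^{-1}(\tilde X_{m,n}^\top\tilde X_{m,n})^{1/2}(\hat\beta^{\mathrm s}_{m,n}-\beta_n)\Rightarrow\mathcal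 N(0,I_p)$$ and $$m^{1/2}\tau_{m,n}^{-1/2}\Big(\|\tilde X_{m,n}\hat\beta^{\mathrm{pa}}_{m,n}\|^2(\tilde X_{m,n}^\top\tilde X_{m,n})^{-1}+(\alpha+1)\hat\beta^{\mathrm{pa}}_{m,n}\hat\beta^{\mathrm{pa}\top}_{m,n}\Big)^{-1/2}(\hat\beta^{\mathrm{pa}}_{m,n}-\beta_n)\Rightarrow\mathcal N(0,I_p).$$
   Context: Asymptotic regime: $p$ fixed, $n\to\infty$, $m=m_n\to\infty$, $m<n$; $\Rightarrow$ is convergence in distribution. The data $(X_n,y_n)$ are deterministic. $X_n$ is an $n\times p$ real matrix with SVD $X_n=U_nL_nV_n^\top$, where $U_n$ is $n\times p$ with orthonormal columns, $L_n=\mathrm{diag}(\ell_{n,1},\dots,\ell_{n,p})$, $\ell_{n,1}\ge\dots\ge\ell_{n,p}>0$, and $V_n$ is $p\times p$ orthogonal; $y_n\in\mathbb R^n$. Put $\beta_n=(X_n^\top X_n)^{-1}X_n^\top y_n$, $\varepsilon_n=y_n-X_n\beta_n$, $\bar\varepsilon_n=\varepsilon_n/\|\varepsilon_n\|$, $\bar x_n=X_n\beta_n/\|X_n\beta_n\|$ (the last two assumed well defined when used). $S_{m,n}$ is a random $m\times n$ matrix; $\tilde X_{m,n}=S_{m,n}X_n$, $\tilde y_{m,n}=S_{m,n}y_n$, $\hat\beta^{\mathrm s}_{m,n}=(\tilde X_{m,n}^\top\tilde X_{m,n})^{-1}\tilde X_{m,n}^\top\tilde y_{m,n}$, $\hat\beta^{\mathrm{pa}}_{m,n}=(\tilde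 X_{m,n}^\top\tilde X_{m,n})^{-1}X_n^\top y_n$, $\tilde\varepsilon_{m,n}=\tilde y_{m,n}-\tilde X_{m,n}\hat\beta^{\mathrm s}_{m,n}$. $\mathfrak p$ and $\mathfrak P$ are abstract conditions on sequences $(a_n,\tilde a_n)_{n\ge1}$ of pairs of unit vectors of $\mathbb R^n$ (to be specified for each distribution of sketching matrices), and $(\tau_{m,n})$ are positive scalars with $\tau_{m,n}/m\to0$. (Bounded): for any sequence $(a_n,\tilde a_n)_{n\ge1}$ of pairs of unit vectors in $\mathbb R^n$ satisfying $\mathfrak p$, $\sqrt m\,\tau_{m,n}^{-1/2}(a_n^\top S_{m,n}^\top S_{m,n}\tilde a_n-a_n^\top\tilde a_n)=O_P(1)$. (1-dim): for any sequence $(a_n,\tilde a_n)_{n\ge1}$ of pairs of unit vectors in $\mathbb R^n$ satisfying $\mathfrak P$, there is a sequence $\sigma_n^2(a_n,\tilde a_n)$, uniformly bounded away from zero and infinity, such that $\sqrt m\,\tau_{m,n}^{-1/2}\sigma_n^{-1}(a_n,\tilde a_n)(a_n^\top S_{m,n}^\top S_{m,n}\tilde a_n-a_n^\top\tilde a_n)\Rightarrow\mathcal N(0,1)$. Moreover, for all $n\ge1$ there are $M_n=M_n(\bar\varepsilon_n)$ and $M_n^{\mathrm{pa}}=M_n^{\mathrm{pa}}(\bar x_n)$ in $\mathbb R^{p\times p}$, also possibly depending on $U_n$, such that for any unit vectors $b_n\in\mathbb R^p$ with $(U_nb_n,\bar\varepsilon_n)_{n\ge1}$, $(U_nb_n,\bar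 x_n)_{n\ge1}$ satisfying $\mathfrak P$, one has $\sigma_n^2(U_nb_n,\bar\varepsilon_n)=b_n^\top M_nb_n$ and $\sigma_n^2(U_nb_n,\bar x_n)=b_n^\top M_n^{\mathrm{pa}}b_n$. (1-dim'), for $\alpha\in\{0,1\}$: the special case of (1-dim) where $\sigma_n^2(a_n,\tilde a_n)=1+(\alpha+1)(a_n^\top\tilde a_n)^2$ for all $n\ge1$ and all $(a_n,\tilde a_n)_{n\ge1}$ satisfying $\mathfrak P$.
   Formalization: Part (b) and the second display of (c) also assume that (U_n b_n, x̄_n) satisfies 𝔓 for all unit b_n; the first display of (c) also assumes that (ε̄_n, ε̄_n) satisfies 𝔭; M_n and M_n^pa are taken symmetric. Without these the claims fail. *)

(* Defs.v *)
From HB Require Import structures.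
From mathcomp Require Import all_boot all_order all_algebra.
From mathcomp Require Import all_classical all_reals all_analysis.

Set Implicit Arguments.
Unset Strict Implicit.
Unset Printing Implicit Defensive.

Import Order.TTheory GRing.Theory Num.Theory.
Import numFieldNormedType.Exports.

Local Open Scope classical_set_scope.
Local Open Scope ring_scope.

(* The norm `|v| of the library on matrices is the sup norm; the Euclidean
   one is needed here. *)
Definition enorm (R : realType) n (v : 'cV[R]_n) : R :=
  Num.sqrt (\sum_i v i ord0 ^+ 2).

Definition normalize (R : realType) n (v : 'cV[R]_n) : 'cV[R]_n :=
  (enorm v)^-1 *: v.

Definition dotv (R : realType) n (u v : 'cV[R]_n) : R :=
  (u^T *m v) ord0 ord0.

Definition qform (R : realType) n (A : 'M[R]_n) (u v : 'cV[R]_n) : R :=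
  (u^T *m A *m v) ord0 ord0.

Definition psdmx (R : realType) p (A : 'M[R]_p) : Prop :=
  A^T = A /\ forall v : 'cV[R]_p, 0 <= qform A v v.

(* The positive semidefinite square root of a positive semidefinite matrix,
   which exists and is unique; A^{-1/2} is then [invmx (sqrtmx A)]. *)
Definition sqrtmx (R : realType) p (A : 'M[R]_p) : 'M[R]_p :=
  xget 0 [set B | psdmx B /\ B *m B = A].

Definition is_svd (R : realType) n p (X : 'M[R]_(n, p))
    (U : 'M[R]_(n, p)) (l : 'rV[R]_p) (V : 'M[R]_p) : Prop :=
  [/\ X = U *m diag_mx l *m V^T,
      U^T *m U = 1%:M,
      V^T *m V = 1%:M,
      (forall i j : 'I_p, (i <= j)%N -> l ord0 j <= l ord0 i) &
      (forall i : 'I_p, 0 < l ord0 i)].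

(* [ls_est X y] is also the sketch-and-solve estimator when applied to the
   sketched data. As [invmx A = A] for singular [A], these functions are total;
   they are the estimators whenever the Gram matrix is invertible. *)
Definition ls_est (R : realType) n p (X : 'M[R]_(n, p)) (y : 'cV[R]_n) :
    'cV[R]_p :=
  invmx (X^T *m X) *m X^T *m y.

Definition partial_est (R : realType) k n p (Xt : 'M[R]_(k, p))
    (X : 'M[R]_(n, p)) (y : 'cV[R]_n) : 'cV[R]_p :=
  invmx (Xt^T *m Xt) *m X^T *m y.

Definition residual (R : realType) n p (X : 'M[R]_(n, p)) (y : 'cV[R]_n) :
    'cV[R]_n :=
  y - X *m ls_est X y.

(* N(0, I_p) is built as the p-fold product of N(0, 1), on p-tuples because
   these carry the product sigma-algebra; [cV_of_tuple] reads a tuple as a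
   vector of R^p. *)
Section standard_normal_vector.
Context {R : realType}.
Let R1 : measurableType _ := measurableTypeR R.

Definition tuple_cons p (x : R1 * p.-tuple R1) : p.+1.-tuple R1 :=
  [the p.+1.-tuple R1 of x.1 :: x.2].

Lemma measurable_tuple_cons p : measurable_fun [set: R1 * p.-tuple R1]
  (@tuple_cons p).
Proof.
apply: measurable_cons; first exact: measurable_fst.
exact: measurable_snd.
Qed.

HB.instance Definition _ p := isMeasurableFun.Build _ _ _ _
  (@tuple_cons p) (@measurable_tuple_cons p).

Fixpoint std_normal (p : nat) : probability (p.-tuple R1) R :=
  match p return probability (p.-tuple R1) R with
  | 0 => \d_([tuple] : 0.-tuple R1)
  | q.+1 => distribution
      ((normal_prob (0 : R) 1 : probability R1 R) \x std_normal q)%E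
      (@tuple_cons q)
  end.

Definition cV_of_tuple p (t : p.-tuple R1) : 'cV[R]_p := \col_i tnth t i.

End standard_normal_vector.

(* Convergence in distribution of the random elements [Y n], defined on
   [(T, P)], to the random element [Z], defined on [(T', Q)]. *)
Definition cvg_distr (R : realType) (E : topologicalType)
    (d : measure_display) (T : measurableType d) (P : probability T R)
    (Y : nat -> T -> E)
    (d' : measure_display) (T' : measurableType d') (Q : probability T' R)
    (Z : T' -> E) : Prop :=
  forall f : E -> R, continuous f -> (exists K, forall x, `|f x| <= K) ->
    ('E_P[fun w => f (Y n w)] @[n --> \oo] --> 'E_Q[fun z => f (Z z)])%E.

Definition cvg_std_normal1 (R : realType) (d : measure_display)
    (T : measurableType d) (P : probability T R) (Y : nat -> T -> R) : Prop :=
  cvg_distr P Y (normal_prob (0 : R) 1 : probability (measurableTypeR R) R) id.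

Definition cvg_std_normal (R : realType) (d : measure_display)
    (T : measurableType d) (P : probability T R) p
    (Y : nat -> T -> 'cV[R]_p) : Prop :=
  cvg_distr P Y (std_normal p) (@cV_of_tuple R p).

Definition OP1 (R : realType) (d : measure_display) (T : measurableType d)
    (P : probability T R) (Y : nat -> T -> R) : Prop :=
  forall e : R, 0 < e -> exists K : R,
    \forall n \near \oo, (P [set w | K < `|Y n w|]%R <= e%:E)%E.

(* Sequences (a_n) with a_n in R^n. An n x p matrix with orthonormal columns
   and a nonzero vector orthogonal to them exist only if p < n, so "for all n"
   is read as "for all n > p", here and below; entries with n <= p are
   irrelevant. *)
Definition vecseq (R : realType) := forall n : nat, 'cV[R]_n.

Definition unit_seq (R : realType) (p : nat) (a : vecseq R) : Prop :=
  forall n, (p < n)%N -> enorm (a n) = 1.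

(* (a, a') is a sequence of pairs of unit vectors satisfying the condition C.
   When a or a' is [fun n => normalize (v n)], unitness says v n != 0. *)
Definition sat (R : realType) (p : nat) (C : vecseq R -> vecseq R -> Prop)
    (a a' : vecseq R) : Prop :=
  [/\ unit_seq p a, unit_seq p a' & C a a'].

Section conditions.
Context {R : realType} {d : measure_display} {T : measurableType d}.
Variables (P : probability T R) (p : nat).
Variables (m : nat -> nat) (tau : nat -> nat -> R).
Variable S : forall k n, T -> 'M[R]_(k, n).

Definition rate (n : nat) : R :=
  Num.sqrt (m n)%:R * (Num.sqrt (tau (m n) n))^-1.

Definition sketch_err (a a' : vecseq R) (n : nat) (w : T) : R :=
  qform ((S (m n) n w)^T *m S (m n) n w) (a n) (a' n) - dotv (a n) (a' n).

(* Condition (Bounded), for the condition [C] in the role of fraktur p. *)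
Definition bounded_cond (C : vecseq R -> vecseq R -> Prop) : Prop :=
  forall a a' : vecseq R, sat p C a a' ->
    OP1 P (fun n w => rate n * sketch_err a a' n w).

(* Condition (1-dim), for the condition [C] in the role of fraktur P; the
   matrices [M n] and [Mpa n] are symmetric since they are the variance forms
   whose inverse square roots are used. *)
Definition one_dim_cond (C : vecseq R -> vecseq R -> Prop)
    (U : forall n, 'M[R]_(n, p)) (ebar xbar : vecseq R)
    (sigma2 : forall n, 'cV[R]_n -> 'cV[R]_n -> R)
    (M Mpa : nat -> 'M[R]_p) : Prop :=
  [/\ (forall a a' : vecseq R, sat p C a a' ->
        (exists c1 c2 : R, 0 < c1 /\
          forall n, (p < n)%N -> c1 <= sigma2 n (a n) (a' n) <= c2) /\
        cvg_std_normal1 P (fun n w =>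
          rate n * (Num.sqrt (sigma2 n (a n) (a' n)))^-1 *
          sketch_err a a' n w)),
      (forall n, (p < n)%N -> (M n)^T = M n /\ (Mpa n)^T = Mpa n) &
      (forall b : nat -> 'cV[R]_p, (forall n, enorm (b n) = 1) ->
        (sat p C (fun n => U n *m b n) ebar ->
          forall n, (p < n)%N ->
            sigma2 n (U n *m b n) (ebar n) = qform (M n) (b n) (b n)) /\
        (sat p C (fun n => U n *m b n) xbar ->
          forall n, (p < n)%N ->
            sigma2 n (U n *m b n) (xbar n) = qform (Mpa n) (b n) (b n)))].

Definition one_dim_cond' (alpha : nat) (C : vecseq R -> vecseq R -> Prop)
    (U : forall n, 'M[R]_(n, p)) (ebar xbar : vecseq R)
    (sigma2 : forall n, 'cV[R]_n -> 'cV[R]_n -> R)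
    (M Mpa : nat -> 'M[R]_p) : Prop :=
  one_dim_cond C U ebar xbar sigma2 M Mpa /\
  forall a a' : vecseq R, sat p C a a' -> forall n, (p < n)%N ->
    sigma2 n (a n) (a' n) = 1 + alpha.+1%:R * dotv (a n) (a' n) ^+ 2.

End conditions.

(* Main.v *)
Require Import Defs.
From HB Require Import structures.
From mathcomp Require Import all_boot all_order all_algebra.
From mathcomp Require Import all_classical all_reals all_analysis measurable_realfun.
From mathcomp Require Import ring lra.
From mathcomp Require Import spectral complex.

Set Implicit Arguments.
Unset Strict Implicit.
Unset Printing Implicit Defensive.

Import Order.TTheory GRing.Theory Num.Theory.
Import numFieldNormedType.Exports.

Local Open Scope classical_set_scope.
Local Open Scope ring_scope.

(** The proof reduces the four limits to a single statement about a random
    vector of fixed dimension p.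

    Write G = U^T S^T S U. In the coordinates of the singular value
    decomposition, the error of the sketch-and-solve estimator is
    |eps| V L^-1 G^-1 U^T S^T S ebar, where ebar is orthogonal to the columns
    of U. The error of the partial estimator is
    - |X beta| V L^-1 G^-1 (G - 1) u, where u = U^T xbar. Both are thus a
    deterministic matrix times G^-1 times the centered sketched products
    cross a = rate (U^T S^T S a - U^T a), up to sign, with a = ebar or
    a = xbar. The projection of cross a on b is a rescaled error of the pair
    (U b, a), so its limit is known for every sequence b of unit vectors.
    Applied to the pairs (U b, U b), the same hypothesis shows that G tends to
    1 in probability (sketched_gram_cvg).

    After division of V L by the largest singular value, which leaves a matrix
    A such that A and A^-1 are bounded, each statistic takes the form
    s C A^-T G^-1 Z. Here Z = cross a up to sign has the variance form Sg, the
    scalar s tends to 1, and C is positive semidefinite with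
    C^2 = A W^-1 A^T for some W close to Sg: W is Sg itself in the first two limits,
    and an estimate of it in the last two. Then C is close to the root C0 of A Sg^-1 A^T,
    by a Lipschitz bound for square roots (root_lip). The matrix Q = C0 A^-T
    satisfies Q Sg Q^T = 1. Since directions may vary with n, the projection
    of Q Z on any fixed unit vector is asymptotically N(0, 1) (whiten_cvg). The
    bounds on the variances along the coordinate vectors and along the rows of
    Q show that Q and Q^-1 are bounded. So the statistic is (1 + o_P(1)) Q Z,
    and it remains to go from the projections of Q Z to the vector itself
    (studentized_clt, and svd_clt for its regression form).

    That last step is the combination of the theorems of Cramer-Wold and
    Slutsky (cramer_wold_slutsky). The convergence of projections is the
    convergence of the characteristic functions, hence of the means of
    trigonometric polynomials, to those of the standard normal vector; the
    limits are identified through the stability of the normal law under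
    linear combinations (normal_stable). A continuous function bounded by K is
    uniformly close on a large cube to a trigonometric polynomial with the same
    bound K everywhere (trig_approx, by Bernstein polynomials in the sines of
    the coordinates), and tightness takes care of the complement of the cube.
    Statements in probability are limits along the filter whp. *)

(** * Gaussian integrals *)

Section gaussian_integrals.
Context {R : realType}.
Notation mu := (@lebesgue_measure R).
Notation N01 := (normal_prob (0 : R) 1 : probability (measurableTypeR R) R).

Lemma integral_normal01 (h : R -> \bar R) (K : R) :
  measurable_fun setT h -> (forall x, 0 <= h x <= K%:E)%E ->
  (\int[N01]_x h x = \int[mu]_x (h x * (normal_pdf 0 1 x)%:E))%E.
Proof.
move=> mh hK.
have ih : N01.-integrable setT h.
  apply: (@le_integrable _ _ _ _ _ _ _ (EFin \o cst K)) => //=.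
  - move=> x _; rewrite gee0_abs ?(andP (hK x)).1 // (le_trans (andP (hK x)).2) //.
    by rewrite lee_fin ler_norm.
  - exact: finite_measure_integrable_cst.
rewrite -(Radon_Nikodym_change_of_variables (normal_prob_dominates 0 1))//=.
apply: ae_eq_integral => //.
- apply: emeasurable_funM => //.
  apply: (measurable_int mu).
  by apply: Radon_Nikodym_integrable; exact: normal_prob_dominates.
- apply: emeasurable_funM => //; apply/measurable_EFinP.
  exact: measurable_normal_pdf.
- apply: ae_eqe_mul2l => /=.
  rewrite Radon_NikodymE//=; first exact: normal_prob_dominates.
  move=> abmu.
  case: cid => /= k [h1 h2 h3].
  apply: integral_ae_eq => //=.
  + by apply/measurable_EFinP; exact: measurable_normal_pdf.
  + by move=> E E01 mE; rewrite -h3.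
Qed.

(** The law of a + c Y, for Y standard normal, has the density of N(a, c^2):
    substitute u = a + c y. *)
Lemma normal_sub (h : R -> R) (a c : R) : 0 < c ->
  continuous h -> (forall x, 0 <= h x) ->
  (\int[mu]_y (h (a + c * y) * normal_pdf 0 1 y)%:E =
   \int[mu]_u (h u * normal_pdf a c u)%:E)%E.
Proof.
move=> c0 ch h0.
pose F (u : R) := c^-1 * (u - a).
have dF (x : R) : is_derive x 1 F c^-1.
  by rewrite /F; apply: is_derive_eq; rewrite oppr0 addr0 scaler1.
have F'E : F^`()%classic = cst c^-1.
  by apply/funext => x; rewrite derive1E (@derive_val _ _ _ _ _ _ _ (dF x)).
rewrite (@increasing_ge0_integration_by_substitutionT _ F); first last.
- by move=> x; rewrite mulr_ge0// normal_pdf_ge0.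
- move=> x; apply: (@cvgM R).
    apply: (cvg_comp (fun y => a + c * y) h); last exact: ch.
    by apply: cvgD; [exact: cvg_cst|apply: cvgM; [exact: cvg_cst|exact: cvg_id]].
  exact: continuous_normal_pdf.
- rewrite /F; under eq_fun do rewrite mulrC.
  apply/gt0_cvgMly; last exact: cvg_addrr.
  by rewrite invr_gt0.
- rewrite /F; under eq_fun do rewrite mulrC.
  apply/gt0_cvgMlNy; last exact: cvg_addrr_Ny.
  by rewrite invr_gt0.
- by move=> x; exact: (@ex_derive _ _ _ _ _ _ _ (dF x)).
- by rewrite F'E; exact: is_cvg_cst.
- by rewrite F'E; exact: is_cvg_cst.
- by rewrite F'E => ?; exact: cvg_cst.
- by move=> x y xy; rewrite /F ltr_pM2l ?invr_gt0// ltrD2r.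
apply: eq_integral => x _; rewrite F'E /= !fctE /=; congr EFin.
rewrite /F mulrA divff ?gt_eqF// mul1r addrC subrK -mulrA; congr (_ * _).
rewrite !normal_pdfE ?oner_eq0 ?gt_eqF// /normal_peak /normal_fun subr0.
rewrite expr1n mul1r mulrAC; congr (_ * _).
  rewrite -mulrnAr sqrtrM ?sqr_ge0// sqrtr_sqr gtr0_norm// invfM mulrC//.
by congr expR; rewrite exprMn; field; rewrite gt_eqF.
Qed.

(** Reversibility of the Gaussian autoregression u = s x + c y: the pair
    (x, u) has an exchangeable joint density. *)
Lemma normal_pdf_swap (s c x u : R) : 0 < c -> c ^+ 2 + s ^+ 2 = 1 ->
  normal_pdf 0 1 x * normal_pdf (s * x) c u =
  normal_pdf 0 1 u * normal_pdf (s * u) c x.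
Proof.
move=> c0 cs.
rewrite !normal_pdfE ?oner_eq0 ?gt_eqF// /normal_fun !subr0 !expr1n.
rewrite mulrACA [RHS]mulrACA -!expRD; congr (_ * expR _).
have c0' : c != 0 by rewrite gt_eqF.
have s2 : s ^+ 2 = 1 - c ^+ 2 by rewrite -cs; ring.
have E (z w : R) : (w - s * z) ^+ 2 = w ^+ 2 - 2 * s * z * w + (1 - c ^+ 2) * z ^+ 2.
  by rewrite -s2; ring.
by rewrite !E; field.
Qed.

Lemma measurable_normal_pdf2 (s c : R) : 0 < c ->
  measurable_fun [set: measurableTypeR R * measurableTypeR R]
    (fun z => normal_pdf (s * z.1) c z.2 : R).
Proof.
move=> c0; have -> : (fun z : measurableTypeR R * measurableTypeR R =>
    normal_pdf (s * z.1) c z.2 : R) =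
   (fun z => normal_peak c * expR (- (z.2 - s * z.1) ^+ 2 / (c ^+ 2 *+ 2))).
  by apply/funext => z; rewrite normal_pdfE ?gt_eqF.
apply: measurable_funM => //; apply: measurableT_comp => //.
apply: measurable_funM => //; apply: measurableT_comp => //.
apply: measurable_funX; apply: measurable_funB; first exact: measurable_snd.
by apply: measurable_funM => //; exact: measurable_fst.
Qed.

(** For fixed x, the inner integral is the integral of h against the density
    of N(s x, c^2) in u = s x + c y. By normal_pdf_swap the joint density is
    symmetric in (x, u), so that after exchanging the integrals the variable x
    integrates out and u is standard normal. *)
Lemma normal_rotation (h : R -> R) (K s c : R) : 0 < c -> c ^+ 2 + s ^+ 2 = 1 ->
  continuous h -> (forall x, 0 <= h x <= K) ->
  (\int[N01]_x \int[N01]_y (h (s * x + c * y))%:E = \int[N01]_x (h x)%:E)%E.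
Proof.
move=> c0 cs ch hK.
have h0 x : 0 <= h x by case/andP: (hK x).
have hKe x : (0 <= (h x)%:E <= K%:E)%E by rewrite !lee_fin.
have mh : measurable_fun setT h by exact: continuous_measurable_fun.
have p0 a b x : 0 <= normal_pdf a b x :> R by exact: normal_pdf_ge0.
have inner x : (\int[N01]_y (h (s * x + c * y))%:E =
    \int[mu]_u (h u * normal_pdf (s * x) c u)%:E)%E.
  rewrite -normal_sub// (@integral_normal01 _ K)//.
  apply/measurable_EFinP; apply: measurableT_comp => //.
  by apply: measurable_funD => //; exact: measurable_funM.
have innerK : forall x, ((0 <= \int[N01]_y (h (s * x + c * y))%:E) && (\int[N01]_y (h (s * x + c * y))%:E <= K%:E))%E.
  move=> x; apply/andP; split; first by apply: integral_ge0 => y _; rewrite lee_fin.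
  have -> : K%:E = (\int[N01]_y (cst K%:E y))%E by rewrite integral_cst//= probability_setT mule1.
  apply: ge0_le_integral => //.
  - by move=> y _; rewrite lee_fin.
  - apply/measurable_EFinP; apply: measurableT_comp => //.
    by apply: measurable_funD => //; exact: measurable_funM.
  - by move=> y _; rewrite lee_fin; case/andP: (hK (s * x + c * y)).
pose f (z : measurableTypeR R * measurableTypeR R) :=
  (h z.2 * normal_pdf (s * z.1) c z.2)%:E.
have mf : measurable_fun setT f.
  apply/measurable_EFinP; apply: measurable_funM.
    by apply: measurableT_comp => //; exact: measurable_snd.
  exact: measurable_normal_pdf2.
have f0 z : (0 <= f z)%E by rewrite lee_fin mulr_ge0.
have mF : measurable_fun setT (fubini_F lebesgue_measure f).
  exact: measurable_fun_fubini_tonelli_F.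
rewrite (@integral_normal01 _ K)//; last first.
  by apply: eq_measurable_fun mF => x _; rewrite /fubini_F inner.
pose g (z : measurableTypeR R * measurableTypeR R) := (f z * (normal_pdf 0 1 z.1)%:E)%E.
have mp1 : measurable_fun [set: measurableTypeR R * measurableTypeR R]
   (fun z => (normal_pdf 0 1 z.1 : R)%:E).
  apply/measurable_EFinP; apply: (@measurableT_comp _ _ _ _ _ _ (normal_pdf 0 1 : R -> R)).
    exact: measurable_normal_pdf.
  exact: measurable_fst.
transitivity (\int[mu]_x \int[mu]_u g (x, u))%E.
  apply: eq_integral => x _; rewrite inner /g /f /= -ge0_integralZr//.
  - apply/measurable_EFinP; apply: measurable_funM => //.
    exact: measurable_normal_pdf.
  - by move=> u _; rewrite lee_fin mulr_ge0.
  - by rewrite lee_fin.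
transitivity (\int[mu]_u \int[mu]_x g (x, u))%E.
  apply: (@fubini_tonelli _ _ (measurableTypeR R) (measurableTypeR R) R mu mu g).
    exact: emeasurable_funM.
  by move=> z; rewrite mule_ge0// lee_fin.
rewrite (@integral_normal01 _ K)//; last exact/measurable_EFinP.
apply: eq_integral => u _; rewrite /g /f /=.
transitivity (\int[mu]_x ((h u * normal_pdf 0 1 u)%:E * (normal_pdf (s * u) c x)%:E))%E.
  apply: eq_integral => x _; rewrite -!EFinM; congr EFin.
  by rewrite -mulrA -mulrA [_ * normal_pdf 0 1 x]mulrC normal_pdf_swap.
rewrite ge0_integralZl//.
- by rewrite integral_normal_pdf mule1 EFinM.
- by apply/measurable_EFinP; exact: measurable_normal_pdf.
- by move=> x _; rewrite lee_fin.
- by rewrite lee_fin mulr_ge0.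
Qed.

Lemma normal_sym (h : R -> R) (K : R) :
  continuous h -> (forall x, 0 <= h x <= K) ->
  (\int[N01]_x (h (- x))%:E = \int[N01]_x (h x)%:E)%E.
Proof.
move=> ch hK.
have h0 x : 0 <= h x by case/andP: (hK x).
have hKe x : (0 <= (h x)%:E <= K%:E)%E by rewrite !lee_fin.
have mh : measurable_fun setT h by exact: continuous_measurable_fun.
rewrite !(@integral_normal01 _ K)//; last 2 first.
- exact/measurable_EFinP.
- by apply/measurable_EFinP; apply: measurableT_comp.
pose k x : R := h x * normal_pdf 0 1 x.
have mk : measurable_fun setT (EFin \o k).
  apply/measurable_EFinP; apply: measurable_funM => //.
  exact: measurable_normal_pdf.
transitivity (\int[mu]_x (EFin \o k) x)%E; last by apply: eq_integral.
transitivity (\int[mu]_x ((EFin \o k) \o (-%R : _ -> measurableTypeR R)) x)%E.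
  apply: eq_integral => x _ /=; rewrite /k -EFinM !normal_pdfE ?oner_eq0//.
  by rewrite /normal_fun !subr0 sqrrN.
have := @ge0_integral_pushforward _ _ (measurableTypeR R) (measurableTypeR R) R
  (-%R : measurableTypeR R -> measurableTypeR R) _ mu setT (EFin \o k).
rewrite preimage_setT => <-//; last by move=> x _; rewrite lee_fin mulr_ge0// normal_pdf_ge0.
apply: eq_measure_integral => A mA _; exact: lebesgue_measureN.
Qed.

(** Reduced to normal_rotation by scaling (a, b) to the unit circle; the
    rotation needs a positive coefficient in front of y, hence the separate
    case b = 0, where the sign of a is removed by symmetry. *)
Lemma normal_stable (h : R -> R) (K a b : R) : 0 <= b ->
  continuous h -> (forall x, 0 <= h x <= K) ->
  (\int[N01]_x \int[N01]_y (h (a * x + b * y))%:E =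
   \int[N01]_x (h (Num.sqrt (a ^+ 2 + b ^+ 2) * x))%:E)%E.
Proof.
move=> b0 ch hK.
have chr (r : R) : continuous (fun x : R => h (r * x)).
  by move=> x; apply: continuous_comp; [exact: mulrl_continuous|exact: ch].
move: b0; rewrite le_eqVlt => /predU1P[<-|b0].
  rewrite expr0n/= addr0 sqrtr_sqr.
  transitivity (\int[N01]_x (h (a * x))%:E)%E.
    apply: eq_integral => x _.
    under eq_integral do rewrite mul0r addr0.
    by rewrite integral_cst//= probability_setT mule1.
  have [a0|a0] := leP 0 a; [by rewrite ger0_norm|rewrite ltr0_norm//].
  rewrite -(@normal_sym (fun x => h (- a * x)) K)//.
  by apply: eq_integral => x _; rewrite mulrNN.
set r := Num.sqrt _.
have r0 : 0 < r by rewrite sqrtr_gt0 ltr_wpDl ?sqr_ge0// exprn_gt0.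
have rE : r ^+ 2 = a ^+ 2 + b ^+ 2 by rewrite sqr_sqrtr// addr_ge0// sqr_ge0.
rewrite -(@normal_rotation (fun x => h (r * x)) K (a / r) (b / r))//.
- apply: eq_integral => x _; apply: eq_integral => y _; congr (EFin (h _)).
  by field; rewrite gt_eqF.
- by rewrite divr_gt0.
- by rewrite !exprMn -mulrDl [b ^+ 2 + _]addrC -rE exprVn divff// expf_neq0// gt_eqF.
Qed.

End gaussian_integrals.

(** * Projections of a standard normal vector *)

Section standard_normal_projections.
Context {R : realType}.
Notation mu := (@lebesgue_measure R).
Notation N01 := (normal_prob (0 : R) 1 : probability (measurableTypeR R) R).

(** Induction on the dimension: the first coordinate is independent of the
    others, whose linear combination is by induction a multiple of one normal
    variable, and normal_stable adds the two. *)
Lemma std_normal_dot_tuple p (t : 'I_p -> R) (h : R -> R) (K : R) :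
  continuous h -> (forall x, 0 <= h x <= K) ->
  (\int[std_normal p]_z (h (\sum_i t i * tnth z i))%:E =
   \int[N01]_x (h (Num.sqrt (\sum_i t i ^+ 2) * x))%:E)%E.
Proof.
have mt q (u : 'I_q -> R) : measurable_fun [set: q.-tuple (measurableTypeR R)]
    (fun z => \sum_i u i * tnth z i).
  apply: measurable_sum => i; apply: measurable_funM => //.
  exact: measurable_tnth.
elim: p t h => [|q IH] t h ch hK.
  rewrite /= integral_dirac//=; last first.
    apply/measurable_EFinP; apply: measurableT_comp => //.
      exact: continuous_measurable_fun.
    exact: mt.
  rewrite diracT mul1e !big_ord0 sqrtr0.
  under eq_integral do rewrite mul0r.
  by rewrite integral_cst//= probability_setT mule1.
have h0 x : 0 <= h x by case/andP: (hK x).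
have mh : measurable_fun setT h by exact: continuous_measurable_fun.
rewrite /= ge0_integral_distribution; last 2 first.
- apply/measurable_EFinP; apply: measurableT_comp => //; exact: mt.
- by move=> z; rewrite lee_fin.
pose f (z : measurableTypeR R * q.-tuple (measurableTypeR R)) :=
  (h (t ord0 * z.1 + \sum_i t (lift ord0 i) * tnth z.2 i))%:E.
transitivity (\int[(N01 \x std_normal q)]_z f z)%E.
  apply: eq_integral => z _; rewrite /f /= big_ord_recl/=; congr (EFin (h (_ + _))).
  by apply: eq_bigr => i _; rewrite (tnth_nth 0) (tnth_nth 0).
have mf : measurable_fun setT f.
  apply/measurable_EFinP; apply: measurableT_comp => //.
  apply: measurable_funD; first by apply: measurable_funM => //; exact: measurable_fst.
  apply: (measurableT_comp (mt q (fun i => t (lift ord0 i)))).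
  exact: measurable_snd.
rewrite (fubini_tonelli1 f)//; last by move=> z; rewrite lee_fin.
rewrite big_ord_recl/=.
set b := \sum_(i < q) t (lift ord0 i) ^+ 2.
have b0 : 0 <= b by apply: sumr_ge0 => i _; exact: sqr_ge0.
rewrite -{1}(sqr_sqrtr b0) -(@normal_stable _ h K) ?sqrtr_ge0//.
apply: eq_integral => x _.
rewrite /fubini_F /f /=.
apply: (IH (fun i => t (lift ord0 i)) (fun y => h (t ord0 * x + y))) => // y.
apply: continuous_comp; last exact: ch.
by apply: cvgD; [exact: cvg_cst|exact: cvg_id].
Qed.

Lemma dotvE n (u v : 'cV[R]_n) : dotv u v = \sum_i u i ord0 * v i ord0.
Proof. by rewrite /dotv mxE; apply: eq_bigr => i _; rewrite mxE. Qed.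

Lemma std_normal_dot p (t : 'cV[R]_p) (h : R -> R) (K : R) :
  continuous h -> (forall x, 0 <= h x <= K) ->
  (\int[std_normal p]_z (h (dotv t (cV_of_tuple z)))%:E =
   \int[N01]_x (h (enorm t * x))%:E)%E.
Proof.
move=> ch hK; rewrite -(@std_normal_dot_tuple p (fun i => t i ord0) h K)//.
apply: eq_integral => z _; rewrite dotvE; congr (EFin (h _)).
by apply: eq_bigr => i _; rewrite mxE.
Qed.
End standard_normal_projections.

(** * Expectations of bounded functions *)

Section bounded_expectations.
Context {R : realType} {d : measure_display} {T : measurableType d}.
Variable P : probability T R.
Implicit Types X Y : T -> R.

Definition mean X : R := fine 'E_P[X].

(** The integral of a nonnegative function is the supremum of the integrals of
    the simple functions below it, so it is monotone without any
    measurability. It applies to statistics built from matrix inverses and square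
    roots, whose measurability is not known. *)
Lemma le_integral_nonmeas (f g : T -> \bar R) : (forall w, f w <= g w)%E ->
  (\int[P]_w f w <= \int[P]_w g w)%E.
Proof.
move=> fg.
have mono (u v : T -> \bar R) : (forall w, 0 <= u w)%E -> (forall w, u w <= v w)%E ->
    (\int[P]_w u w <= \int[P]_w v w)%E.
  move=> u0 uv.
  have v0 w : (0 <= v w)%E by exact: le_trans (u0 w) (uv w).
  rewrite !ge0_integralTE//; apply: ge_ereal_sup => _ /= [k ku <-].
  apply: ereal_sup_ubound => /=; exists k => // w.
  exact: le_trans (ku w) (uv w).
rewrite integralE [leRHS]integralE leeB//.
- by apply: mono => // w; apply: (@funepos_le _ _ setT f g); rewrite ?inE.
- by apply: mono => // w; apply: (@funeneg_le _ _ setT f g); rewrite ?inE.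
Qed.

Lemma expectation_bounded X (K : R) : (forall w, `|X w| <= K) ->
  ('E_P[X] = (mean X)%:E)%E /\ `|mean X| <= K.
Proof.
move=> XK.
have cE (c : R) : (\int[P]_w (cst c%:E w) = c%:E)%E.
  by rewrite integral_cst//= probability_setT mule1.
have h1 : ('E_P[X] <= K%:E)%E.
  rewrite expectation.unlock -cE; apply: le_integral_nonmeas => w /=.
  by rewrite lee_fin (le_trans (ler_norm _) (XK w)).
have h2 : ((- K)%:E <= 'E_P[X])%E.
  rewrite expectation.unlock -cE; apply: le_integral_nonmeas => w /=.
  by rewrite lee_fin lerNl (le_trans _ (XK w))// -normrN ler_norm.
have fX : ('E_P[X] \is a fin_num)%E.
  by rewrite fin_numE; apply/andP; split; apply/eqP => E; rewrite E in h1 h2.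
rewrite /mean fineK//; split => //.
by rewrite ler_norml -!lee_fin fineK// h1 h2.
Qed.

Lemma ge_mean X Y (K : R) : (forall w, `|X w| <= K) -> (forall w, `|Y w| <= K) ->
  (forall w, X w <= Y w) -> mean X <= mean Y.
Proof.
move=> XK YK XY; rewrite -lee_fin -(expectation_bounded XK).1 -(expectation_bounded YK).1.
by rewrite expectation.unlock; apply: le_integral_nonmeas => w; rewrite lee_fin.
Qed.

Lemma bounded_Lfun1 X (K : R) : measurable_fun setT X -> (forall w, `|X w| <= K) ->
  X \in Lfun P 1.
Proof.
move=> mX XK; rewrite inE; apply/Lfun1_integrable.
apply: measurable_bounded_integrable => //.
  by rewrite /= probability_setT ltry.
exists K; split; first by rewrite num_real.
by move=> x Kx w _; exact: le_trans (XK w) (ltW Kx).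
Qed.

Lemma meanD X Y (K : R) : measurable_fun setT X -> measurable_fun setT Y ->
  (forall w, `|X w| <= K) -> (forall w, `|Y w| <= K) ->
  mean (fun w => X w + Y w) = mean X + mean Y.
Proof.
move=> mX mY XK YK.
have e := expectationD (bounded_Lfun1 mX XK) (bounded_Lfun1 mY YK).
rewrite /mean (_ : (fun w => X w + Y w) = X \+ Y)// e.
by rewrite (expectation_bounded XK).1 (expectation_bounded YK).1.
Qed.

Lemma meanZ (c : R) X (K : R) : measurable_fun setT X -> (forall w, `|X w| <= K) ->
  mean (fun w => c * X w) = c * mean X.
Proof.
move=> mX XK; have e := expectationZl c (bounded_Lfun1 mX XK).
rewrite /mean (_ : (fun w => c * X w) = c \o* X); last first.
  by apply/funext => w /=; rewrite mulrC.
by rewrite e (expectation_bounded XK).1.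
Qed.

Lemma mean_cst (c : R) : mean (fun=> c) = c.
Proof. by rewrite /mean (_ : (fun=> c) = cst c)// expectation_cst. Qed.

Lemma mean_indic (A : set T) : measurable A -> mean (\1_A) = fine (P A).
Proof. by move=> mA; rewrite /mean expectation_indic. Qed.

(** X lies between Y - (e + 2 K 1_B) and Y + (e + 2 K 1_B). These two bounds
    are measurable, so their means can be computed, and the mean of X is
    between them by monotonicity. *)
Lemma mean_close X Y (K e dl : R) (B : set T) : measurable B ->
  measurable_fun setT Y ->
  (forall w, `|X w| <= K) -> (forall w, `|Y w| <= K) ->
  0 <= K -> 0 <= e -> (P B <= dl%:E)%E ->
  (forall w, ~ B w -> `|X w - Y w| <= e) ->
  `|mean X - mean Y| <= e + 2 * K * dl.
Proof.
move=> mB mY XK YK K0 e0 PB XY.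
have indB w : 0 <= (\1_B w : R) <= 1 by rewrite indicE ler0n lern1 leq_b1.
have mI : measurable_fun setT (\1_B : T -> R) by exact: measurable_indic.
have nI w : `|\1_B w : R| <= 1 by case/andP: (indB w) => ? ?; rewrite ger0_norm.
have PBf : fine (P B) <= dl by rewrite -lee_fin fineK// fin_num_measure.
have PB0 : 0 <= fine (P B) by exact: fine_ge0.
pose U (s : R) w := Y w + s * (e + 2 * K * \1_B w).
have UE s : mean (U s) = mean Y + s * (e + 2 * K * fine (P B)).
  rewrite (@meanD Y _ (K + `|s| * (e + 2 * K)))//.
  - congr (_ + _); rewrite (@meanZ s _ (e + 2 * K)).
    + congr (_ * _); rewrite (@meanD _ _ (e + 2 * K))//.
      * by rewrite mean_cst (@meanZ _ _ 1)// mean_indic.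
      * exact: measurable_funM.
      * by move=> w; rewrite ger0_norm// lerDl mulr_ge0.
      * move=> w; rewrite normrM (@ger0_norm _ (2 * K)) ?mulr_ge0//.
        by rewrite ler_wpDl// ler_piMr// mulr_ge0.
    + by apply: measurable_funD => //; exact: measurable_funM.
    + move=> w; have /andP[i0 i1] := indB w.
      rewrite ger0_norm; last by rewrite addr_ge0// !mulr_ge0.
      by rewrite lerD2l ler_piMr// mulr_ge0.
  - apply: measurable_funM => //.
    by apply: measurable_funD => //; exact: measurable_funM.
  - by move=> w; rewrite (le_trans (YK w))// lerDl mulr_ge0// addr_ge0// mulr_ge0.
  - move=> w; rewrite normrM ler_wpDl// ler_wpM2l//.
    have /andP[i0 i1] := indB w.
    rewrite ger0_norm; last by rewrite addr_ge0// !mulr_ge0.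
    by rewrite lerD2l ler_piMr// mulr_ge0.
have UK (s : R) w : `|s| <= 1 -> `|U s w| <= K + (e + 2 * K).
  move=> s1; rewrite (le_trans (ler_normD _ _))// lerD// normrM.
  have /andP[i0 i1] := indB w.
  rewrite (@ger0_norm _ (_ + _)); last by rewrite addr_ge0// !mulr_ge0.
  rewrite -[leRHS]mul1r ler_pM//; first by rewrite addr_ge0// !mulr_ge0.
  by rewrite lerD2l ler_piMr// mulr_ge0.
have XK' w : `|X w| <= K + (e + 2 * K).
  by rewrite (le_trans (XK w))// lerDl addr_ge0// mulr_ge0.
have key w : `|X w - Y w| <= e + 2 * K * \1_B w.
  rewrite indicE; have [wB|wB] := boolP (w \in B).
    rewrite mulr1 (le_trans (ler_normB _ _))// ler_wpDl//.
    by rewrite mulrDl mul1r lerD.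
  by rewrite mulr0 addr0; apply: XY => /mem_set; apply/negP.
have lb : mean (U (-1)) <= mean X.
  apply: (@ge_mean _ _ (K + (e + 2 * K))) => //.
  - by move=> w; apply: UK; rewrite normrN normr1.
  - move=> w; rewrite /U mulN1r; have := key w; rewrite ler_norml => /andP[]; lra.
have ub : mean X <= mean (U 1).
  apply: (@ge_mean _ _ (K + (e + 2 * K))) => //.
  - by move=> w; apply: UK; rewrite normr1.
  - move=> w; rewrite /U mul1r; have := key w; rewrite ler_norml => /andP[]; lra.
rewrite !UE in lb ub.
have : 2 * K * fine (P B) <= 2 * K * dl by rewrite ler_wpM2l// mulr_ge0.
rewrite ler_norml; move: lb ub; rewrite mulN1r mul1r => *; apply/andP; split; lra.
Qed.
End bounded_expectations.

(** * Trigonometric polynomials and characteristic functions *)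

Section trigpoly.
Context {R : realType}.

(** Real trigonometric polynomials on R^p, presented by phase-shifted cosines
    so that the class is closed under products by the product-to-sum formula
    and so that their means are determined by the characteristic function. *)
Inductive trigpoly p : ('cV[R]_p -> R) -> Prop :=
| trig_cos t th : trigpoly (fun x => cos (dotv t x + th))
| trig_add f g : trigpoly f -> trigpoly g -> trigpoly (fun x => f x + g x)
| trig_scale c f : trigpoly f -> trigpoly (fun x => c * f x).

Lemma dotvDl n (u v w : 'cV[R]_n) : dotv (u + v) w = dotv u w + dotv v w.
Proof. by rewrite /dotv linearD mulmxDl mxE. Qed.

Lemma dotvNl n (u w : 'cV[R]_n) : dotv (- u) w = - dotv u w.
Proof. by rewrite /dotv linearN mulNmx mxE. Qed.

Lemma dotvZl n c (u w : 'cV[R]_n) : dotv (c *: u) w = c * dotv u w.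
Proof. by rewrite /dotv linearZ -scalemxAl mxE. Qed.

Lemma dotv0l n (w : 'cV[R]_n) : dotv 0 w = 0.
Proof. by rewrite /dotv linear0 mul0mx mxE. Qed.

Lemma dotv_delta n (j : 'I_n) (x : 'cV[R]_n) : dotv (delta_mx j ord0) x = x j ord0.
Proof.
rewrite dotvE (bigD1 j)//= mxE !eqxx mul1r big1 ?addr0// => i ij.
by rewrite mxE (negbTE ij) mul0r.
Qed.

Lemma trig_cst p c : @trigpoly p (fun=> c).
Proof.
have := trig_scale c (@trig_cos p 0 0).
rewrite (_ : (fun x => _) = (fun=> c))//; apply/funext => x.
by rewrite dotv0l addr0 cos0 mulr1.
Qed.

Lemma trig_mul p (f g : 'cV[R]_p -> R) :
  trigpoly f -> trigpoly g -> trigpoly (fun x => f x * g x).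
Proof.
move=> tf; elim: tf g => {f} [t th|f1 f2 _ IH1 _ IH2|c f _ IH] g tg.
- elim: tg => {g} [s ph|g1 g2 _ IH1 _ IH2|c g _ IH].
  + have := trig_scale 2^-1 (trig_add (trig_cos (t + s) (th + ph)) (trig_cos (t - s) (th - ph))).
    rewrite (_ : (fun x => 2^-1 * _) = (fun x => cos (dotv t x + th) * cos (dotv s x + ph)))//.
    apply/funext => x; rewrite !dotvDl dotvNl.
    have -> : dotv t x + dotv s x + (th + ph) = (dotv t x + th) + (dotv s x + ph) by ring.
    have -> : dotv t x - dotv s x + (th - ph) = (dotv t x + th) + - (dotv s x + ph) by ring.
    move: (dotv t x + th) (dotv s x + ph) => u v.
    by rewrite !cosD cosN sinN; field.
  + have := trig_add IH1 IH2; congr trigpoly.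
    by apply/funext => x; rewrite mulrDr.
  + have := trig_scale c IH; congr trigpoly.
    by apply/funext => x; rewrite mulrCA.
- have := trig_add (IH1 _ tg) (IH2 _ tg); congr trigpoly.
  by apply/funext => x; rewrite mulrDl.
- have := trig_scale c (IH _ tg); congr trigpoly.
  by apply/funext => x; rewrite mulrA.
Qed.

Lemma trig_exp p (f : 'cV[R]_p -> R) k : trigpoly f -> trigpoly (fun x => f x ^+ k).
Proof.
move=> tf; elim: k => [|k IH]; first exact: trig_cst.
have := trig_mul tf IH; congr trigpoly.
by apply/funext => x; rewrite exprS.
Qed.

Lemma trig_prod p (I : Type) (r : seq I) (f : I -> 'cV[R]_p -> R) :
  (forall i, trigpoly (f i)) -> trigpoly (fun x => \prod_(i <- r) f i x).
Proof.
move=> tf; elim: r => [|i r IH].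
  by have := trig_cst p 1; congr trigpoly; apply/funext => x; rewrite big_nil.
have := trig_mul (tf i) IH; congr trigpoly.
by apply/funext => x; rewrite big_cons.
Qed.

Lemma trig_sum p (I : Type) (r : seq I) (f : I -> 'cV[R]_p -> R) :
  (forall i, trigpoly (f i)) -> trigpoly (fun x => \sum_(i <- r) f i x).
Proof.
move=> tf; elim: r => [|i r IH].
  by have := trig_cst p 0; congr trigpoly; apply/funext => x; rewrite big_nil.
have := trig_add (tf i) IH; congr trigpoly.
by apply/funext => x; rewrite big_cons.
Qed.

Lemma trig_sin p (a : R) (j : 'I_p) : trigpoly (fun x : 'cV[R]_p => sin (a * x j ord0)).
Proof.
have := trig_cos (a *: delta_mx j ord0) (- (pi / 2)); congr trigpoly.
by apply/funext => x; rewrite dotvZl dotv_delta cosBpihalf.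
Qed.

Lemma trig_bounded p (q : 'cV[R]_p -> R) : trigpoly q ->
  exists2 K, 0 <= K & forall x, `|q x| <= K.
Proof.
elim=> {q} [t th|f g _ [K1 K10 h1] _ [K2 K20 h2]|c f _ [K K0 h]].
- by exists 1 => // x; exact: cos_max.
- by exists (K1 + K2); rewrite ?addr_ge0// => x; rewrite (le_trans (ler_normD _ _))// lerD.
- by exists (`|c| * K); rewrite ?mulr_ge0// => x; rewrite normrM ler_wpM2l.
Qed.

Lemma measurable_dotv (d : measure_display) (T : measurableType d) p
    (t : 'cV[R]_p) (X : T -> 'cV[R]_p) :
  (forall i, measurable_fun setT (fun w => X w i ord0)) ->
  measurable_fun setT (fun w => dotv t (X w)).
Proof.
move=> mX; under eq_fun do rewrite dotvE.
by apply: measurable_sum => i; exact: measurable_funM.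
Qed.

Lemma trig_measurable (d : measure_display) (T : measurableType d) p
    (q : 'cV[R]_p -> R) (X : T -> 'cV[R]_p) : trigpoly q ->
  (forall i, measurable_fun setT (fun w => X w i ord0)) ->
  measurable_fun setT (fun w => q (X w)).
Proof.
move=> tq mX; elim: tq => {q} [t th|f g _ mf _ mg|c f _ mf].
- apply: (@measurableT_comp _ _ _ _ _ _ (@cos R)).
    by apply: continuous_measurable_fun; exact: continuous_cos.
  by apply: measurable_funD => //; exact: measurable_dotv.
- exact: measurable_funD.
- exact: measurable_funM.
Qed.

(** Convergence of extended real expectations and of their real values are
    interchangeable for uniformly bounded variables. *)
Lemma cvg_expectation (d : measure_display) (T : measurableType d) (P : probability T R)
    (d' : measure_display) (T' : measurableType d') (Q : probability T' R)
    (X : nat -> T -> R) (Z : T' -> R) (K : R) :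
  (forall n w, `|X n w| <= K) -> (forall w, `|Z w| <= K) ->
  ('E_P[X n] @[n --> \oo] --> 'E_Q[Z])%E <-> mean P (X n) @[n --> \oo] --> mean Q Z.
Proof.
move=> XK ZK; rewrite (expectation_bounded Q ZK).1.
under eq_fun do rewrite (expectation_bounded P (XK _)).1.
split => [/fine_cvg//|h]; apply: cvg_EFin => //; exact: nearW.
Qed.

(** Convergence of means passes to linear combinations, hence from single
    cosines, that is from the characteristic function, to all trigonometric
    polynomials. *)
Lemma trig_cvg (d : measure_display) (T : measurableType d) (P : probability T R)
    (d' : measure_display) (T' : measurableType d') (Q : probability T' R) p
    (X : nat -> T -> 'cV[R]_p) (Z : T' -> 'cV[R]_p) :
  (forall n i, measurable_fun setT (fun w => X n w i ord0)) ->
  (forall i, measurable_fun setT (fun w => Z w i ord0)) ->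
  (forall t th, mean P (fun w => cos (dotv t (X n w) + th)) @[n --> \oo] -->
     mean Q (fun w => cos (dotv t (Z w) + th))) ->
  forall q, trigpoly q ->
    mean P (fun w => q (X n w)) @[n --> \oo] --> mean Q (fun w => q (Z w)).
Proof.
move=> mX mZ ct q tq; elim: tq => {q} [t th|f g tf IHf tg IHg|c f tf IHf]; first exact: ct.
- have [K1 K10 h1] := trig_bounded tf; have [K2 K20 h2] := trig_bounded tg.
  have h1' x : `|f x| <= K1 + K2 by rewrite (le_trans (h1 x))// lerDl.
  have h2' x : `|g x| <= K1 + K2 by rewrite (le_trans (h2 x))// lerDr.
  rewrite (@meanD _ _ _ _ _ _ (K1 + K2)) => [|||w|w] //; try exact: trig_measurable.
  under eq_fun => n.
    rewrite (@meanD _ _ _ _ _ _ (K1 + K2)) => [|||w|w] //; try exact: trig_measurable.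
    over.
  exact: cvgD.
- have [K K0 h] := trig_bounded tf.
  rewrite (@meanZ _ _ _ _ _ _ K) => [||w] //; try exact: trig_measurable.
  under eq_fun => n.
    rewrite (@meanZ _ _ _ _ _ _ K) => [||w] //; try exact: trig_measurable.
    over.
  by apply: cvgM => //; exact: cvg_cst.
Qed.

Lemma measurable_cV_of_tuple p (i : 'I_p) :
  measurable_fun [set: p.-tuple (measurableTypeR R)] (fun z => cV_of_tuple z i ord0 : R).
Proof.
rewrite (_ : (fun z => _) = (fun z => tnth z i)); first exact: measurable_tnth.
by apply/funext => z; rewrite mxE.
Qed.

Lemma enormZ n c (v : 'cV[R]_n) : enorm (c *: v) = `|c| * enorm v.
Proof.
rewrite /enorm -sqrtr_sqr -sqrtrM ?sqr_ge0// mulr_sumr; congr Num.sqrt.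
by apply: eq_bigr => i _; rewrite mxE exprMn.
Qed.

Lemma enorm_ge0 n (v : 'cV[R]_n) : 0 <= enorm v.
Proof. exact: sqrtr_ge0. Qed.

Lemma enorm_sqr n (v : 'cV[R]_n) : enorm v ^+ 2 = dotv v v.
Proof.
rewrite sqr_sqrtr ?sumr_ge0// => [|i _]; last exact: sqr_ge0.
by rewrite dotvE; apply: eq_bigr => i _; rewrite expr2.
Qed.

Lemma enorm_eq0 n (v : 'cV[R]_n) : enorm v = 0 -> v = 0.
Proof.
move=> /(congr1 (fun x => x ^+ 2)); rewrite enorm_sqr expr0n/= dotvE => /eqP.
rewrite psumr_eq0 => [/allP v0|i _]; last by rewrite -expr2 sqr_ge0.
apply/colP => i; rewrite mxE; apply/eqP.
by have := v0 i; rewrite mem_index_enum mulf_eq0 orbb => /(_ isT).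
Qed.

Lemma enorm_delta n (j : 'I_n) : enorm (delta_mx j ord0 : 'cV[R]_n) = 1.
Proof.
apply/eqP; rewrite -(@eqrXn2 _ 2)// ?enorm_ge0// expr1n enorm_sqr dotv_delta.
by rewrite mxE !eqxx.
Qed.

(** The cosine along t is a function of the projection on the unit vector
    c = t / |t|, whose limit law is N(0, 1), and |t| times a standard normal
    variable has the law of the projection on t of a standard normal vector. *)
Lemma cramer_wold_cos (d : measure_display) (T : measurableType d) (P : probability T R)
    p (p_gt0 : (0 < p)%N) (X : nat -> T -> 'cV[R]_p) :
  (forall c : 'cV[R]_p, enorm c = 1 -> cvg_std_normal1 P (fun n w => dotv c (X n w))) ->
  forall t th, mean P (fun w => cos (dotv t (X n w) + th)) @[n --> \oo] -->
     mean (std_normal p) (fun z => cos (dotv t (cV_of_tuple z : 'cV[R]_p) + th)).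
Proof.
move=> cX t th.
pose c : 'cV[R]_p := if t == 0 then delta_mx (Ordinal p_gt0) ord0 else (enorm t)^-1 *: t.
have c1 : enorm c = 1.
  rewrite /c; case: eqP => [_|/eqP t0]; first exact: enorm_delta.
  rewrite enormZ ger0_norm ?invr_ge0 ?enorm_ge0// mulVf//.
  by apply: contra_neq t0 => /enorm_eq0.
have tc : t = enorm t *: c.
  rewrite /c; case: eqP => [->|/eqP t0].
    by rewrite -(scale0r (0 : 'cV[R]_p)) enormZ normr0 mul0r !scale0r.
  by rewrite scalerA divff ?scale1r//; apply: contra_neq t0 => /enorm_eq0.
pose g (x : R) := cos (enorm t * x + th).
have cg : continuous g.
  move=> x; apply: continuous_comp; last exact: continuous_cos.
  by apply: cvgD; [exact: mulrl_continuous|exact: cvg_cst].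
have gb : forall x, `|g x| <= 1 by move=> x; exact: cos_max.
have := cX c c1 g cg (ex_intro _ 1 gb).
rewrite (@cvg_expectation _ _ _ _ _ _ _ _ 1)//.
rewrite /g /=; under eq_fun do under eq_fun do rewrite -dotvZl -tc.
suff -> : mean (normal_prob 0 1 : probability (measurableTypeR R) R) (fun z => cos (enorm t * z + th)) =
  mean (std_normal p) (fun z => cos (dotv t (cV_of_tuple z) + th)) by [].
(* The Gaussian identities are stated for nonnegative test functions. *)
pose h (x : R) := 1 + cos (x + th).
have ch : continuous h.
  move=> x; apply: cvgD; first exact: cvg_cst.
  apply: continuous_comp; last exact: continuous_cos.
  by apply: cvgD; [exact: cvg_id|exact: cvg_cst].
have hK x : 0 <= h x <= 2.
  by have := @cos_max R (x + th); rewrite ler_norml /h => /andP[? ?]; apply/andP; split; lra.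
have mc : measurable_fun setT (@cos R).
  by apply: continuous_measurable_fun; exact: continuous_cos.
have := @std_normal_dot R p t h 2 ch hK.
have e (d0 : measure_display) (T0 : measurableType d0) (P0 : probability T0 R) (f : T0 -> R) :
    measurable_fun setT f ->
    (\int[P0]_x (h (f x))%:E)%E = (1 + mean P0 (fun x => cos (f x + th)))%:E.
  move=> mf.
  have b1 w : `|cos (f w + th)| <= 1 by exact: cos_max.
  have mcf : measurable_fun setT (fun w => cos (f w + th)).
    by apply: measurableT_comp => //; exact: measurable_funD.
  have := @meanD _ _ _ P0 (fun=> 1) _ 1 (measurable_cst _) mcf (fun=> _) b1.
  rewrite mean_cst => <-; last by rewrite normr1.
  have b2 w : `|1 + cos (f w + th)| <= 2.
    by rewrite (le_trans (ler_normD _ _))// normr1 lerD.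
  by have [<- _] := expectation_bounded P0 b2; rewrite expectation.unlock.
rewrite (e _ _ _ (fun z => dotv t (cV_of_tuple z))); last first.
  by apply: measurable_dotv => i; exact: measurable_cV_of_tuple.
rewrite (e _ _ _ (fun x : measurableTypeR R => enorm t * x)); last exact: measurable_funM.
by move=> [] /addrI ->.
Qed.
End trigpoly.

(** * Bernstein polynomials in several variables *)

Section bernstein.
Context {R : realType}.

(** The mean of g at a binomial variable with parameters m and v. *)
Definition bern m (v : R) (g : nat -> R) : R :=
  \sum_(k < m.+1) g k * ('C(m, k)%:R * v ^+ k * (1 - v) ^+ (m - k)).

(** Conditioning on the first of m + 1 trials. *)
Lemma bernS m v g :
  bern m.+1 v g = v * bern m v (fun k => g k.+1) + (1 - v) * bern m v g.
Proof.
rewrite /bern big_ord_recl bin0 expr0 subn0.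
under eq_bigr => i _ do rewrite lift0 binS natrD subSS !mulrDl mulrDr.
rewrite big_split /= addrA addrC; congr (_ + _).
  rewrite mulr_sumr; apply: eq_bigr => i _; rewrite exprS; ring.
rewrite big_ord_recr /= bin_small// !mul0r mulr0 addr0.
rewrite big_ord_recl bin0 expr0 subn0 mulrDr; congr (_ + _).
  by rewrite exprS; ring.
rewrite mulr_sumr; apply: eq_bigr => i _; rewrite lift0.
have -> : (m - i = (m - i.+1).+1)%N by rewrite subnSK.
by rewrite [(1 - v) ^+ _.+1]exprS; ring.
Qed.

Lemma bern1 m v : bern m v (fun=> 1) = 1.
Proof.
elim: m => [|m IH]; first by rewrite /bern big_ord1 bin0 !expr0 !mulr1.
by rewrite bernS IH; ring.
Qed.

Lemma bern_sqr m v c :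
  bern m v (fun k => (k%:R - c) ^+ 2) = m%:R * v * (1 - v) + (m%:R * v - c) ^+ 2.
Proof.
elim: m c => [|m IH] c.
  rewrite /bern big_ord1 bin0 !expr0 /=; ring.
rewrite bernS IH.
have -> : (fun k => (k.+1%:R - c) ^+ 2) = (fun k => (k%:R - (c - 1)) ^+ 2).
  by apply/funext => k; rewrite -natr1; congr (_ ^+ 2); ring.
by rewrite IH -natr1; ring.
Qed.

Definition bern_weight m (v : R) (k : nat) : R := 'C(m, k)%:R * v ^+ k * (1 - v) ^+ (m - k).

Lemma bern_weight_ge0 m v k : 0 <= v <= 1 -> 0 <= bern_weight m v k.
Proof.
by case/andP=> v0 v1; rewrite /bern_weight !mulr_ge0// exprn_ge0// subr_ge0.
Qed.

Variable p : nat.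
Implicit Types (v : 'I_p -> R).

Definition mbern_weight m v (k : {ffun 'I_p -> 'I_m.+1}) : R :=
  \prod_j bern_weight m (v j) (k j).

(** The multivariate Bernstein polynomial of F: the mean of F at the vector of
    frequencies of success of p independent binomial variables. *)
Definition mbern m v (F : 'cV[R]_p -> R) : R :=
  \sum_(k : {ffun 'I_p -> 'I_m.+1}) F (\col_j ((k j)%:R / m%:R)) * mbern_weight v k.

Lemma mbern_weight1 m v : \sum_(k : {ffun 'I_p -> 'I_m.+1}) mbern_weight v k = 1.
Proof.
rewrite -(bigA_distr_bigA (fun j (i : 'I_m.+1) => bern_weight m (v j) i)) /=.
rewrite big1// => j _; rewrite -[RHS](bern1 m (v j)).
by apply: eq_bigr => i _; rewrite mul1r.
Qed.

Lemma mbern_var m v j : \sum_(k : {ffun 'I_p -> 'I_m.+1})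
  mbern_weight v k * ((k j)%:R - m%:R * v j) ^+ 2 = m%:R * v j * (1 - v j).
Proof.
pose G l (i : 'I_m.+1) := (if l == j then (i%:R - m%:R * v j) ^+ 2 else 1) *
  bern_weight m (v l) i.
transitivity (\sum_(k : {ffun 'I_p -> 'I_m.+1}) \prod_l G l (k l)).
  apply: eq_bigr => k _; rewrite /G big_split /= mulrC; congr (_ * _).
  rewrite (bigD1 j)//= eqxx big1 ?mulr1// => l lj.
  by rewrite (negbTE lj).
rewrite -(bigA_distr_bigA G) (bigD1 j)//= [X in _ * X]big1 => [|l /negbTE lj]; last first.
  rewrite /G lj -[RHS](bern1 m (v l)).
  by apply: eq_bigr => i _; rewrite mul1r.
rewrite mulr1 /G eqxx -[RHS]addr0.
by have := bern_sqr m (v j) (m%:R * v j); rewrite subrr expr0n/= => <-.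
Qed.

Lemma mbern_weight_ge0 m v (k : {ffun 'I_p -> 'I_m.+1}) :
  (forall j, 0 <= v j <= 1) -> 0 <= mbern_weight v k.
Proof. by move=> v01; apply: prodr_ge0 => j _; exact: bern_weight_ge0. Qed.

Lemma mbern_bounded m v F (K : R) : (forall j, 0 <= v j <= 1) ->
  (forall x, `|F x| <= K) -> `|mbern m v F| <= K.
Proof.
move=> v01 FK; rewrite (le_trans (ler_norm_sum _ _ _))//.
rewrite -[leRHS]mulr1 -(mbern_weight1 m v) mulr_sumr; apply: ler_sum => k _.
by rewrite normrM (@ger0_norm _ (mbern_weight _ _)) ?mbern_weight_ge0// ler_wpM2r// mbern_weight_ge0.
Qed.

(** Weak law of large numbers in the form of Chebyshev's inequality: the
    frequencies are within dl of v off an event of probability at most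
    p / (m dl^2), where F differs from its value at v by at most 2 K. *)
Lemma mbern_approx m v F (K dl e : R) : (0 < m)%N -> (forall j, 0 <= v j <= 1) ->
  (forall x, `|F x| <= K) -> 0 < dl -> 0 <= e ->
  (forall u : 'cV[R]_p, (forall j, `|v j - u j ord0| < dl) -> `|F (\col_j v j) - F u| <= e) ->
  `|mbern m v F - F (\col_j v j)| <= e + 2 * K * p%:R / (m%:R * dl ^+ 2).
Proof.
move=> m0 v01 FK dl0 e0 Fu.
have K0 : 0 <= K := le_trans (normr_ge0 _) (FK 0).
have mR : 0 < m%:R :> R by rewrite ltr0n.
have FE : F (\col_j v j) = \sum_(k : {ffun 'I_p -> 'I_m.+1}) F (\col_j v j) * mbern_weight v k.
  by rewrite -mulr_sumr mbern_weight1 mulr1.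
rewrite [X in _ - X]FE -sumrB (le_trans (ler_norm_sum _ _ _))//.
pose V (k : {ffun 'I_p -> 'I_m.+1}) := \sum_j ((k j)%:R - m%:R * v j) ^+ 2.
pose c := 2 * K / (m%:R * dl) ^+ 2.
have c0 : 0 <= c by apply: divr_ge0; [exact: mulr_ge0|exact: (sqr_ge0 (m%:R * dl))].
have V0 k : 0 <= V k by apply: sumr_ge0 => j _; exact: sqr_ge0.
(* If some frequency is at distance at least dl from v, then V k >= (m dl)^2,
   so the term c * V k alone dominates 2 K. *)
have bd (k : {ffun 'I_p -> 'I_m.+1}) :
    `|F (\col_j ((k j)%:R / m%:R)) - F (\col_j v j)| <= e + c * V k.
  have [cl|] := pselect (forall j, `|v j - (k j)%:R / m%:R| < dl).
    rewrite distrC; apply: (le_trans (Fu _ _)); last first.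
      by rewrite lerDl; exact: mulr_ge0.
    by move=> j; rewrite mxE; exact: cl.
  move/existsNP => [j /negP]; rewrite -leNgt => far.
  rewrite (le_trans (ler_normB _ _))// ler_wpDl//.
  rewrite (@le_trans _ _ (2 * K))//; first by rewrite mulrDl mul1r lerD.
  have : (m%:R * dl) ^+ 2 <= V k.
    rewrite /V (bigD1 j)//=; apply: ler_wpDr.
      by apply: sumr_ge0 => i _; exact: sqr_ge0.
    rewrite -[X in _ <= X]real_normK ?num_real//.
    apply: lerXn2r; rewrite ?nnegrE//; first by apply: mulr_ge0; apply: ltW.
    have -> : (k j)%:R - m%:R * v j = - (m%:R * (v j - (k j)%:R / m%:R)).
      by field; rewrite gt_eqF.
    by rewrite normrN normrM gtr0_norm// ler_wpM2l// ltW.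
  have md : 0 < (m%:R * dl) ^+ 2 by rewrite exprn_gt0// mulr_gt0.
  move=> h; rewrite /c mulrAC -mulrA ler_peMr ?mulr_ge0//.
  by rewrite ler_pdivlMr// mul1r.
have -> : e + 2 * K * p%:R / (m%:R * dl ^+ 2) = e + c * (\sum_(j < p) m%:R).
  rewrite sumr_const card_ord -mulr_natr /c; congr (_ + _).
  by field; rewrite !gt_eqF.
apply: (@le_trans _ _ (\sum_(k : {ffun 'I_p -> 'I_m.+1}) (e + c * V k) * mbern_weight v k)).
  apply: ler_sum => k _; rewrite -mulrBl normrM (@ger0_norm _ (mbern_weight _ _)) ?mbern_weight_ge0//.
  by rewrite ler_wpM2r ?mbern_weight_ge0.
under eq_bigr => k _ do rewrite mulrDl -mulrA.
rewrite big_split /= -!mulr_sumr mbern_weight1 mulr1 lerD2l ler_wpM2l//.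
have -> : \sum_(k : {ffun 'I_p -> 'I_m.+1}) V k * mbern_weight v k =
   \sum_(k : {ffun 'I_p -> 'I_m.+1}) \sum_j ((k j)%:R - m%:R * v j) ^+ 2 * mbern_weight v k.
  by apply: eq_bigr => k _; rewrite mulr_suml.
rewrite exchange_big/=; apply: ler_sum => j _.
under eq_bigr => k _ do rewrite mulrC.
rewrite mbern_var -mulrA ler_piMr ?ltW//.
by have /andP[v0 v1] := v01 j; nra.
Qed.
End bernstein.

(** Compactness of the cube gives a modulus of continuity which is uniform in
    the point x of the cube, while y may lie outside. *)
Lemma cube_unif_continuous (R : realType) p (F : 'cV[R]_p -> R) (N e : R) :
  continuous F -> 0 < e ->
  exists2 dl : R, 0 < dl & forall x : 'cV[R]_p, (forall j, `|x j ord0| <= N) ->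
    forall y : 'cV[R]_p, (forall j, `|x j ord0 - y j ord0| < dl) -> `|F x - F y| <= e.
Proof.
move=> cF e0.
pose A := [set v : 'rV[R]_p | forall i, `[(- N), N]%classic (v ord0 i)].
have cA : compact A by apply: (@rV_compact _ _ (fun=> `[(- N), N]%classic)) => i; exact: segment_compact.
pose Q (dl : R) (x : 'rV[R]_p) := forall y : 'cV[R]_p, (forall j, `|x ord0 j - y j ord0| < dl) ->
  `|F x^T - F y| <= e.
have : \forall dl \near (0 : R)^'+, A `<=` Q dl.
  move/compact_near_coveringP : cA; apply => x _.
  have e2 : 0 < e / 2 by rewrite divr_gt0.
  have /cvgrPdist_lt/(_ _ e2) := cF x^T.
  move=> /nbhs_ballP [r /= r0 Hr].
  have r2 : 0 < r / 2 by rewrite divr_gt0.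
  exists (ball x (r / 2), [set t | 0 < t < r / 2]) => /=.
    split; first exact: nbhsx_ballx.
    near=> t; apply/andP; split; first by near: t; exact: nbhs_right_gt.
    by near: t; exact: nbhs_right_lt.
  move=> [x' t] /= [[_ xx'] /andP[t0 tr]] y x'y.
  have b1 : ball x^T r x'^T.
    split=> // i j; rewrite /ball/= !mxE.
    by rewrite (lt_trans (xx' j i))// ltr_pdivrMr// ltr_pMr// ltr1n.
  have b2 : ball x^T r y.
    split=> // i j; rewrite /ball/= !mxE (ord1 j).
    have := xx' ord0 i; rewrite /ball/= => h1.
    have h2 := x'y i.
    rewrite (_ : _ - _ = (x ord0 i - x' ord0 i) + (x' ord0 i - y i ord0)); last by ring.
    by rewrite (le_lt_trans (ler_normD _ _))// [r]splitr ltrD// (lt_trans h2).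
  have := Hr _ b1; have := Hr _ b2 => /= h1 h2.
  rewrite (_ : _ - _ = (F x^T - F y) - (F x^T - F x'^T)); last by ring.
  by rewrite (le_trans (ler_normB _ _))// [e]splitr lerD// ltW.
move=> H; have : \forall dl \near (0 : R)^'+, 0 < dl /\ A `<=` Q dl.
  by near=> dl; split; [near: dl; exact: nbhs_right_gt|near: dl].
move=> /filter_ex [dl [dl0 AQ]].
exists dl => // x xN y xy.
have := AQ x^T; rewrite /Q trmxK; apply => //.
  by move=> i /=; rewrite mxE in_itv/= -ler_norml.
by move=> j; rewrite mxE.
Unshelve. all: by end_near. Qed.

(** * Trigonometric approximation on a cube *)

Section trigonometric_approximation.
Context {R : realType}.

Lemma sin_half_bound : 0 < sin (2^-1 : R) < 1.
Proof.
have h : (2^-1 : R) < pi / 2 by apply: lt_le_trans (@pihalf_ge1 R); lra.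
have h0 : (0 : R) < 2^-1 by lra.
have p0 : (0 : R) <= pi / 2 := ltW (lt_trans h0 h).
have Np : - (pi / 2 : R) <= 0 by rewrite oppr_le0.
have a1 : (2^-1 : R) \in `[- (pi / 2), pi / 2] by rewrite in_itv/= (ltW h) (le_trans Np (ltW h0)).
have a2 : (pi / 2 : R) \in `[- (pi / 2), pi / 2] by rewrite in_itv/= lexx (le_trans Np p0).
rewrite sin_gt0_pihalf ?h0//=.
have := ltr_sin a1 a2; rewrite sin_pihalf => ->.
exact: h.
Qed.

Definition clamp (s x : R) : R := Num.max (- s) (Num.min s x).

Lemma continuous_clamp s : continuous (clamp s).
Proof.
move=> x; apply: (@continuous_max _ _ (fun=> - s) (fun x => Num.min s x)).
  exact: cvg_cst.
apply: (@continuous_min _ _ (fun=> s) id); [exact: cvg_cst|exact: cvg_id].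
Qed.

Lemma clamp_bound s x : 0 <= s -> - s <= clamp s x <= s.
Proof.
move=> s0; rewrite /clamp le_max lexx/= ge_max ge_min lexx/= andbT.
by rewrite lerNl (le_trans _ s0)// oppr_le0.
Qed.

Lemma clampE s x : - s <= x <= s -> clamp s x = x.
Proof. by case/andP=> a b; rewrite /clamp (min_idPr b) (max_idPr a). Qed.

(** The inverse on [-N, N] of x |-> (1 + sin (x / (2 N))) / 2. The angle stays
    within [-1/2, 1/2], hence the sine away from the end points of the
    domain of asin; clamping to that range extends the inverse to a
    continuous function on the line. *)
Definition unsin (N u : R) : R := 2 * N * asin (clamp (sin 2^-1) (2 * u - 1)).

Lemma continuous_unsin N : continuous (unsin N).
Proof.
have /andP[s0 s1] := sin_half_bound.
have ca : continuous (fun x : R => asin (clamp (sin 2^-1) x)).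
  move=> x; apply: continuous_comp; first exact: continuous_clamp.
  apply: continuous_asin.
  have /andP[h1 h2] := @clamp_bound (sin 2^-1) x (ltW s0).
  by rewrite (le_lt_trans h2 s1) andbT (lt_le_trans _ h1)// ltrN2.
move=> u; apply: cvgM; first exact: cvg_cst.
apply: (@cvg_comp _ _ _ (fun u => 2 * u - 1) (fun x => asin (clamp (sin 2^-1) x))); last exact: ca.
by apply: cvgB; [exact: mulrl_continuous|exact: cvg_cst].
Qed.

Lemma unsinK N x : 0 < N -> `|x| <= N -> unsin N ((1 + sin ((2 * N)^-1 * x)) / 2) = x.
Proof.
move=> N0 xN; rewrite /unsin; set y := (2 * N)^-1 * x.
have y1 : - 2^-1 <= y <= 2^-1.
  rewrite -ler_norml normrM gtr0_norm ?invr_gt0 ?mulr_gt0//.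
  by rewrite invfM -mulrA ler_piMr// mulrC ler_pdivrMr// mul1r.
have h : (2^-1 : R) <= pi / 2 by apply: le_trans (@pihalf_ge1 R); lra.
have hI z : - 2^-1 <= z <= 2^-1 -> z \in `[- (pi / 2), (pi / 2 : R)].
  case/andP=> z1 z2; rewrite in_itv/= (le_trans z2 h) andbT.
  by rewrite (le_trans _ z1)// lerN2.
have yI := hI _ y1.
have h1 : (2^-1 : R) \in `[- (pi / 2), (pi / 2 : R)] by apply: hI; apply/andP; split; lra.
have h2 : - (2^-1 : R) \in `[- (pi / 2), (pi / 2 : R)] by apply: hI; apply/andP; split; lra.
rewrite (_ : 2 * _ - 1 = sin y); last by field.
rewrite clampE; last first.
  by rewrite -sinN !leNgt !ltr_sin// -!leNgt.
rewrite sinK// /y mulrA divff ?mul1r// gt_eqF// mulr_gt0//.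
Qed.

Lemma continuous_col p (g : R -> R) : continuous g ->
  continuous (fun u : 'cV[R]_p => \col_j g (u j ord0) : 'cV[R]_p).
Proof.
move=> cg u A /nbhs_ballP [r /= r0 rA].
have H (j : 'I_p) : nbhs u (fun u' : 'cV[R]_p => `|g (u j ord0) - g (u' j ord0)| < r).
  have : continuous (fun u' : 'cV[R]_p => g (u' j ord0)).
    move=> v; apply: (@cvg_comp _ _ _ (fun v : 'cV[R]_p => v j ord0) g); last exact: cg.
    exact: coord_continuous.
  by move=> /(_ u) /cvgrPdist_lt; exact.
apply: (@filterS _ _ (nbhs_filter (u : 'cV[R]_p)) _ _ _ (filter_forall (nbhs_filter (u : 'cV[R]_p)) H)) => u' Hu'; apply: rA.
by split=> // i j; rewrite !mxE; exact: Hu'.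
Qed.

(** In the coordinates v_j = (1 + sin (x_j / (2 N))) / 2 of [0, 1], f becomes
    on the cube a continuous function F of v, and the Bernstein polynomials of
    F converge uniformly to F. In terms of x they are trigonometric
    polynomials, and they inherit from F the bound K on all of R^p and not
    only on the cube: this is what controls the mass outside the cube. *)
Lemma trig_approx p (f : 'cV[R]_p -> R) (K N e : R) :
  continuous f -> (forall x, `|f x| <= K) -> 0 < N -> 0 < e ->
  exists q, [/\ trigpoly q, (forall x, `|q x| <= K) &
    forall x : 'cV[R]_p, (forall j, `|x j ord0| <= N) -> `|f x - q x| <= e].
Proof.
move=> cf fK N0 e0.
have e2 : 0 < e / 2 by rewrite divr_gt0.
have K0 : 0 <= K := le_trans (normr_ge0 _) (fK 0).
pose F (u : 'cV[R]_p) := f (\col_j unsin N (u j ord0)).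
have cF : continuous F.
  move=> u; apply: (@cvg_comp _ _ _ (fun u : 'cV[R]_p => \col_j unsin N (u j ord0)) f); last exact: cf.
  by apply: continuous_col; exact: continuous_unsin.
have FK u : `|F u| <= K by exact: fK.
have [dl dl0 Hdl] := @cube_unif_continuous R p F 1 (e / 2) cF e2.
(* Large enough for the Chebyshev term of mbern_approx to be below e / 2. *)
pose m := (Num.bound (2 * K * p%:R / dl ^+ 2 / (e / 2))).+1.
pose sv (x : 'cV[R]_p) j := (1 + sin ((2 * N)^-1 * x j ord0)) / 2.
have sv01 x j : 0 <= sv x j <= 1.
  have := @sin_max R ((2 * N)^-1 * x j ord0).
  by rewrite ler_norml /sv => /andP[? ?]; apply/andP; split; lra.
exists (fun x => mbern m (sv x) F); split.
- rewrite /mbern; apply: trig_sum => k; apply: trig_mul; first exact: trig_cst.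
  apply: trig_prod => j; rewrite /bern_weight.
  have tsv : trigpoly (fun x => sv x j).
    have := trig_scale 2^-1 (trig_add (trig_cst p 1) (trig_sin (2 * N)^-1 j)).
    by congr trigpoly; apply/funext => x; rewrite /sv mulrC.
  apply: trig_mul.
    by apply: trig_mul; [exact: trig_cst|exact: trig_exp].
  apply: trig_exp.
  have := trig_add (trig_cst p 1) (trig_scale (-1) tsv).
  by congr trigpoly; apply/funext => x; rewrite mulN1r.
- by move=> x; apply: mbern_bounded.
- move=> x xN.
  have -> : f x = F (\col_j sv x j).
    by rewrite /F; congr f; apply/colP => j; rewrite !mxE unsinK.
  rewrite distrC (le_trans (@mbern_approx R p m (sv x) F K dl (e / 2) _ _ _ _ _ _))//.
  + exact: ltW.
  + move=> u xu; apply: Hdl => j; rewrite mxE; last exact: xu.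
    by have /andP[h1 h2] := sv01 x j; rewrite ger0_norm.
  + rewrite [leRHS]splitr lerD2l.
    have mR : 0 < m%:R :> R by rewrite ltr0n.
    have d2 : 0 < dl ^+ 2 by rewrite exprn_gt0.
    have : 2 * K * p%:R / dl ^+ 2 / (e / 2) < m%:R.
      have x0 : 0 <= 2 * K * p%:R / dl ^+ 2 / (e / 2).
        by rewrite !divr_ge0 ?mulr_ge0// ltW.
      by apply: (lt_trans (archi_boundP x0)); rewrite ltr_nat.
    rewrite ltr_pdivrMr// => /ltW h.
    by rewrite invfM mulrCA mulrC ler_pdivrMr// [X in _ <= X]mulrC.
Qed.
End trigonometric_approximation.

(** * Limits in probability and tightness *)

Section probability_limits.
Context {R : realType} {d : measure_display} {T : measurableType d}.
Variable P : probability T R.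

(** The filter of the properties of (n, w) that hold with probability tending to
    1 as n tends to infinity. The exceptional sets are covered by measurable
    events of small probability, so no property needs to be measurable, and a
    limit along this filter is a limit in probability. *)
Definition whp : set_system (nat * T) := [set A | forall dl : R, 0 < dl ->
  \forall n \near \oo, exists B, [/\ measurable B, (P B <= dl%:E)%E &
    forall w, ~ B w -> A (n, w)]].

Global Instance whp_filter : Filter whp.
Proof.
split.
- move=> dl dl0; apply: nearW => n; exists set0; split => //.
  by rewrite measure0 lee_fin ltW.
- move=> A A' hA hA' dl dl0.
  have dl2 : 0 < dl / 2 by rewrite divr_gt0.
  have := hA _ dl2; have := hA' _ dl2; apply: filterS2 => n [B [mB PB hB]] [B' [mB' PB' hB']].
  exists (B `|` B'); split; first exact: measurableU.
    rewrite [dl]splitr EFinD (le_trans (measureU2 _ _ _))// leeD//.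
  by move=> w /not_orP[w1 w2]; split; [exact: hB'|exact: hB].
- move=> A A' AA' hA dl dl0; have := hA _ dl0; apply: filterS => n [B [mB PB hB]].
  by exists B; split => // w /hB /AA'.
Qed.

Lemma whp_near (A : nat -> Prop) : (\forall n \near \oo, A n) ->
  \forall x \near whp, A x.1.
Proof.
move=> hA dl dl0; near=> n; exists set0; split => //.
  by rewrite measure0 lee_fin ltW.
by move=> w _ /=; near: n.
Unshelve. all: by end_near. Qed.

Lemma whp_cvg {U : topologicalType} (u : nat -> U) (l : U) :
  u n @[n --> \oo] --> l -> u x.1 @[x --> whp] --> l.
Proof. by move=> ul A /ul hA; exact: (@whp_near (fun n => A (u n))). Qed.

(** Boundedness in probability, again with measurable covers of the exceptional
    sets. *)
Definition tight (Y : nat -> T -> R) := forall dl : R, 0 < dl -> exists2 N, 0 < N &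
  \forall n \near \oo, exists B, [/\ measurable B, (P B <= dl%:E)%E &
    forall w, ~ B w -> `|Y n w| <= N].

Lemma tightM_cvg0 (Y : nat -> T -> R) (e : nat * T -> R) : tight Y ->
  e x @[x --> whp] --> 0 -> e x * Y x.1 x.2 @[x --> whp] --> 0.
Proof.
move=> tY e0; apply/cvgr0Pnorm_lt => eps eps0 dl dl0.
have dl2 : 0 < dl / 2 by rewrite divr_gt0.
have [N N0 hN] := tY _ dl2.
have eN : 0 < eps / N by rewrite divr_gt0.
move/cvgr0Pnorm_lt : e0 => /(_ _ eN) /(_ _ dl2) he.
move: hN he; apply: filterS2 => n [B [mB PB hB]] [B' [mB' PB' hB']].
exists (B `|` B'); split; first exact: measurableU.
  by rewrite [dl]splitr EFinD (le_trans (measureU2 _ _ _))// leeD.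
move=> w /not_orP[/hB w1 /hB' w2] /=; rewrite normrM.
rewrite -(divfK (lt0r_neq0 N0) eps).
apply: (@le_lt_trans _ _ (`|e (n, w)| * N)); first by rewrite ler_wpM2l.
by rewrite ltr_pM2r.
Qed.

Lemma measurable_abs_gt (X : T -> R) (N : R) : measurable_fun setT X ->
  measurable [set w | N < `|X w|].
Proof.
move=> mX.
have mX' : measurable_fun setT (fun w => `|X w|) by exact: measurableT_comp.
rewrite (_ : [set w | _] = setT `&` (fun w => `|X w|) @^-1` `]N, +oo[).
  exact: mX'.
by rewrite setTI; apply/seteqP; split => w /=; rewrite in_itv/= andbT.
Qed.

Lemma tight_var (X : T -> R) : measurable_fun setT X -> tight (fun=> X).
Proof.
move=> mX dl dl0.
pose A k := [set w | k%:R < `|X w|].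
have mA k : measurable (A k).
  exact: measurable_abs_gt.
have : P (A k) @[k --> \oo] --> P (\bigcap_k A k).
  apply: nonincreasing_cvg_mu => //.
  - by rewrite (le_lt_trans (probability_le1 _ _)) ?ltry.
  - exact: bigcap_measurable.
  - move=> m n mn; apply/subsetPset => w; rewrite /A /=; apply: le_lt_trans.
    by rewrite ler_nat.
have -> : \bigcap_k A k = set0.
  rewrite -subset0 => w /(_ (Num.bound `|X w|) I) /=; apply/negP; rewrite -leNgt ltW//.
  exact: archi_boundP.
rewrite measure0 => /fine_cvgP[_ /cvgr0Pnorm_lt/(_ _ dl0)].
move=> /filter_ex [k]; rewrite /= ger0_norm ?fine_ge0// => hk.
exists k.+1%:R; first by rewrite ltr0n.
apply: nearW => _; exists (A k); split => //.
  by rewrite -(@fineK _ (P (A k))) ?fin_num_measure// lee_fin ltW.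
move=> w /negP; rewrite -leNgt => /le_trans; apply; rewrite ler_nat//.
Qed.

Lemma tight_seq p (X : nat -> T -> 'cV[R]_p) : (forall j, tight (fun n w => X n w j ord0)) ->
  forall dl : R, 0 < dl -> exists2 N, 0 < N & \forall n \near \oo, exists B,
    [/\ measurable B, (P B <= dl%:E)%E & forall w, ~ B w -> forall j, `|X n w j ord0| <= N].
Proof.
move=> tX.
suff H (s : seq 'I_p) (dl : R) : 0 < dl -> exists2 N, 0 < N & \forall n \near \oo, exists B,
    [/\ measurable B, (P B <= dl%:E)%E & forall w, ~ B w -> forall j, j \in s -> `|X n w j ord0| <= N].
  move=> dl dl0; have [N N0 hN] := H (index_enum 'I_p) dl dl0; exists N => //.
  apply: filterS hN => n [B [mB PB hB]]; exists B; split => // w wB j.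
  by apply: hB => //; exact: mem_index_enum.
elim: s dl => [|i s IH] dl dl0.
  exists 1 => //; apply: nearW => n; exists set0; split => //.
  by rewrite measure0 lee_fin ltW.
have dl2 : 0 < dl / 2 by rewrite divr_gt0.
have [N N0 hN] := IH _ dl2; have [N' N'0 hN'] := tX i _ dl2.
exists (N + N'); first exact: addr_gt0.
move: hN hN'; apply: filterS2 => n [B [mB PB hB]] [B' [mB' PB' hB']].
exists (B `|` B'); split; first exact: measurableU.
  by rewrite [dl]splitr EFinD (le_trans (measureU2 _ _ _))// leeD.
move=> w /not_orP[w1 w2] j; rewrite inE => /predU1P[->|js].
  by rewrite (le_trans (hB' w w2))// lerDr ltW.
by rewrite (le_trans (hB w w1 j js))// lerDl ltW.
Qed.
End probability_limits.

(** Test the convergence on a continuous ramp from 0 at |x| = N to 1 at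
    |x| = N + 1, where N is such that the normal law gives small mass to
    |x| > N. *)
Lemma tight_of_normal (R : realType) (d : measure_display) (T : measurableType d)
    (P : probability T R) (Y : nat -> T -> R) :
  (forall n, measurable_fun setT (Y n)) -> cvg_std_normal1 P Y -> tight P Y.
Proof.
move=> mY cY dl dl0.
have dl2 : 0 < dl / 2 by rewrite divr_gt0.
pose N01 := (normal_prob (0 : R) 1 : probability (measurableTypeR R) R).
have [N N0 /filter_ex[_ [B [mB PB hB]]]] := @tight_var _ _ _ N01 id (@measurable_id _ _ _) _ dl2.
pose g (x : R) := Num.min 1 (Num.max 0 (`|x| - N)).
have g01 x : 0 <= g x <= 1.
  by rewrite /g ge_min lexx/= le_min ler01 le_max lexx.
have gN x : `|x| <= N -> g x = 0.
  by move=> xN; rewrite /g max_l ?subr_le0// min_r// ler01.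
have gN1 x : N + 1 < `|x| -> g x = 1.
  move=> xN; rewrite /g min_l// le_max; apply/orP; right.
  by rewrite lerBrDr addrC ltW.
have cg : continuous g.
  move=> x; apply: (@continuous_min _ _ (fun=> 1) (fun x => Num.max 0 (`|x| - N))).
    exact: cvg_cst.
  apply: (@continuous_max _ _ (fun=> 0) (fun x => `|x| - N)); first exact: cvg_cst.
  by apply: cvgB; [exact: norm_continuous|exact: cvg_cst].
have gb x : `|g x| <= 1 by rewrite ger0_norm; case/andP: (g01 x).
have := cY g cg (ex_intro _ 1 gb).
rewrite (@cvg_expectation _ _ _ _ _ _ _ _ _ 1)//.
have gd : mean N01 g <= dl / 2.
  apply: (@le_trans _ _ (mean N01 (\1_B))).
    apply: (@ge_mean _ _ _ _ _ _ 1) => //.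
      by move=> w; rewrite indicE ger0_norm ?ler0n// lern1 leq_b1.
    move=> w; rewrite indicE; have [wB|wB] := boolP (w \in B); first by case/andP: (g01 w).
    by rewrite gN//; apply: (hB w) => /mem_set; apply/negP.
  by rewrite mean_indic// -lee_fin fineK// fin_num_measure.
move=> /cvgr_lt /(_ dl); rewrite (le_lt_trans gd) ?ltr_pdivrMr ?ltr_pMr ?ltr1n// => /(_ isT) H.
exists (N + 1); first by rewrite addr_gt0.
apply: filterS H => n hn.
have mA := measurable_abs_gt (N + 1) (mY n).
exists [set w | N + 1 < `|Y n w|]; split => //; last first.
  by move=> w /negP; rewrite -leNgt.
rewrite -(@fineK _ (P _)) ?fin_num_measure// lee_fin (le_trans _ (ltW hn))//.
rewrite -mean_indic//; apply: (@ge_mean _ _ _ _ _ _ 1) => //.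
  by move=> w; rewrite indicE ger0_norm ?ler0n// lern1 leq_b1.
move=> w; rewrite indicE.
have [|wB] := boolP (w \in _); last by case/andP: (g01 (Y n w)).
by rewrite inE/= => /gN1 ->.
Qed.

(** * The theorems of Cramer-Wold and Slutsky *)

Section cramer_wold.
Context {R : realType} {d : measure_display} {T : measurableType d}.
Variable P : probability T R.

(** On the event where X is in a large cube and Y is close to X, both f (Y) -
    f (X) and f (X) - q (X) are at most e; off this event the integrands
    differ by at most 2 K. *)
Lemma mean_trig_approx p (Y X : nat -> T -> 'cV[R]_p) (f : 'cV[R]_p -> R) (K : R) :
  (forall n i, measurable_fun setT (fun w => X n w i ord0)) ->
  (forall j, tight P (fun n w => X n w j ord0)) ->
  (forall eta : R, 0 < eta -> \forall x \near whp P, forall j,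
    `|X x.1 x.2 j ord0 - Y x.1 x.2 j ord0| < eta) ->
  continuous f -> (forall x, `|f x| <= K) ->
  forall e : R, 0 < e -> exists N, forall N', N <= N' -> forall q, trigpoly q ->
    (forall x, `|q x| <= K) ->
    (forall x : 'cV[R]_p, (forall j, `|x j ord0| <= N') -> `|f x - q x| <= e) ->
    \forall n \near \oo, `|mean P (fun w => f (Y n w)) - mean P (fun w => q (X n w))| <= 3 * e.
Proof.
move=> mX tX XY cf fK e e0.
have K0 : 0 <= K := le_trans (normr_ge0 _) (fK 0).
(* There are two exceptional events, each of probability at most dl, and they
   contribute 2 K (2 dl) <= e. *)
pose dl := e / (4 * (K + 1)).
have K1 : 0 < 4 * (K + 1) by rewrite mulr_gt0// ltr_wpDl.
have dl0 : 0 < dl by rewrite divr_gt0.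
have [N N0 hN] := tight_seq tX dl0.
exists N => N' NN' q tq qK fq.
have [eta eta0 Heta] := @cube_unif_continuous R p f N e cf e0.
have := XY _ eta0 _ dl0.
move: hN; apply: filterS2 => n [B [mB PB hB]] [B' [mB' PB' hB']].
have mBB : measurable (B `|` B') by exact: measurableU.
apply: le_trans (@mean_close _ _ _ P _ _ K (2 * e) (2 * dl) (B `|` B') mBB _ _ _ _ _ _ _) _ => //.
- exact: trig_measurable.
- by rewrite mulr_ge0// ltW.
- rewrite (_ : 2 * dl = dl + dl); last by ring.
  by rewrite EFinD (le_trans (measureU2 _ _ _))// leeD.
- move=> w /not_orP[w1 w2].
  have h1 := hB w w1; have h2 := hB' w w2.
  have := Heta _ h1 _ h2.
  have : `|f (X n w) - q (X n w)| <= e by apply: fq => j; exact: le_trans (h1 j) NN'.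
  move=> a b; rewrite (_ : _ - _ = (f (X n w) - q (X n w)) - (f (X n w) - f (Y n w))); last by ring.
  by rewrite (le_trans (ler_normB _ _))// (_ : 2 * e = e + e); [rewrite lerD|ring].
- rewrite [leRHS](_ : _ = 2 * e + e); last by ring.
  rewrite lerD2l /dl mulrCA !mulrA ler_pdivrMr//.
  have : 0 <= e * K by rewrite mulr_ge0// ltW.
  nra.
Qed.

End cramer_wold.

(** Replace f by a trigonometric polynomial q, both at X and at a standard
    normal vector, at the cost of mean_trig_approx; the means of q converge by
    cramer_wold_cos. The same lemma replaces X by the nearby Y. *)
Theorem cramer_wold_slutsky (R : realType) (d : measure_display) (T : measurableType d)
    (P : probability T R) p (p_gt0 : (0 < p)%N) (Y X : nat -> T -> 'cV[R]_p) :
  (forall n i, measurable_fun setT (fun w => X n w i ord0)) ->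
  (forall c : 'cV[R]_p, enorm c = 1 -> cvg_std_normal1 P (fun n w => dotv c (X n w))) ->
  (forall eta : R, 0 < eta -> \forall x \near whp P, forall j,
    `|X x.1 x.2 j ord0 - Y x.1 x.2 j ord0| < eta) ->
  cvg_std_normal P Y.
Proof.
move=> mX cX XY f cf [K fK].
have K0 : 0 <= K := le_trans (normr_ge0 _) (fK 0).
rewrite (@cvg_expectation _ _ _ _ _ _ _ _ _ K)//.
apply/cvgrPdist_le => e e0.
have e8 : 0 < e / 8 by rewrite divr_gt0.
have tX j : tight P (fun n w => X n w j ord0).
  apply: tight_of_normal => //.
  have := cX (delta_mx j ord0) (enorm_delta _).
  by under eq_fun do under eq_fun do rewrite dotv_delta.
have mZ i := @measurable_cV_of_tuple R p i.
have tZ j : tight (std_normal p) (fun=> fun z => cV_of_tuple z j ord0 : R) by exact: tight_var.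
have [N1 H1] := mean_trig_approx mX tX XY cf fK e8.
have ZZ (eta : R) : 0 < eta -> \forall x \near whp (std_normal p), forall j,
    `|(fun _ => @cV_of_tuple R p) x.1 x.2 j ord0 - (fun _ => @cV_of_tuple R p) x.1 x.2 j ord0| < eta.
  by move=> eta0; apply: nearW => x j; rewrite subrr normr0.
have [N2 H2] := @mean_trig_approx _ _ _ (std_normal p) p (fun _ : nat => @cV_of_tuple R p)
  (fun _ : nat => @cV_of_tuple R p) f K (fun _ => mZ) tZ ZZ cf fK _ e8.
pose N := Num.max 1 (Num.max N1 N2).
have N0 : 0 < N by rewrite lt_max ltr01.
have N1N : N1 <= N by rewrite !le_max lexx/= orbT.
have N2N : N2 <= N by rewrite !le_max lexx !orbT.
have [q [tq qK fq]] := trig_approx cf fK N0 e8.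
have /filter_ex[_ h2] := H2 N N2N q tq qK fq.
have h1 := H1 N N1N q tq qK fq.
have /cvgrPdist_le/(_ _ e8) h3 :=
  trig_cvg mX mZ (cramer_wold_cos p_gt0 cX) tq.
move: h1 h3; apply: filterS2 => n h1 h3.
set a := mean _ (fun z => f _) in h2 *; set b := mean _ (fun w => f _) in h1 *.
set a' := mean _ _ in h2 h3; set b' := mean _ _ in h1 h3.
rewrite (_ : a - b = (a - a') + (a' - b') + (b' - b)); last by ring.
rewrite (le_trans (ler_normD _ _))// (le_trans (lerD (ler_normD _ _) (lexx _)))//.
rewrite distrC in h1.
have : 3 * (e / 8) + e / 8 + 3 * (e / 8) <= e by lra.
by apply: le_trans; rewrite !lerD.
Qed.

(** * Positive semidefinite square roots *)

Section square_roots.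
Context {R : realType}.

Lemma interpolation (F : fieldType) (s : seq F) (g : F -> F) :
  exists q : {poly F}, forall x, x \in s -> q.[x] = g x.
Proof.
elim: s => [|a s [q qs]]; first by exists 0.
have [ias|ias] := boolP (a \in s).
  by exists q => x; rewrite inE => /predU1P[->|]; exact: qs.
pose r := \prod_(z <- s) ('X - z%:P).
have ra : r.[a] != 0.
  rewrite horner_prod prodf_seq_neq0; apply/allP => z zs /=.
  by rewrite hornerXsubC subr_eq0; apply: contraNneq ias => ->.
exists (q + ((g a - q.[a]) / r.[a]) *: r) => x; rewrite inE hornerD hornerZ => /predU1P[->|xs].
  by rewrite divfK// addrC subrK.
rewrite qs// (_ : r.[x] = 0) ?mulr0 ?addr0//; apply/eqP.
by rewrite -/(root r x) root_prod_XsubC.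
Qed.

Lemma trmx_horner n (A : 'M[R]_n.+1) (q : {poly R}) :
  (horner_mx A q)^T = horner_mx A^T q.
Proof.
elim/poly_ind: q => [|q c IH]; first by rewrite !rmorph0 linear0.
rewrite !rmorphD !rmorphM /= linearD /= !horner_mx_C !horner_mx_X tr_scalar_mx.
congr (_ + _); rewrite -!mulmxE trmx_mul IH.
by apply: (@comm_mx_horner _ _ A^T A^T); exact: comm_mx_refl.
Qed.

(** The spectrum may live in an extension K of F: a real symmetric matrix is
    diagonalized over the complex numbers, and the conclusion returns to the
    real matrix. *)
Lemma horner_diag_eq0 (F K : fieldType) (f : {rmorphism F -> K}) n
    (A : 'M[F]_n.+1) (P : 'M[K]_n.+1) (D : 'rV[K]_n.+1) (p : {poly F}) :
  P \in unitmx -> map_mx f A = invmx P *m diag_mx D *m P ->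
  (forall i, (map_poly f p).[D ord0 i] = 0) -> horner_mx A p = 0.
Proof.
move=> Pu AE pD; apply: (@map_mx_inj _ _ f).
rewrite map_horner_mx map_mx0 AE horner_mx_uconjC// horner_mx_diag.
have -> : map_mx (horner (map_poly f p)) D = 0.
  by apply/matrixP => i j; rewrite !mxE (ord1 i) pD.
by rewrite linear0 mulmx0 mul0mx.
Qed.

Lemma qformE n (A : 'M[R]_n) (v : 'cV[R]_n) : qform A v v = dotv v (A *m v).
Proof. by rewrite /qform /dotv mulmxA. Qed.

Local Open Scope complex_scope.

(** Interpolate the fourth root at the eigenvalues, which are real and
    nonnegative. A fourth root is wanted, and not a square root, because the
    square of the symmetric matrix q(A) is positive semidefinite without any
    look at its spectrum. *)
Lemma psd_poly_root n (A : 'M[R]_n.+1) : psdmx A ->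
  exists q : {poly R}, horner_mx A (q ^+ 4) = A.
Proof.
move=> [As Ap].
pose AC : 'M[R[i]]_n.+1 := map_mx (real_complex R) A.
have ACr : AC \is a realmx.
  by apply/mxOverP => i j; rewrite mxE complex_real.
have ACs : AC \is symmetricmx.
  by apply/is_hermitianmxP; rewrite expr0 scale1r map_mx_id//; apply/matrixP => i j; rewrite !mxE -{1}As mxE.
have ACh := realsym_hermsym ACs ACr.
have /orthomx_spectralP := hermitian_normalmx ACh.
have /mxOverP dr := hermitian_spectral_diag_real ACh.
have Pu := spectral_unit AC.
move: (spectralmx AC) (spectral_diag AC) Pu dr => P D Pu Dr ACE.
have Dk i : exists2 k : R, 0 <= k & D ord0 i = k%:C.
  have /complex_realP [k Dk] := Dr ord0 i.
  exists k => //.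
  have : eigenvalue AC (k%:C).
    apply/eigenvalueP; exists (row i P).
      rewrite ACE !mulmxA -row_mul mulmxV// row1 -Dk.
      by rewrite -[delta_mx _ _ *m _]rowE row_diag_mx -scalemxAl -rowE.
    apply/eqP => Pi0; have : row i P *m invmx P = 0 by rewrite Pi0 mul0mx.
    rewrite -row_mul mulmxV// row1 => /rowP/(_ i); rewrite !mxE !eqxx/= => /eqP.
    by rewrite oner_eq0.
  rewrite eigenvalue_root_char -map_char_poly fmorph_root -eigenvalue_root_char.
  move=> /eigenvalueP[v vA v0].
  have := Ap v^T; rewrite /qform trmxK vA -scalemxAl mxE.
  have : 0 < (v *m v^T) ord0 ord0.
    rewrite mxE; have [j vj] : exists j, v ord0 j != 0.
      apply/existsP; rewrite -negb_forall; apply: contra v0 => /forallP v0.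
      by apply/eqP/rowP => j; rewrite mxE; exact/eqP/v0.
    rewrite (bigD1 j)//= mxE ltr_pwDl// ?sumr_ge0//; last first.
      by move=> k' _; rewrite mxE -expr2 sqr_ge0.
    by rewrite -expr2 lt_neqAle eq_sym sqrf_eq0 vj sqr_ge0.
  by move=> vv; rewrite pmulr_lge0.
pose lam i := complex.Re (D ord0 i).
have [q qE] := interpolation [seq lam i | i <- enum 'I_n.+1] (fun x => Num.sqrt (Num.sqrt x)).
exists q.
have h : horner_mx A (q ^+ 4 - 'X) = 0.
  apply: (horner_diag_eq0 Pu ACE) => i; have [k k0 Dik] := Dk i.
  rewrite Dik horner_map hornerD hornerN hornerX horner_exp.
  rewrite (_ : q.[k] = Num.sqrt (Num.sqrt k)); last first.
    apply: qE; apply/mapP; exists i; first by rewrite mem_enum.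
    by rewrite /lam Dik.
  rewrite (exprM _ 2 2) !sqr_sqrtr ?sqrtr_ge0// subrr.
  by rewrite rmorph0.
by move/eqP: h; rewrite rmorphB /= horner_mx_X subr_eq0 => /eqP.
Qed.

Lemma sym_sqr_psd n (C : 'M[R]_n) : C^T = C -> psdmx (C *m C).
Proof.
move=> Cs; split; first by rewrite trmx_mul Cs.
move=> v; rewrite /qform !mulmxA -{1}Cs -mulmxA -trmx_mul mxE.
by apply: sumr_ge0 => i _; rewrite mxE -expr2 sqr_ge0.
Qed.

Lemma psd_root n (A : 'M[R]_n) : psdmx A -> exists2 B, psdmx B & B *m B = A.
Proof.
case: n A => [|n] A Apsd.
  by exists A => //; apply/matrixP => -[].
have [q qA] := psd_poly_root Apsd.
pose C := horner_mx A q.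
have Cs : C^T = C by rewrite /C trmx_horner; case: Apsd => ->.
exists (C *m C); first exact: sym_sqr_psd.
by rewrite -[RHS]qA rmorphXn /= (exprM _ 2 2) !expr2 !mulmxE.
Qed.

Lemma sqrtmxP n (A : 'M[R]_n) : psdmx A -> psdmx (sqrtmx A) /\ sqrtmx A *m sqrtmx A = A.
Proof.
move=> /psd_root [B Bp BA]; rewrite /sqrtmx.
by case: xgetP => [C _ //|/(_ B)]; case.
Qed.
End square_roots.

(** * Matrix norms and the continuity of the square root *)

Section matrix_norms.
Context {R : realType}.

Lemma mx_entry_le m n (A : 'M[R]_(m, n)) i j : `|A i j| <= `|A|.
Proof. by rewrite [leRHS]mx_normrE (le_bigmax _ _ (i, j)). Qed.

Lemma mx_norm_le m n (A : 'M[R]_(m, n)) c : 0 <= c ->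
  (forall i j, `|A i j| <= c) -> `|A| <= c.
Proof. by move=> c0 Ac; rewrite [leLHS]mx_normrE; apply/bigmax_leP; split => // -[i j] _; exact: Ac. Qed.

Lemma mulmx_norm m n q (A : 'M[R]_(m, n)) (B : 'M[R]_(n, q)) :
  `|A *m B| <= n%:R * (`|A| * `|B|).
Proof.
apply: mx_norm_le => [|i j]; first by rewrite !mulr_ge0.
rewrite mxE (le_trans (ler_norm_sum _ _ _))//.
rewrite -[X in X%:R](card_ord n) mulr_natl -sumr_const; apply: ler_sum => k _.
by rewrite normrM ler_pM// mx_entry_le.
Qed.

Lemma trmx_norm m n (A : 'M[R]_(m, n)) : `|A^T| = `|A|.
Proof.
apply/eqP; rewrite eq_le; apply/andP; split; apply: mx_norm_le => // i j.
  by rewrite mxE mx_entry_le.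
by have := mx_entry_le A^T j i; rewrite mxE.
Qed.

Lemma mxtrace_norm n (A : 'M[R]_n) : `|\tr A| <= n%:R * `|A|.
Proof.
rewrite /mxtrace (le_trans (ler_norm_sum _ _ _))//.
rewrite -[X in X%:R](card_ord n) mulr_natl -sumr_const; apply: ler_sum => k _.
exact: mx_entry_le.
Qed.

(** The maximum norm is at most the Frobenius norm. *)
Lemma norm_sqr_le_trace m n (A : 'M[R]_(m, n)) : `|A| ^+ 2 <= \tr (A^T *m A).
Proof.
have trE : \tr (A^T *m A) = \sum_j \sum_i A i j ^+ 2.
  by apply: eq_bigr => j _; rewrite mxE; apply: eq_bigr => i _; rewrite mxE expr2.
have tr0 : 0 <= \tr (A^T *m A).
  by rewrite trE; apply: sumr_ge0 => j _; apply: sumr_ge0 => i _; exact: sqr_ge0.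
rewrite -[leRHS]sqr_sqrtr// lerXn2r ?nnegrE ?sqrtr_ge0//.
apply: mx_norm_le => [|i j]; first exact: sqrtr_ge0.
rewrite -sqrtr_sqr ler_sqrt// trE (bigD1 j)//= (bigD1 i)//= -addrA lerDl addr_ge0//.
  by apply: sumr_ge0 => k _; exact: sqr_ge0.
by apply: sumr_ge0 => k _; apply: sumr_ge0 => l _; exact: sqr_ge0.
Qed.

Lemma psd_trace_conj n q (C : 'M[R]_n) (D : 'M[R]_(n, q)) : psdmx C ->
  0 <= \tr (D^T *m C *m D).
Proof.
move=> [_ Cp]; apply: sumr_ge0 => i _.
have := Cp (col i D); rewrite /qform.
suff -> : ((col i D)^T *m C *m col i D) ord0 ord0 = (D^T *m C *m D) i i by [].
by rewrite tr_col -row_mul colE mulmxA -row_mul -colE !mxE.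
Qed.

(** With D = C - C0 and E a root of C0, the identity
    C^2 - C0^2 = C D + D C0 gives
    tr (D (C^2 - C0^2)) = tr (D C D) + |E D|^2 in Frobenius norm, where both
    terms are nonnegative. So |E D|^2 is at most a multiple of
    |D| |C^2 - C0^2|, while |D| is at most a multiple of |E^-1| |E D|. *)
Lemma root_lip n (C C0 : 'M[R]_n) : psdmx C -> psdmx C0 -> C0 \in unitmx ->
  `|C - C0| <= n%:R ^+ 5 * `|invmx C0| * `|C *m C - C0 *m C0|.
Proof.
move=> Cp C0p C0u.
have [E Ep EE] := psd_root C0p.
have Eu : E \in unitmx by move: C0u; rewrite -EE unitmx_mul => /andP[].
set D := C - C0; set De := _ - _ *m _.
have Es : E^T = E by case: Ep.
have Ds : D^T = D by rewrite linearB /=; case: Cp => ->; case: C0p => ->.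
have DeE : De = C *m D + D *m C0.
  by rewrite /De /D mulmxBr mulmxBl addrA subrK.
have h1 : `|E *m D| ^+ 2 <= \tr (D *m De).
  rewrite (le_trans (norm_sqr_le_trace _))// DeE mulmxDr mxtraceD.
  have -> : \tr (D *m (D *m C0)) = \tr ((E *m D)^T *m (E *m D)).
    by rewrite trmx_mul Es Ds mulmxA mxtrace_mulC -EE !mulmxA mxtrace_mulC !mulmxA.
  by rewrite lerDr; have := psd_trace_conj D Cp; rewrite Ds mulmxA.
have h2 : \tr (D *m De) <= n%:R ^+ 2 * (`|D| * `|De|).
  rewrite (le_trans (ler_norm _))// (le_trans (mxtrace_norm _))// expr2 -mulrA.
  by rewrite ler_wpM2l// mulmx_norm.
have h3 : `|invmx E| ^+ 2 <= n%:R * `|invmx C0|.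
  rewrite (le_trans (norm_sqr_le_trace _))//.
  suff -> : (invmx E)^T *m invmx E = invmx C0.
    by rewrite (le_trans (ler_norm _))// mxtrace_norm.
  have C0E : C0 *m (invmx E *m invmx E) = 1%:M.
    by rewrite -EE -mulmxA (mulmxA E (invmx E)) mulmxV// mul1mx mulmxV.
  by rewrite trmx_inv Es -[LHS](mulKmx C0u) C0E mulmx1.
have h4 : `|D| <= n%:R * (`|invmx E| * `|E *m D|).
  by rewrite -{1}(mulKmx Eu D) mulmx_norm.
have [D0|D0] := eqVneq `|D| 0; first by rewrite D0 !mulr_ge0.
have Dp : 0 < `|D| by rewrite lt_neqAle eq_sym D0/=.
rewrite -(ler_pM2l Dp) -expr2.
have h5 : `|D| ^+ 2 <= n%:R ^+ 2 * (`|invmx E| ^+ 2 * `|E *m D| ^+ 2).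
  by rewrite -!exprMn; apply: lerXn2r; rewrite ?nnegrE ?mulr_ge0.
rewrite (le_trans h5)//.
have h6 : `|invmx E| ^+ 2 * `|E *m D| ^+ 2 <= (n%:R * `|invmx C0|) * (n%:R ^+ 2 * (`|D| * `|De|)).
  by rewrite ler_pM ?sqr_ge0// (le_trans h1).
have -> : `|D| * (n%:R ^+ 5 * `|invmx C0| * `|De|) =
  n%:R ^+ 2 * ((n%:R * `|invmx C0|) * (n%:R ^+ 2 * (`|D| * `|De|))) by ring.
by rewrite ler_wpM2l// sqr_ge0.
Qed.
End matrix_norms.

(** * Bounded and negligible matrices along a filter *)

Section negligible.
Context {R : realType} {X : Type}.
Variable F : set_system X.
Hypothesis FF : Filter F.

Definition bnd m n (f : X -> 'M[R]_(m, n)) := exists K : R, \forall x \near F, `|f x| <= K.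
Definition small m n (f : X -> 'M[R]_(m, n)) := `|f x| @[x --> F] --> (0 : R).

Lemma small_le m n m' n' (f : X -> 'M[R]_(m, n)) (g : X -> 'M[R]_(m', n')) (K : R) :
  (\forall x \near F, `|f x| <= K * `|g x|) -> small g -> small f.
Proof.
move=> fg sg.
have h : K * `|g x| @[x --> F] --> 0 by rewrite -(mulr0 K); apply: cvgM => //; exact: cvg_cst.
apply: (squeeze_cvgr _ _ h); last exact: cvg_cst.
by apply: filterS fg => x fx; rewrite normr_ge0.
Qed.

Lemma small_near m n (f g : X -> 'M[R]_(m, n)) :
  (\forall x \near F, f x = g x) -> small g -> small f.
Proof.
move=> fg; apply: (@small_le _ _ _ _ _ _ 1); apply: filterS fg => x ->.
by rewrite mul1r.
Qed.

Lemma bnd_near m n (f g : X -> 'M[R]_(m, n)) :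
  (\forall x \near F, f x = g x) -> bnd g -> bnd f.
Proof. by move=> fg [K gK]; exists K; move: fg gK; apply: filterS2 => x ->. Qed.

Lemma bndP m n (f : X -> 'M[R]_(m, n)) : bnd f -> exists2 K, 0 < K & \forall x \near F, `|f x| <= K.
Proof.
move=> [K fK]; exists (`|K| + 1); first by rewrite ltr_wpDl.
apply: filterS fK => x /le_trans; apply; rewrite (le_trans (ler_norm K))// lerDl//.
Qed.

Lemma smallD m n (f g : X -> 'M[R]_(m, n)) : small f -> small g -> small (fun x => f x + g x).
Proof.
move=> sf sg; have h : `|f x| + `|g x| @[x --> F] --> (0 : R).
  by rewrite -(addr0 0); exact: cvgD.
apply: (squeeze_cvgr _ _ h); last exact: cvg_cst.
by apply: nearW => x; rewrite normr_ge0 ler_normD.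
Qed.

Lemma small_subrr m n (f : X -> 'M[R]_(m, n)) : small (fun x => f x - f x).
Proof.
rewrite /small (_ : (fun x => _) = fun=> 0); first exact: cvg_cst.
by apply/funext => x; rewrite subrr normr0.
Qed.

Lemma smallN m n (f : X -> 'M[R]_(m, n)) : small f -> small (fun x => - f x).
Proof. by rewrite /small; under eq_fun do rewrite -normrN. Qed.

Lemma small_mul_l m n q (f : X -> 'M[R]_(m, n)) (g : X -> 'M[R]_(n, q)) :
  bnd f -> small g -> small (fun x => f x *m g x).
Proof.
move=> /bndP[K K0 fK]; apply: (@small_le _ _ _ _ _ _ (n%:R * K)); apply: filterS fK => x fx.
by rewrite (le_trans (mulmx_norm _ _))// -mulrA ler_wpM2l// ler_wpM2r.
Qed.

Lemma small_mul_r m n q (f : X -> 'M[R]_(m, n)) (g : X -> 'M[R]_(n, q)) :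
  small f -> bnd g -> small (fun x => f x *m g x).
Proof.
move=> sf /bndP[K K0 gK]; move: sf; apply: (@small_le _ _ _ _ _ _ (n%:R * K)); apply: filterS gK => x gx.
by rewrite (le_trans (mulmx_norm _ _))// -mulrA ler_wpM2l// mulrC ler_wpM2r.
Qed.

Lemma bnd_mul m n q (f : X -> 'M[R]_(m, n)) (g : X -> 'M[R]_(n, q)) :
  bnd f -> bnd g -> bnd (fun x => f x *m g x).
Proof.
move=> /bndP[K K0 fK] /bndP[K' K'0 gK]; exists (n%:R * (K * K')).
move: fK gK; apply: filterS2 => x fx gx.
by rewrite (le_trans (mulmx_norm _ _))// ler_wpM2l// ler_pM.
Qed.

Lemma bndD m n (f g : X -> 'M[R]_(m, n)) : bnd f -> bnd g -> bnd (fun x => f x + g x).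
Proof.
move=> [K fK] [K' gK]; exists (K + K'); move: fK gK; apply: filterS2 => x fx gx.
by rewrite (le_trans (ler_normD _ _))// lerD.
Qed.

Lemma bnd_tr m n (f : X -> 'M[R]_(m, n)) : bnd f -> bnd (fun x => (f x)^T).
Proof. by move=> [K fK]; exists K; apply: filterS fK => x; rewrite trmx_norm. Qed.

Lemma bnd_cst m n (A : 'M[R]_(m, n)) : bnd (fun=> A).
Proof. by exists `|A|; apply: nearW. Qed.

Lemma small_bnd m n (f : X -> 'M[R]_(m, n)) : small f -> bnd f.
Proof.
by move=> /cvgr_le/(_ 1 ltr01) h; exists 1.
Qed.

Lemma small_sub_bnd m n (f g : X -> 'M[R]_(m, n)) :
  bnd g -> small (fun x => f x - g x) -> bnd f.
Proof.
move=> bg /small_bnd sf.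
rewrite (_ : f = fun x => (f x - g x) + g x); first exact: bndD.
by apply/funext => x; rewrite subrK.
Qed.

Lemma smallM_sub m n q (f f' : X -> 'M[R]_(m, n)) (g g' : X -> 'M[R]_(n, q)) :
  bnd f' -> bnd g' -> small (fun x => f x - f' x) -> small (fun x => g x - g' x) ->
  small (fun x => f x *m g x - f' x *m g' x).
Proof.
move=> bf bg sf sg; have bgg := small_sub_bnd bg sg.
rewrite (_ : (fun x => _) = (fun x => (f x - f' x) *m g x + f' x *m (g x - g' x))).
  by apply: smallD; [exact: small_mul_r|exact: small_mul_l].
by apply/funext => x; rewrite mulmxBl mulmxBr addrA subrK.
Qed.

Lemma small_tr m n (f : X -> 'M[R]_(m, n)) : small f -> small (fun x => (f x)^T).
Proof.
by apply: (@small_le _ _ _ _ _ _ 1); apply: nearW => x; rewrite trmx_norm mul1r.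
Qed.

Lemma smallZ m n (c : R) (f : X -> 'M[R]_(m, n)) : small f -> small (fun x => c *: f x).
Proof.
by apply: (@small_le _ _ _ _ _ _ `|c|); apply: nearW => x; rewrite normrZ.
Qed.

Lemma small_entries m n (f : X -> 'M[R]_(m, n)) :
  (forall i j, f x i j @[x --> F] --> 0) -> small f.
Proof.
move=> fij; apply/cvgr0Pnorm_lt => e e0.
have e2 : 0 < e / 2 by rewrite divr_gt0.
have : \forall x \near F, forall i j, `|f x i j| < e / 2.
  apply: filter_forall => i; apply: filter_forall => j.
  by move/cvgr0Pnorm_lt : (fij i j); exact.
apply: filterS => x fx; rewrite normr_id.
apply: (@le_lt_trans _ _ (e / 2)); last by rewrite ltr_pdivrMr// ltr_pMr// ltr1n.
by apply: mx_norm_le => [|i j]; rewrite ltW.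
Qed.

Lemma small_scalar n (f : X -> R) : f x @[x --> F] --> 0 -> small (fun x => (f x)%:M : 'M[R]_n).
Proof.
move=> f0; apply: small_entries => i j.
have -> : (fun x => (f x)%:M i j) = (if i == j then fun x => f x else fun=> 0).
  by apply/funext => x; rewrite mxE; case: (i == j).
by case: ifP => _ //; exact: cvg_cst.
Qed.

(** A left null vector v of W satisfies v = - v (W - 1), so that
    |v| <= n |W - 1| |v|, which forces v = 0 once n |W - 1| < 1. *)
Lemma small_unit n (W : X -> 'M[R]_n) : small (fun x => W x - 1%:M) ->
  \forall x \near F, W x \in unitmx.
Proof.
move=> sW.
have e0 : 0 < (n%:R + 1)^-1 :> R by rewrite invr_gt0 ltr_wpDl.
have /cvgr_lt/(_ _ e0) := sW; apply: filterS => x.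
set N := W x - 1%:M => hN.
have hN' : n%:R * `|N| < 1.
  have n1 : 0 < n%:R + 1 :> R by rewrite ltr_wpDl.
  move: hN; rewrite -[(_ + 1)^-1]mul1r ltr_pdivlMr// => hN.
  by rewrite (le_lt_trans _ hN)// mulrC ler_wpM2l// lerDl.
rewrite -row_free_unit -kermx_eq0; apply/eqP/row_matrixP => i; rewrite row0.
set v := row i _.
have vW : v *m W x = 0 by rewrite -row_mul mulmx_ker row0.
have vN : v = - (v *m N) by rewrite mulmxBr vW mulmx1 sub0r opprK.
apply/eqP; rewrite -normr_eq0; apply/negPn/negP => v0.
have vp : 0 < `|v| by rewrite lt_neqAle eq_sym v0/=.
have : `|v| <= n%:R * (`|v| * `|N|) by rewrite {1}vN normrN mulmx_norm.
rewrite mulrCA -{1}(mulr1 `|v|) ler_pM2l//.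
by rewrite leNgt hN'.
Qed.

(** Write W = (1 + N) S with N = (W - S) S^-1 small. Then
    W^-1 = S^-1 - W^-1 N, and absorbing the last term, whose norm is at most
    half of |W^-1|, bounds W^-1. *)
Lemma small_inv n (W S : X -> 'M[R]_n) :
  (\forall x \near F, S x \in unitmx) -> bnd (fun x => invmx (S x)) ->
  small (fun x => W x - S x) ->
  (\forall x \near F, W x \in unitmx) /\ small (fun x => invmx (W x) - invmx (S x)).
Proof.
move=> Su bS sW.
pose N x := (W x - S x) *m invmx (S x).
have sN : small N by exact: small_mul_r.
have Wu : \forall x \near F, W x \in unitmx.
  have : \forall x \near F, 1%:M + N x \in unitmx.
    by apply: small_unit; rewrite (_ : (fun x => _) = N)//; apply/funext => x; rewrite addrC addKr.
  move: Su; apply: filterS2 => x Sx Nx.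
  suff -> : W x = (1%:M + N x) *m S x by rewrite unitmx_mul Nx.
  by rewrite /N mulmxDl mul1mx mulmxKV// addrC subrK.
split => //.
have key : \forall x \near F, invmx (W x) - invmx (S x) = - (invmx (W x) *m N x).
  move: Su Wu; apply: filterS2 => x Sx Wx.
  by rewrite /N mulmxA mulmxBr mulVmx// mulmxBl mul1mx mulmxK// opprB.
have bW : bnd (fun x => invmx (W x)).
  have [K K0 hK] := bndP bS.
  exists (2 * K).
  have e0 : 0 < (2 * (n%:R + 1))^-1 :> R by rewrite invr_gt0 mulr_gt0// ltr_wpDl.
  have /cvgr_le/(_ _ e0) hN := sN.
  move: hN; apply: filterS3 hK key => x hK hx hN.
  have E : invmx (W x) = invmx (S x) - invmx (W x) *m N x by rewrite -hx addrC subrK.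
  have : `|invmx (W x)| <= K + n%:R * (`|invmx (W x)| * `|N x|).
    by rewrite {1}E (le_trans (ler_normB _ _))// lerD// mulmx_norm.
  have n1 : 0 < n%:R + 1 :> R by rewrite ltr_wpDl.
  have : n%:R * `|N x| <= 2^-1.
    rewrite (@le_trans _ _ ((n%:R + 1) * `|N x|))// ?ler_wpM2r ?lerDl//.
    by rewrite -ler_pdivlMl// mulrC -invfM.
  move=> h1 h2.
  have : n%:R * (`|invmx (W x)| * `|N x|) <= `|invmx (W x)| * 2^-1.
    by rewrite mulrCA ler_wpM2l.
  lra.
apply: small_near key _; apply: smallN; exact: small_mul_l.
Qed.
End negligible.

Lemma cvg_distr_near (R : realType) (E : topologicalType)
    (d : measure_display) (T : measurableType d) (P : probability T R)
    (Y Y' : nat -> T -> E) (d' : measure_display) (T' : measurableType d')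
    (Q : probability T' R) (Z : T' -> E) :
  (\forall n \near \oo, forall w, Y n w = Y' n w) ->
  cvg_distr P Y Q Z -> cvg_distr P Y' Q Z.
Proof.
move=> YY' h f cf fb; have := h f cf fb; apply: cvg_trans; apply: near_eq_cvg.
apply: filterS YY' => n e.
by congr expectation; apply/funext => w; rewrite e.
Qed.

(** * Quadratic forms *)

Section quadratic_forms.
Context {R : realType}.

Lemma dotvC n (u v : 'cV[R]_n) : dotv u v = dotv v u.
Proof. by rewrite !dotvE; apply: eq_bigr => i _; rewrite mulrC. Qed.

Lemma dotv_mull m n (A : 'M[R]_(m, n)) u v : dotv (A *m u) v = dotv u (A^T *m v).
Proof. by rewrite /dotv trmx_mul !mulmxA. Qed.

Lemma qformZ n (A : 'M[R]_n) (k : R) v : qform A (k *: v) (k *: v) = k ^+ 2 * qform A v v.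
Proof. by rewrite !qformE -scalemxAr dotvZl dotvC dotvZl dotvC mulrA expr2. Qed.

Lemma enorm_normalize n (v : 'cV[R]_n) : v != 0 -> enorm (normalize v) = 1.
Proof.
move=> v0; have e0 : enorm v != 0 by apply: contra_neq v0 => /enorm_eq0.
by rewrite /normalize enormZ ger0_norm ?invr_ge0 ?enorm_ge0// mulVf.
Qed.

Lemma enorm_gt0 n (v : 'cV[R]_n) : v != 0 -> 0 < enorm v.
Proof.
move=> v0; rewrite lt_neqAle enorm_ge0 andbT eq_sym.
by apply: contra_neq v0 => /enorm_eq0.
Qed.

Lemma enorm_entry n (v : 'cV[R]_n) i : `|v i ord0| <= enorm v.
Proof.
rewrite -sqrtr_sqr ler_sqrt; last by apply: sumr_ge0 => j _; exact: sqr_ge0.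
by rewrite (bigD1 i)//= lerDl; apply: sumr_ge0 => j _; exact: sqr_ge0.
Qed.

Lemma posdef_psd_unit n (A : 'M[R]_n) : A^T = A ->
  (forall v : 'cV[R]_n, enorm v = 1 -> 0 < qform A v v) -> psdmx A /\ A \in unitmx.
Proof.
move=> As Ap.
have Ap' (v : 'cV[R]_n) : v != 0 -> 0 < qform A v v.
  move=> v0; have := Ap _ (enorm_normalize v0); rewrite /normalize qformZ.
  by rewrite pmulr_rgt0// exprn_gt0// invr_gt0 enorm_gt0.
split; first (split => // v).
  have [->|v0] := eqVneq v 0; last exact/ltW/Ap'.
  by rewrite qformE dotv0l.
rewrite -row_free_unit -kermx_eq0; apply/eqP/row_matrixP => i; rewrite row0.
set v := row i _.
have vA : v *m A = 0 by rewrite -row_mul mulmx_ker row0.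
apply/eqP/negPn/negP => v0.
have : v^T != 0 by apply: contraNneq v0 => /(congr1 trmx); rewrite trmxK trmx0 => ->.
by move=> /Ap'; rewrite /qform trmxK vA mul0mx mxE ltxx.
Qed.

Lemma psd_conj n (A B : 'M[R]_n) : psdmx B -> psdmx (A *m B *m A^T).
Proof.
move=> [Bs Bp]; split; first by rewrite !trmx_mul trmxK Bs mulmxA.
move=> v; have := Bp (A^T *m v).
by rewrite !qformE dotv_mull trmxK !mulmxA.
Qed.

Lemma psd_inv n (A : 'M[R]_n) : psdmx A -> psdmx (invmx A).
Proof.
move=> [As Ap]; have [Au|Au] := boolP (A \in unitmx); last first.
  by rewrite invmx_out.
split; first by rewrite trmx_inv As.
move=> v; have := Ap (invmx A *m v).
by rewrite !qformE mulmxA mulmxV// mul1mx dotvC.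
Qed.
End quadratic_forms.

(** * Whitening and studentization *)

Section whitening.
Context {R : realType} {d : measure_display} {T : measurableType d}.
Variable P : probability T R.
Variables (p : nat) (p_gt0 : (0 < p)%N) (n0 : nat).

(** The directions b are sequences and the bounds c1 and c2 may depend on them:
    there is no bound on Sg uniform over all directions, and the arguments
    below apply the property to directions built from Sg itself. *)
Definition directional_clt (Z : nat -> T -> 'cV[R]_p) (Sg : nat -> 'M[R]_p) : Prop :=
  forall b : nat -> 'cV[R]_p, (forall n, enorm (b n) = 1) ->
    (exists c1 c2 : R, 0 < c1 /\
      forall n, (n0 < n)%N -> c1 <= qform (Sg n) (b n) (b n) <= c2) /\
    cvg_std_normal1 P (fun n w =>
      (Num.sqrt (qform (Sg n) (b n) (b n)))^-1 * dotv (b n) (Z n w)).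

Variables (Z : nat -> T -> 'cV[R]_p) (Sg : nat -> 'M[R]_p).
Hypothesis mZ : forall n i, measurable_fun setT (fun w => Z n w i ord0).
Hypothesis Sgs : forall n, (n0 < n)%N -> (Sg n)^T = Sg n.
Hypothesis clt : directional_clt Z Sg.

Let e0 : 'cV[R]_p := delta_mx (Ordinal p_gt0) ord0.

Lemma Sg_psd n : (n0 < n)%N -> psdmx (Sg n) /\ Sg n \in unitmx.
Proof.
move=> nn0; apply: posdef_psd_unit; first exact: Sgs.
move=> v v1; have [[c1 [c2 [c10 h]]] _] := clt (fun=> v1).
by case/andP: (h n nn0) => /(lt_le_trans c10).
Qed.

Variable Q : nat -> 'M[R]_p.
Hypothesis QSg : \forall n \near \oo, Q n *m Sg n *m (Q n)^T = 1%:M.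

(** Along b = Q^T c / |Q^T c| the variance of Z is |Q^T c|^-2, because Q
    whitens Sg. *)
Lemma whiten_dir (c : 'cV[R]_p) : enorm c = 1 ->
  exists b : nat -> 'cV[R]_p, [/\ forall n, enorm (b n) = 1,
    \forall n \near \oo, 0 < enorm ((Q n)^T *m c),
    \forall n \near \oo, b n = (enorm ((Q n)^T *m c))^-1 *: ((Q n)^T *m c) &
    \forall n \near \oo, qform (Sg n) (b n) (b n) = (enorm ((Q n)^T *m c)) ^- 2].
Proof.
move=> c1.
pose q n := (Q n)^T *m c.
exists (fun n => if q n == 0 then e0 else normalize (q n)).
have qn0 : \forall n \near \oo, q n != 0.
  apply: filterS QSg => n Qn; apply/eqP => qn.
  have : qform (1%:M : 'M[R]_p) c c = 0.
    by rewrite qformE -Qn -!mulmxA -/(q n) qn !mulmx0 dotvC dotv0l.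
  by rewrite qformE mul1mx -enorm_sqr c1 expr1n => /eqP; rewrite oner_eq0.
split.
- move=> n; case: eqP => [_|/eqP qn]; first exact: enorm_delta.
  exact: enorm_normalize.
- by apply: filterS qn0 => n qn; exact: enorm_gt0.
- by apply: filterS qn0 => n /negbTE ->.
- move: qn0 QSg; apply: filterS2 => n qn Qn; rewrite (negbTE qn) qformZ exprVn.
  rewrite qformE /q dotv_mull trmxK !mulmxA Qn mul1mx -enorm_sqr c1 expr1n mulr1.
  by [].
Qed.

Lemma whiten_cvg c : enorm c = 1 -> cvg_std_normal1 P (fun n w => dotv c (Q n *m Z n w)).
Proof.
move=> c1; have [b [b1 qp bE qE]] := whiten_dir c1.
have [_ h] := clt b1.
apply: cvg_distr_near h; move: qp bE qE; apply: filterS3 => n qp bE qE w.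
rewrite qE bE sqrtrV ?exprn_ge0 ?ltW// sqrtr_sqr ger0_norm ?ltW// invrK.
by rewrite dotvZl mulrA divff ?gt_eqF// mul1r dotv_mull trmxK.
Qed.

Local Notation F := (whp P).

Lemma bnd_nat m k (f : nat -> 'M[R]_(m, k)) (K : R) :
  (\forall n \near \oo, forall i j, `|f n i j| <= K) -> bnd F (fun x => f x.1).
Proof.
move=> fK; exists `|K|; apply: (@whp_near _ _ _ P (fun n => `|f n| <= `|K|)).
apply: filterS fK => n fK; apply: mx_norm_le => // i j.
by rewrite (le_trans (fK i j))// ler_norm.
Qed.

Lemma bnd_rows m k (f : nat -> 'M[R]_(m, k)) :
  (forall i, exists K : R, \forall n \near \oo, forall j, `|f n i j| <= K) -> bnd F (fun x => f x.1).
Proof.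
move=> /choice [K HK]; apply: (@bnd_nat _ _ _ (\sum_i `|K i|)).
have H : \forall n \near \oo, forall i j, `|f n i j| <= K i by exact: filter_forall.
apply: filterS H => n h i j; rewrite (le_trans (h i j))// (le_trans (ler_norm _))//.
by rewrite (bigD1 i)//= lerDl; apply: sumr_ge0.
Qed.

(** The rows of Q are the vectors Q^T e_i, and |Q^T e_i|^-2 is the variance of
    Z along a unit direction, so it is bounded below. *)
Lemma whiten_bnd : bnd F (fun x => Q x.1).
Proof.
apply: bnd_rows => i.
have [b [b1 qp bE qE]] := whiten_dir (enorm_delta i).
have [[c1 [c2 [c10 h]]] _] := clt b1.
exists (Num.sqrt c1^-1).
have := nbhs_infty_gt n0; move: qp qE; apply: filterS3 => n qp qE /h /andP[h1 _] j.
have -> : Q n i j = ((Q n)^T *m (delta_mx i ord0 : 'cV[R]_p)) j ord0.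
  by rewrite -colE !mxE.
rewrite (le_trans (enorm_entry _ _))//.
rewrite -[leLHS]ger0_norm ?enorm_ge0// -sqrtr_sqr; apply: ler_wsqrtr.
rewrite qE in h1.
rewrite -[leLHS]invrK lef_pV2 ?posrE//.
by rewrite invr_gt0 exprn_gt0.
Qed.

Lemma whiten_unit : \forall n \near \oo, Q n \in unitmx.
Proof.
by apply: filterS QSg => n; rewrite -mulmxA => /mulmx1_unit[].
Qed.

(** Since Sg = Q^-1 Q^-T, the squared norm of the row i of Q^-1 is the variance
    of Z along e_i, so it is bounded above. *)
Lemma whiten_inv_bnd : bnd F (fun x => invmx (Q x.1)).
Proof.
apply: (@bnd_rows _ _ (fun n => invmx (Q n))) => i.
have [[c1 [c2 [c10 h]]] _] := @clt (fun=> delta_mx i ord0) (fun=> enorm_delta i).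
exists (Num.sqrt c2).
have := nbhs_infty_gt n0; move: whiten_unit QSg; apply: filterS3 => n Qu Qn /h /andP[_ h2] j.
have SgE : Sg n = invmx (Q n) *m (invmx (Q n))^T.
  have : invmx (Q n) *m (Q n *m Sg n *m (Q n)^T) *m invmx (Q n)^T = Sg n.
    by rewrite !mulmxA mulVmx// mul1mx mulmxK// unitmx_tr.
  by rewrite Qn mulmx1 trmx_inv.
have -> : invmx (Q n) i j = ((invmx (Q n))^T *m (delta_mx i ord0 : 'cV[R]_p)) j ord0.
  by rewrite -colE !mxE.
rewrite (le_trans (enorm_entry _ _))//.
rewrite -[leLHS]ger0_norm ?enorm_ge0// -sqrtr_sqr ler_wsqrtr//.
by rewrite enorm_sqr dotv_mull trmxK mulmxA -SgE -qformE.
Qed.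

Lemma tight_whiten j : tight P (fun n w => (Q n *m Z n w) j ord0).
Proof.
apply: tight_of_normal.
  move=> n; under eq_fun do rewrite mxE.
  by apply: measurable_sum => k; exact: measurable_funM.
have := whiten_cvg (enorm_delta j).
by under eq_fun do under eq_fun do rewrite dotv_delta.
Qed.

Lemma small_tight (N : nat * T -> 'M[R]_p) (xi : nat -> T -> 'cV[R]_p) :
  small F N -> (forall j, tight P (fun n w => xi n w j ord0)) ->
  forall eta : R, 0 < eta -> \forall x \near F, forall i, `|(N x *m xi x.1 x.2) i ord0| < eta.
Proof.
move=> sN txi eta eta0; apply: filter_forall => i.
suff : (N x *m xi x.1 x.2) i ord0 @[x --> F] --> (\sum_(j < p) 0 : R).
  by rewrite big1//; move/cvgr0Pnorm_lt; exact.
under eq_fun do rewrite mxE.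
have := @cvg_big R 'I_p +%R 0 xpredT _ _ (whp P) (index_enum 'I_p)
  (fun j x => N x i j * xi x.1 x.2 j ord0) (fun=> 0) (whp_filter P).
apply => [|j _]; first exact: (@add_continuous R).
apply: (tightM_cvg0 (txi j) (e := fun x => N x i j)).
apply/cvgr0Pnorm_lt => e e0'; move/cvgr_lt : sN => /(_ e e0') h.
apply: (@filterS _ (whp P) _ _ _ _ h) => x.
exact/le_lt_trans/mx_entry_le.
Qed.

Lemma whitened_slutsky (H : nat * T -> 'M[R]_p) (Y : nat -> T -> 'cV[R]_p) :
  small F (fun x => H x - 1%:M) ->
  (\forall x \near F, Y x.1 x.2 = H x *m (Q x.1 *m Z x.1 x.2)) ->
  cvg_std_normal P Y.
Proof.
move=> sH YH.
apply: (cramer_wold_slutsky p_gt0 (X := fun n w => Q n *m Z n w)).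
- move=> n i; under eq_fun do rewrite mxE.
  by apply: measurable_sum => k; exact: measurable_funM.
- exact: whiten_cvg.
- move=> eta eta0; have := small_tight sH tight_whiten eta0.
  move: YH; apply: filterS2 => x -> h i.
  have := h i; rewrite mulmxBl mul1mx [X in `|X| < _]mxE [X in _ + X]mxE.
  by rewrite distrC.
Qed.

End whitening.

Section studentization.
Context {R : realType} {d : measure_display} {T : measurableType d}.
Variable P : probability T R.
Variables (p : nat) (p_gt0 : (0 < p)%N) (n0 : nat).
Local Notation F := (whp P).

(** The matrix C is random, and only its square is known to be close to
    C0^2 = A Sg^-1 A^T. The root C0 makes Q = C0 A^-T a whitening matrix for
    Sg, and the Lipschitz bound root_lip carries the convergence of the
    squares to C - C0. Hence Y = H (Q Z) with H = s C A^-T G^-1 Q^-1 close to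
    the identity. *)
Theorem studentized_clt (Z : nat -> T -> 'cV[R]_p) (Sg A : nat -> 'M[R]_p)
    (C W G : nat * T -> 'M[R]_p) (s : nat * T -> R) (Y : nat -> T -> 'cV[R]_p) (K : R) :
  (forall n i, measurable_fun setT (fun w => Z n w i ord0)) ->
  (forall n, (n0 < n)%N -> (Sg n)^T = Sg n) ->
  directional_clt P n0 Z Sg ->
  (\forall n \near \oo, [/\ A n \in unitmx, `|A n| <= K & `|invmx (A n)| <= K]) ->
  small (whp P) (fun x => G x - 1%:M) ->
  small (whp P) (fun x => W x - Sg x.1) ->
  s x @[x --> whp P] --> (1 : R) ->
  (\forall x \near whp P, psdmx (C x) /\ C x *m C x = A x.1 *m invmx (W x) *m (A x.1)^T) ->
  (\forall x \near whp P, Y x.1 x.2 =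
     s x *: (C x *m invmx (A x.1)^T *m invmx (G x) *m Z x.1 x.2)) ->
  cvg_std_normal P Y.
Proof.
move=> mZ Sgs clt hA sG sW s1 hC hY.
pose C0 n := sqrtmx (A n *m invmx (Sg n) *m (A n)^T).
have good : \forall n \near \oo, [/\ A n \in unitmx, Sg n \in unitmx, psdmx (C0 n),
    C0 n *m C0 n = A n *m invmx (Sg n) *m (A n)^T & C0 n \in unitmx].
  have := nbhs_infty_gt n0; move: hA; apply: filterS2 => n [Au _ _] nn0.
  have [Sp Su] := Sg_psd Sgs clt nn0.
  have [h1 h2] := sqrtmxP (psd_conj (A n) (psd_inv Sp)).
  split => //.
  have : C0 n *m C0 n \in unitmx by rewrite h2 !unitmx_mul Au unitmx_inv Su unitmx_tr.
  by rewrite unitmx_mul => /andP[].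
pose Q n := C0 n *m invmx (A n)^T.
have QSg : \forall n \near \oo, Q n *m Sg n *m (Q n)^T = 1%:M.
  apply: filterS good => n [Au Su Cp CC Cu].
  have Cs : (C0 n)^T = C0 n by case: Cp.
  rewrite /Q trmx_mul trmx_inv trmxK Cs.
  pose X := invmx (A n)^T *m Sg n *m invmx (A n).
  have CX : C0 n *m (C0 n *m X) = 1%:M.
    rewrite mulmxA CC /X !mulmxA mulmxK ?unitmx_tr// mulmxKV// mulmxV//.
  suff : C0 n *m invmx (A n)^T *m Sg n *m (invmx (A n) *m C0 n) = C0 n *m X *m C0 n.
    by move=> ->; exact: mulmx1C.
  by rewrite /X !mulmxA.
have bA : bnd F (fun x => A x.1).
  apply: (@bnd_nat _ _ _ P _ _ A K); apply: filterS hA => n [_ AK _] i j.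
  exact: le_trans (mx_entry_le _ _ _) AK.
have bAi : bnd F (fun x => invmx (A x.1)).
  apply: (@bnd_nat _ _ _ P _ _ (fun n => invmx (A n)) K); apply: filterS hA => n [_ _ AK] i j.
  exact: le_trans (mx_entry_le _ _ _) AK.
have bAti : bnd F (fun x => invmx (A x.1)^T).
  by under eq_fun do rewrite -trmx_inv; exact: bnd_tr.
have bQ : bnd F (fun x => Q x.1) by exact (whiten_bnd p_gt0 clt QSg).
have bQi : bnd F (fun x => invmx (Q x.1)) by exact (whiten_inv_bnd clt QSg).
have goodF := @whp_near _ _ _ P _ good.
have QSgF := @whp_near _ _ _ P _ QSg.
(* Whitening turns the bound on Q into a bound on Sg^-1 = Q^T Q. *)
have bSi : bnd F (fun x => invmx (Sg x.1)).
  apply: (@bnd_near _ _ _ _ _ _ _ (fun x => (Q x.1)^T *m Q x.1)); last first.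
    by apply: bnd_mul => //; exact: bnd_tr.
  move: goodF QSgF; apply: filterS2 => x [_ Su _ _ _] Qx.
  have Qu : Q x.1 \in unitmx by move: Qx; rewrite -mulmxA => /mulmx1_unit[].
  have h : Sg x.1 *m ((Q x.1)^T *m Q x.1) = 1%:M.
    by rewrite mulmxA; apply: mulmx1C; rewrite mulmxA.
  by rewrite -[RHS](mulKmx Su) h mulmx1.
have Suf : \forall x \near F, Sg x.1 \in unitmx by apply: (@filterS _ (whp P) _ _ _ _ goodF) => x [].
have [Wu sWi] := small_inv _ Suf bSi sW.
have [Gu sGi] : (\forall x \near F, G x \in unitmx) /\ small F (fun x => invmx (G x) - 1%:M).
  have := @small_inv _ _ F _ p G (fun=> 1%:M) _ _ sG.
  rewrite invmx1; apply; last exact: bnd_cst.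
  by apply: nearW => x; rewrite unitmx1.
(* From Q = C0 A^-T, the inverse of C0 is A^-T Q^-1. *)
have bC0i : bnd F (fun x => invmx (C0 x.1)).
  apply: (@bnd_near _ _ _ _ _ _ _ (fun x => invmx (A x.1)^T *m invmx (Q x.1))); last exact: bnd_mul.
  move: (whp_near P hA) goodF; apply: filterS2 => x [Au _ _] [_ _ _ _ Cu].
  have h : C0 x.1 *m (invmx (A x.1)^T *m invmx (Q x.1)) = 1%:M.
    rewrite mulmxA -/(Q x.1) mulmxV// /Q unitmx_mul Cu unitmx_inv unitmx_tr.
    by [].
  by rewrite -[RHS](mulKmx Cu) h mulmx1.
have sC : small F (fun x => C x - C0 x.1).
  have [K' K'0 hK'] := bndP _ bC0i.
  pose N x := A x.1 *m (invmx (W x) - invmx (Sg x.1)) *m (A x.1)^T.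
  have sN : small F N.
    by apply: small_mul_r; [exact: small_mul_l|exact: bnd_tr].
  apply: (@small_le _ _ _ _ _ _ _ _ _ N (p%:R ^+ 5 * K') _ sN).
  move: hK' hC goodF; apply: filterS3 => x hK' [Cp CC] [_ _ C0p C0C C0u].
  apply: (le_trans (root_lip Cp C0p C0u)).
  rewrite CC C0C -mulmxBl -mulmxBr -/(N x).
  by rewrite ler_wpM2r// ler_wpM2l// exprn_ge0.
have sCA : small F (fun x => C x *m invmx (A x.1)^T - Q x.1).
  apply: (@small_near _ _ F _ _ _ _ (fun x => (C x - C0 x.1) *m invmx (A x.1)^T)).
    by apply: nearW => x; rewrite mulmxBl.
  exact: small_mul_r.
have sH : small F (fun x => C x *m invmx (A x.1)^T *m invmx (G x) *m invmx (Q x.1) - 1%:M).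
  have h := smallM_sub (whp_filter P) bQ (bnd_cst (whp_filter P) 1%:M) sCA sGi.
  apply: (small_near (whp_filter P) _ (small_mul_r (whp_filter P) h bQi)).
  apply: (@filterS _ (whp P) _ _ _ _ QSgF) => x Qx.
  have Qu : Q x.1 \in unitmx by move: Qx; rewrite -mulmxA => /mulmx1_unit[].
  by rewrite mulmx1 mulmxBl mulmxV.
pose H x := s x *: (C x *m invmx (A x.1)^T *m invmx (G x) *m invmx (Q x.1)).
apply: (whitened_slutsky p_gt0 mZ clt QSg (H := H)).
- pose N x := C x *m invmx (A x.1)^T *m invmx (G x) *m invmx (Q x.1).
  rewrite (_ : (fun x => _) = (fun x => (s x - 1)%:M *m N x + (N x - 1%:M))); last first.
    apply/funext => x; rewrite /H -/(N x) mul_scalar_mx scalerBl scale1r.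
    by rewrite addrA subrK.
  apply: smallD => //; apply: small_mul_r; last exact: small_sub_bnd (bnd_cst _ 1%:M) sH.
  apply: small_entries => i j.
  have -> : (fun x => (s x - 1)%:M i j) = (if i == j then fun x => s x - 1 else fun=> 0).
    by apply/funext => x; rewrite mxE; case: (i == j).
  case: ifP => _; last exact: cvg_cst.
  by rewrite -(subrr (1 : R)); apply: cvgB => //; exact: cvg_cst.
- move: hY QSgF; apply: filterS2 => x -> Qx.
  have Qu : Q x.1 \in unitmx by move: Qx; rewrite -mulmxA => /mulmx1_unit[].
  rewrite /H -scalemxAl; congr (_ *: _).
  by rewrite [in RHS]mulmxA mulmxKV.
Qed.
End studentization.

(** * Exact formulas for sketched least squares *)

Section regression_algebra.
Context {R : realType} (n p k : nat).
Variables (X U : 'M[R]_(n, p)) (l : 'rV[R]_p) (V : 'M[R]_p) (y : 'cV[R]_n).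
Hypothesis svd : is_svd X U l V.
Variable S : 'M[R]_(k, n).

Let L := diag_mx l.
Let XE : X = U *m L *m V^T. Proof. by case: svd. Qed.
Let UU : U^T *m U = 1%:M. Proof. by case: svd. Qed.
Let VV : V^T *m V = 1%:M. Proof. by case: svd. Qed.
Let l0 i : 0 < l ord0 i. Proof. by case: svd. Qed.

Lemma svd_Vunit : V \in unitmx.
Proof. by case: (mulmx1_unit VV). Qed.

Lemma svd_invV : invmx V = V^T.
Proof. by rewrite -[RHS](mulmxK svd_Vunit) VV mul1mx. Qed.

Lemma svd_VVt : V *m V^T = 1%:M.
Proof. by rewrite -svd_invV mulmxV// svd_Vunit. Qed.

Lemma svd_Lunit : L \in unitmx.
Proof.
rewrite unitmxE det_diag unitfE; apply/prodf_neq0 => i _.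
by rewrite gt_eqF.
Qed.

Lemma svd_Ltr : L^T = L. Proof. exact: tr_diag_mx. Qed.

Lemma svd_invLtr : (invmx L)^T = invmx L. Proof. by rewrite trmx_inv svd_Ltr. Qed.

Lemma svd_Xtr : X^T = V *m L *m U^T.
Proof. by rewrite XE !trmx_mul trmxK svd_Ltr mulmxA. Qed.

Lemma sandwich_inv (N : 'M[R]_p) : N \in unitmx ->
  invmx (V *m L *m N *m L *m V^T) = V *m invmx L *m invmx N *m invmx L *m V^T.
Proof.
move=> Nu.
have Lu := svd_Lunit; have Vu := svd_Vunit.
have h : (V *m L *m N *m L *m V^T) *m (V *m invmx L *m invmx N *m invmx L *m V^T) = 1%:M.
  rewrite !mulmxA -(mulmxA _ V^T V) VV mulmx1 mulmxK// mulmxK// mulmxK//.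
  exact: svd_VVt.
have [Au _] := mulmx1_unit h.
by rewrite -[RHS](mulKmx Au) h mulmx1.
Qed.

Lemma sandwich_inv' (N : 'M[R]_p) : N \in unitmx ->
  invmx (V *m invmx L *m N *m invmx L *m V^T) = V *m L *m invmx N *m L *m V^T.
Proof.
move=> Nu; rewrite -[RHS]invmxK sandwich_inv ?unitmx_inv// invmxK//.
Qed.

Lemma gramE : X^T *m X = V *m L *m L *m V^T.
Proof. by rewrite svd_Xtr XE !mulmxA -(mulmxA _ U^T U) UU mulmx1. Qed.

Lemma gram_unit : X^T *m X \in unitmx.
Proof.
rewrite gramE !unitmx_mul.
by rewrite svd_Vunit svd_Lunit unitmx_tr svd_Vunit.
Qed.

Local Notation beta := (ls_est X y).
Local Notation eps := (residual X y).

Lemma residual_decomp : y = X *m beta + eps.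
Proof. by rewrite /residual addrC subrK. Qed.

Lemma normal_equation : X^T *m X *m beta = X^T *m y.
Proof. by rewrite /ls_est !mulmxA mulmxV ?gram_unit// mul1mx. Qed.

Lemma residual_orthogonal : U^T *m eps = 0.
Proof.
have : X^T *m eps = 0 by rewrite /residual mulmxBr mulmxA normal_equation subrr.
rewrite svd_Xtr -mulmxA => /(congr1 (mulmx (invmx (V *m L)))).
by rewrite mulKmx ?mulmx0// unitmx_mul svd_Vunit svd_Lunit.
Qed.

Local Notation G := (U^T *m S^T *m S *m U).
Local Notation Xt := (S *m X).

Lemma sketched_gram : Xt^T *m Xt = V *m L *m G *m L *m V^T.
Proof. by rewrite trmx_mul svd_Xtr {1}XE !mulmxA. Qed.

Lemma sketch_solve_error : G \in unitmx ->
  ls_est Xt (S *m y) - beta = V *m invmx L *m invmx G *m (U^T *m S^T *m S *m eps).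
Proof.
move=> Gu; rewrite /ls_est sketched_gram.
have h : Xt^T *m (S *m y) = Xt^T *m Xt *m beta + V *m L *m (U^T *m S^T *m S *m eps).
  rewrite {1}residual_decomp !mulmxDr !mulmxA; congr (_ + _).
  by rewrite trmx_mul svd_Xtr !mulmxA.
have Hu : V *m L *m G *m L *m V^T \in unitmx.
  by rewrite !(unitmx_mul, unitmx_tr) in Gu *; rewrite svd_Vunit svd_Lunit Gu.
rewrite -mulmxA h sketched_gram mulmxDr mulKmx// addrAC subrr add0r.
rewrite sandwich_inv// !mulmxA -(mulmxA _ V^T V) VV mulmx1.
by rewrite mulmxKV// svd_Lunit.
Qed.

Lemma partial_estE : G \in unitmx ->
  partial_est Xt X y = V *m invmx L *m invmx G *m (L *m V^T *m beta).
Proof.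
move=> Gu; rewrite /partial_est sketched_gram sandwich_inv// -mulmxA -normal_equation.
by rewrite gramE !mulmxA -(mulmxA _ V^T V) VV mulmx1 mulmxKV ?svd_Lunit.
Qed.

Lemma partial_error : G \in unitmx ->
  partial_est Xt X y - beta =
  - (V *m invmx L *m invmx G *m ((G - 1%:M) *m (L *m V^T *m beta))).
Proof.
move=> Gu; rewrite partial_estE// mulmxBl mul1mx mulmxBr opprB; congr (_ - _).
rewrite mulmxA mulmxKV// !mulmxA mulmxKV ?svd_Lunit// svd_VVt mul1mx.
by [].
Qed.

(** The sketched residual is the component of S eps orthogonal to the columns
    of S U: the part of the residual along X contributes nothing. *)
Lemma sketched_residual_norm : G \in unitmx ->
  enorm (residual Xt (S *m y)) ^+ 2 =
  dotv eps (S^T *m S *m eps) -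
  dotv (U^T *m S^T *m S *m eps) (invmx G *m (U^T *m S^T *m S *m eps)).
Proof.
move=> Gu; set z := U^T *m S^T *m S *m eps.
have -> : residual Xt (S *m y) = S *m eps - S *m U *m (invmx G *m z).
  have -> : residual Xt (S *m y) = S *m eps - Xt *m (ls_est Xt (S *m y) - beta).
    by rewrite /residual !mulmxBr !mulmxA opprB addrA subrK.
  rewrite sketch_solve_error// -/z; congr (_ - _); rewrite XE.
  rewrite !mulmxA -(mulmxA _ V^T V) VV mulmx1 mulmxK ?svd_Lunit//.
have Gs : G^T = G by rewrite !trmx_mul !trmxK !mulmxA.
rewrite enorm_sqr; set v := invmx G *m z.
have E (a b : 'cV[R]_k) : dotv (a - b) (a - b) = dotv a a - dotv b a - dotv b a + dotv b b.
  rewrite dotvDl dotvNl [dotv a _]dotvC [dotv b _]dotvC !dotvDl !dotvNl.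
  by rewrite [dotv a b]dotvC; ring.
rewrite E.
have h1 : dotv (S *m U *m v) (S *m eps) = dotv v z.
  by rewrite dotv_mull /z trmx_mul !mulmxA.
have h2 : dotv (S *m U *m v) (S *m U *m v) = dotv v z.
  rewrite dotv_mull; congr dotv.
  have -> : (S *m U)^T *m (S *m U *m v) = G *m v by rewrite trmx_mul !mulmxA.
  by rewrite /v mulKVmx.
by rewrite h1 h2 dotv_mull mulmxA [dotv z v]dotvC subrK.
Qed.
End regression_algebra.

(** * Sums, inverses and roots of positive semidefinite matrices *)

Section psd_facts.
Context {R : realType}.

Lemma psdZ n (c : R) (A : 'M[R]_n) : 0 <= c -> psdmx A -> psdmx (c *: A).
Proof.
move=> c0 [As Ap]; split; first by rewrite linearZ /= As.
by move=> v; rewrite qformE -scalemxAl dotvC dotvZl dotvC -qformE mulr_ge0.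
Qed.

Lemma psdD n (A B : 'M[R]_n) : psdmx A -> psdmx B -> psdmx (A + B).
Proof.
move=> [As Ap] [Bs Bp]; split; first by rewrite linearD /= As Bs.
by move=> v; rewrite qformE mulmxDl dotvC dotvDl !(dotvC (_ *m v)) -!qformE addr_ge0.
Qed.

Lemma outer_mul n (u v w : 'cV[R]_n) : u *m v^T *m w = dotv v w *: u.
Proof. by rewrite -mulmxA [v^T *m w]mx11_scalar mul_mx_scalar. Qed.

Lemma qform_outer n (u v : 'cV[R]_n) : qform (u *m u^T) v v = dotv u v ^+ 2.
Proof. by rewrite qformE outer_mul dotvC dotvZl expr2. Qed.

Lemma psd_outer n (u : 'cV[R]_n) : psdmx (u *m u^T).
Proof.
split; first by rewrite trmx_mul trmxK.
by move=> v; rewrite qform_outer sqr_ge0.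
Qed.

Lemma psd_gram m n (A : 'M[R]_(m, n)) : psdmx (A^T *m A).
Proof.
split; first by rewrite trmx_mul trmxK.
by move=> v; rewrite qformE -mulmxA dotvC dotv_mull trmxK -enorm_sqr sqr_ge0.
Qed.

(** Besides the invertibility, the formula shows that the inverse remains
    bounded uniformly in u. *)
Lemma sherman_morrison n (c : R) (u : 'cV[R]_n) : 0 <= c -> enorm u = 1 ->
  (1%:M + c *: (u *m u^T)) \in unitmx /\
  invmx (1%:M + c *: (u *m u^T)) = 1%:M - (c / (1 + c)) *: (u *m u^T).
Proof.
move=> c0 u1; have c1 : 1 + c != 0 by rewrite gt_eqF// ltr_pwDl.
set Q := u *m u^T.
have QQ : Q *m Q = Q by rewrite /Q mulmxA outer_mul -enorm_sqr u1 expr1n scale1r.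
have h : (1%:M + c *: Q) *m (1%:M - (c / (1 + c)) *: Q) = 1%:M.
  rewrite mulmxBr mulmx1 mulmxDl mul1mx -scalemxAl -scalemxAr QQ scalerA -scalerDl.
  rewrite -addrA -scalerBl (_ : c - _ = 0) ?scale0r ?addr0//.
  by field.
have [hu _] := mulmx1_unit h; split => //.
by rewrite -[RHS](mulKmx hu) h mulmx1.
Qed.

Lemma inv_sqrtmxP n (D : 'M[R]_n) : psdmx D -> D \in unitmx ->
  psdmx (invmx (sqrtmx D)) /\ invmx (sqrtmx D) *m invmx (sqrtmx D) = invmx D.
Proof.
move=> Dp Du; have [Bp BB] := sqrtmxP Dp; split; first exact: psd_inv.
have Bu : sqrtmx D \in unitmx by move: Du; rewrite -{1}BB unitmx_mul => /andP[].
have h : D *m (invmx (sqrtmx D) *m invmx (sqrtmx D)) = 1%:M.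
  by rewrite -{1}BB -mulmxA (mulmxA (sqrtmx D) (invmx _)) mulmxV// mul1mx mulmxV.
by rewrite -[LHS](mulKmx Du) h mulmx1.
Qed.
End psd_facts.

Lemma OP1_tight (R : realType) (d : measure_display) (T : measurableType d)
    (P : probability T R) (Y : nat -> T -> R) :
  (forall n, measurable_fun setT (Y n)) -> OP1 P Y -> tight P Y.
Proof.
move=> mY h dl dl0; have [K hK] := h dl dl0.
exists (`|K| + 1); first by rewrite ltr_wpDl.
apply: filterS hK => n hn; exists [set w | K < `|Y n w|]; split => //.
  exact: measurable_abs_gt.
move=> w /negP; rewrite -leNgt => /le_trans; apply.
by rewrite (le_trans (ler_norm K))// lerDl.
Qed.

(** * Limit theorems for the sketched estimators *)

Section sketched_regression.
Context {R : realType} {d : measure_display} {T : measurableType d}.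
Variables (P : probability T R) (p : nat) (p_gt0 : (0 < p)%N).
Variables (m : nat -> nat) (tau : nat -> nat -> R).
Variables (X U : forall n, 'M[R]_(n, p)) (l : nat -> 'rV[R]_p) (V : nat -> 'M[R]_p).
Variable S : forall k n, T -> 'M[R]_(k, n).
Variable condP : vecseq R -> vecseq R -> Prop.
Variable sigma2 : forall n, 'cV[R]_n -> 'cV[R]_n -> R.
Hypothesis m_oo : m n @[n --> \oo] --> \oo.
Hypothesis tau_gt0 : forall k n, 0 < tau k n.
Hypothesis tau_m : (tau (m n) n / (m n)%:R) @[n --> \oo] --> (0 : R).
Hypothesis svd : forall n, (p < n)%N -> is_svd (X n) (U n) (l n) (V n).
Hypothesis mS : forall k n (i : 'I_k) (j : 'I_n),
  measurable_fun [set: T] (fun w => S k n w i j : R).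
Hypothesis cond_bounded : (limn_esup (fun n =>
     (l n ord0 (Ordinal p_gt0) / l n ord0 (rev_ord (Ordinal p_gt0)))%:E) < +oo)%E.
Hypothesis clt1 : forall a a' : vecseq R, sat p condP a a' ->
  (exists c1 c2 : R, 0 < c1 /\
     forall n, (p < n)%N -> c1 <= sigma2 (a n) (a' n) <= c2) /\
  cvg_std_normal1 P (fun n w =>
    rate m tau n * (Num.sqrt (sigma2 (a n) (a' n)))^-1 * sketch_err m S a a' n w).

Local Notation F := (whp P).
Local Notation rt := (rate m tau).
Local Notation err := (sketch_err m S).
Local Notation L n := (diag_mx (l n)).
Local Notation Sn x := (S (m x.1) x.1 x.2).
Local Notation G x := ((U x.1)^T *m (Sn x)^T *m Sn x *m U x.1).

Lemma rate_gt0 : \forall n \near \oo, 0 < rt n.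
Proof.
have h : \forall n \near \oo, (0 < m n)%N.
  exact: (m_oo (nbhs_infty_gt 0)).
apply: filterS h => n m0.
by rewrite /rate mulr_gt0 ?invr_gt0 ?sqrtr_gt0 ?ltr0n.
Qed.

Lemma rate_inv : (rt n)^-1 @[n --> \oo] --> (0 : R).
Proof.
have -> : (fun n => (rt n)^-1) = (fun n => Num.sqrt (tau (m n) n / (m n)%:R)).
  apply/funext => n; rewrite /rate invfM invrK sqrtrM ?ltW// mulrC sqrtrV//.
rewrite -[X in _ --> X]sqrtr0.
by apply: continuous_cvg => //; exact: sqrt_continuous.
Qed.

Lemma sketch_errE (a a' : vecseq R) n w :
  err a a' n w = dotv (S (m n) n w *m a n) (S (m n) n w *m a' n) - dotv (a n) (a' n).
Proof. by rewrite /sketch_err /qform /dotv trmx_mul !mulmxA. Qed.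

Lemma measurable_sketch_err (a a' : vecseq R) n : measurable_fun setT (err a a' n).
Proof.
have mSa (v : 'cV[R]_n) i : measurable_fun setT (fun w => (S (m n) n w *m v) i ord0).
  under eq_fun do rewrite mxE.
  by apply: measurable_sum => j; exact: measurable_funM.
rewrite (_ : err a a' n = fun w => \sum_i (S (m n) n w *m a n) i ord0 * (S (m n) n w *m a' n) i ord0
   - dotv (a n) (a' n)); last by apply/funext => w; rewrite sketch_errE dotvE.
by apply: measurable_funB => //; apply: measurable_sum => i; exact: measurable_funM.
Qed.

(** The error times a rate tending to infinity is tight, as it is
    asymptotically normal after division by a bounded deviation. *)
Lemma sketch_err_cvg0 (a a' : vecseq R) : sat p condP a a' ->
  err a a' x.1 x.2 @[x --> F] --> (0 : R).
Proof.
move=> /clt1 [[c1 [c2 [c10 hs]]] h].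
have tY := tight_of_normal _ h.
have e0 : Num.sqrt (sigma2 (a n) (a' n)) * (rt n)^-1 @[n --> \oo] --> (0 : R).
  have hc : Num.sqrt c2 * (rt n)^-1 @[n --> \oo] --> (0 : R).
    by rewrite -(mulr0 (Num.sqrt c2)); apply: cvgM; [exact: cvg_cst|exact: rate_inv].
  apply: (squeeze_cvgr _ (cvg_cst 0) hc).
  have := nbhs_infty_gt p; move: rate_gt0; apply: filterS2 => n rn /hs /andP[h1 h2].
  have ri0 : 0 <= (rt n)^-1 by rewrite invr_ge0 ltW.
  apply/andP; split; first by apply: mulr_ge0 => //; exact: sqrtr_ge0.
  by apply: ler_wpM2r => //; exact: ler_wsqrtr.
have {}tY : tight P (fun n w => rt n * (Num.sqrt (sigma2 (a n) (a' n)))^-1 * err a a' n w).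
  by apply: tY => n; apply: measurable_funM => //; exact: measurable_sketch_err.
apply: cvg_trans (tightM_cvg0 tY (whp_cvg P e0)).
apply: near_eq_cvg; have := whp_near P (nbhs_infty_gt p); have := whp_near P rate_gt0.
apply: filterS2 => x rx /hs /andP[h1 h2].
have s0 : 0 < Num.sqrt (sigma2 (a x.1) (a' x.1)) by rewrite sqrtr_gt0 (lt_le_trans c10).
by field; rewrite !gt_eqF.
Qed.

(** The centered and rescaled sketched products of a with the orthonormal
    columns of U. Its projection on b is the rescaled error of the pair
    (U b, a), so one-dimensional limits of the errors are limits of the
    projections of one vector of R^p. *)
Definition cross (a : vecseq R) n w : 'cV[R]_p :=
  rt n *: ((U n)^T *m (S (m n) n w)^T *m S (m n) n w *m a n - (U n)^T *m a n).

Lemma dotv_cross (b : nat -> 'cV[R]_p) a n w :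
  dotv (b n) (cross a n w) = rt n * err (fun n => U n *m b n) a n w.
Proof.
rewrite sketch_errE /cross dotvC dotvZl dotvC; congr (_ * _).
rewrite dotvC dotvDl dotvNl; congr (_ - _); last first.
  by rewrite dotvC dotv_mull.
by rewrite dotvC !dotv_mull !mulmxA.
Qed.

Lemma measurable_cross a n i : measurable_fun setT (fun w => cross a n w i ord0).
Proof.
rewrite (_ : (fun w => _) = fun w => rt n * err (fun n => U n *m delta_mx i ord0) a n w).
  by apply: measurable_funM => //; exact: measurable_sketch_err.
by apply/funext => w; rewrite -(dotv_cross (fun=> delta_mx i ord0)) dotv_delta.
Qed.

Lemma cross_clt (a : vecseq R) (Sg : nat -> 'M[R]_p) :
  (forall b : nat -> 'cV[R]_p, (forall n, enorm (b n) = 1) ->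
    sat p condP (fun n => U n *m b n) a) ->
  (forall b : nat -> 'cV[R]_p, (forall n, enorm (b n) = 1) ->
    forall n, (p < n)%N -> sigma2 (U n *m b n) (a n) = qform (Sg n) (b n) (b n)) ->
  directional_clt P p (cross a) Sg.
Proof.
move=> ha hs b b1; have [hc h] := clt1 (ha b b1); split.
  by case: hc => c1 [c2 [c10 hc]]; exists c1, c2; split => // n pn; rewrite -hs//; exact: hc.
apply: cvg_distr_near h; apply: filterS (nbhs_infty_gt p) => n pn w.
by rewrite dotv_cross (hs b b1)// mulrCA mulrA.
Qed.

Lemma opp_clt (Z : nat -> T -> 'cV[R]_p) (Sg : nat -> 'M[R]_p) :
  directional_clt P p Z Sg -> directional_clt P p (fun n w => - Z n w) Sg.
Proof.
move=> clt b b1.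
have nb1 n : enorm (- b n) = 1 by rewrite -scaleN1r enormZ normrN normr1 mul1r b1.
have [hc h] := clt _ nb1; have [hc' _] := clt _ b1; split => //.
apply: cvg_distr_near h; apply: nearW => n w.
by rewrite -scaleN1r qformZ sqrrN expr1n mul1r scaleN1r dotvNl [dotv _ (- _)]dotvC dotvNl dotvC.
Qed.

Hypothesis condU : forall b : nat -> 'cV[R]_p, (forall n, enorm (b n) = 1) ->
  sat p condP (fun n => U n *m b n) (fun n => U n *m b n).

(** The quadratic form of G - 1 at a unit vector b is the error of the pair
    (U b, U b), which tends to 0. Off-diagonal entries follow by polarization
    with the direction (e_i + e_j) / sqrt 2. *)
Lemma sketched_gram_cvg : small F (fun x => G x - 1%:M).
Proof.
have UU x : (p < x.1)%N -> (U x.1)^T *m U x.1 = 1%:M by move=> /svd[].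
have q0 (b : 'cV[R]_p) : enorm b = 1 -> qform (G x - 1%:M) b b @[x --> F] --> (0 : R).
  move=> b1; have := sketch_err_cvg0 (condU (fun=> b1)).
  apply: cvg_trans; apply: near_eq_cvg.
  apply: (@filterS _ (whp P) _ _ _ _ (whp_near P (nbhs_infty_gt p))) => x px.
  rewrite sketch_errE qformE mulmxBl mul1mx [RHS]dotvC dotvDl dotvNl !dotv_mull; congr (_ - _).
    by rewrite !trmx_mul !trmxK !mulmxA.
  by rewrite mulmxA UU// mul1mx.
apply: small_entries => i j.
pose e i : 'cV[R]_p := delta_mx i ord0.
have qij (N : 'M[R]_p) a b : dotv (e a) (N *m e b) = N a b.
  by rewrite dotv_delta /e -colE mxE.
have [<-|ij] := eqVneq i j.
  have := q0 _ (enorm_delta i); apply: cvg_trans; apply: near_eq_cvg.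
  by apply: nearW => x; rewrite qformE -/(e i) qij.
pose f : 'cV[R]_p := e i + e j.
have f2 : enorm f ^+ 2 = 2.
  rewrite enorm_sqr dotvDl !dotv_delta !mxE !eqxx (negbTE ij) eq_sym (negbTE ij) /=; ring.
have f0 : f != 0.
  by apply/eqP => f0; move: f2; rewrite f0 enorm_sqr dotv0l => /eqP; rewrite eq_sym pnatr_eq0.
have h1 := q0 _ (enorm_normalize f0).
have h2 := q0 _ (enorm_delta i); have h3 := q0 _ (enorm_delta j).
have h : qform (G x - 1%:M) (normalize f) (normalize f) - 2^-1 * (qform (G x - 1%:M) (e i) (e i) +
    qform (G x - 1%:M) (e j) (e j)) @[x --> F] --> (0 : R).
  rewrite [X in _ --> X](_ : 0 = 0 - 2^-1 * (0 + 0)); last by ring.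
  by apply: cvgB => //; apply: cvgM; [exact: cvg_cst|exact: cvgD].
apply: cvg_trans h; apply: near_eq_cvg; apply: nearW => x.
set N := G x - 1%:M.
have Ns : N^T = N by rewrite /N linearB /= !trmx_mul !trmxK trmx1 !mulmxA.
rewrite /normalize qformZ exprVn f2 !qformE mulmxDr [dotv (e i + _) _]dotvC !dotvDl.
rewrite ![dotv (N *m _) _]dotvC !dotvDl !qij.
have -> : N j i = N i j by rewrite -{1}Ns mxE.
by field.
Qed.

Let l1 n := l n ord0 (Ordinal p_gt0).
(** The matrix V L divided by the largest singular value, so that both it and
    its inverse are bounded as soon as the condition number is. *)
Definition stdA n : 'M[R]_p := (l1 n)^-1 *: (V n *m L n).

Lemma l1_gt0 n : (p < n)%N -> 0 < l1 n.
Proof. by move=> pn; have [_ _ _ _] := svd pn; exact. Qed.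

Lemma stdA_unit n : (p < n)%N -> stdA n \in unitmx.
Proof.
move=> pn; have sv := svd pn.
by rewrite /stdA unitmxZ ?unitfE ?invr_eq0 ?gt_eqF ?l1_gt0// unitmx_mul (svd_Vunit sv) (svd_Lunit sv).
Qed.

Lemma stdA_inv n : (p < n)%N -> invmx (stdA n) = l1 n *: (invmx (L n) *m (V n)^T).
Proof.
move=> pn; have sv := svd pn.
have h : stdA n *m (l1 n *: (invmx (L n) *m (V n)^T)) = 1%:M.
  rewrite /stdA -scalemxAl -scalemxAr scalerA mulVf ?gt_eqF ?l1_gt0// scale1r.
  by rewrite -mulmxA mulKVmx ?(svd_Lunit sv)// (svd_VVt sv).
by rewrite -[RHS](mulKmx (stdA_unit pn)) h mulmx1.
Qed.

Lemma stdA_bounds : exists K : R, \forall n \near \oo,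
  [/\ stdA n \in unitmx, `|stdA n| <= K & `|invmx (stdA n)| <= K].
Proof.
(* A finite upper limit of the condition numbers bounds them eventually. *)
have [K hK] : exists K : R, \forall n \near \oo, l1 n / l n ord0 (rev_ord (Ordinal p_gt0)) <= K.
  move: cond_bounded; rewrite /limn_esup /limf_esup => /ereal_inf_lt [_ [A /= hA <-] ltA].
  set s := ereal_sup _ in ltA.
  exists (fine s); apply: filterS hA => n An.
  have le_s : ((l1 n / l n ord0 (rev_ord (Ordinal p_gt0)))%:E <= s)%E.
    by apply: ereal_sup_ubound; exists n.
  rewrite -lee_fin fineK// fin_numE; apply/andP; split.
    by apply/eqP => sE; move: le_s; rewrite sE.
  by apply/eqP => sE; move: ltA; rewrite sE.
exists (Num.max 1 K); have := nbhs_infty_gt p; move: hK; apply: filterS2 => n hK pn.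
have sv := svd pn; have l10 := l1_gt0 pn.
have [_ _ VV dec lpos] := sv.
have V1 i j : `|V n i j| <= 1.
  have : V n i j ^+ 2 <= 1.
    have VVj : 1 = \sum_k (V n)^T j k * V n k j.
      by have /matrixP/(_ j j) := VV; rewrite !mxE eqxx.
    rewrite [leRHS]VVj (bigD1 i)//= mxE -expr2 lerDl; apply: sumr_ge0 => k _.
    by rewrite mxE -expr2 sqr_ge0.
  by rewrite -real_normK ?num_real// expr_le1.
split; first exact: stdA_unit.
- apply: mx_norm_le => [|i j]; first by rewrite le_max ler01.
  rewrite /stdA mul_mx_diag !mxE !normrM le_max; apply/orP; left.
  rewrite gtr0_norm ?invr_gt0// mulrC ler_pdivrMr// mul1r.
  rewrite -[leRHS]mul1r ler_pM// gtr0_norm//.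
  by apply: dec.
- apply: mx_norm_le => [|i j]; first by rewrite le_max ler01.
  rewrite stdA_inv//.
  have -> : invmx (L n) = diag_mx (\row_k (l n ord0 k)^-1).
    rewrite -[RHS](mulKmx (svd_Lunit sv)) mulmx_diag.
    rewrite (_ : diag_mx _ = 1%:M) ?mulmx1//; apply/matrixP => a b; rewrite !mxE.
    by rewrite divff// gt_eqF.
  rewrite mul_diag_mx !mxE normrM normrM le_max; apply/orP; right.
  rewrite mulrA -[leRHS]mulr1; apply: ler_pM => //.
  apply: (le_trans _ hK); rewrite (gtr0_norm l10) gtr0_norm ?invr_gt0//.
  apply: ler_wpM2l; first exact: ltW.
  rewrite lef_pV2 ?posrE//.
  by apply: dec => /=; rewrite subn1 -ltnS prednK.
Qed.
Lemma sketched_gram_unit : \forall x \near F, (p < x.1)%N /\ G x \in unitmx.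
Proof.
have h1 := whp_near P (nbhs_infty_gt p).
have h2 := small_unit (whp_filter P) sketched_gram_cvg.
by move: h1 h2; apply: filterS2 => x.
Qed.

(** The instance of studentized_clt for A = V L / l_1 and C = (k / l_1) B, in the
    unscaled quantities; k is the norm that normalizes the estimator. *)
Lemma svd_clt (Z : nat -> T -> 'cV[R]_p) (Sg : nat -> 'M[R]_p) (W B : nat * T -> 'M[R]_p)
    (k : nat -> R) (s : nat * T -> R) (Y : nat -> T -> 'cV[R]_p) :
  (forall n i, measurable_fun setT (fun w => Z n w i ord0)) ->
  (forall n, (p < n)%N -> (Sg n)^T = Sg n) ->
  directional_clt P p Z Sg ->
  small F (fun x => W x - Sg x.1) ->
  s x @[x --> F] --> (1 : R) ->
  (forall n, (p < n)%N -> 0 < k n) ->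
  (\forall x \near F, psdmx (B x) /\ B x *m B x =
     (k x.1) ^- 2 *: (V x.1 *m L x.1 *m invmx (W x) *m L x.1 *m (V x.1)^T)) ->
  (\forall x \near F, Y x.1 x.2 =
     s x *: (k x.1 *: (B x *m V x.1 *m invmx (L x.1) *m invmx (G x) *m Z x.1 x.2))) ->
  cvg_std_normal P Y.
Proof.
move=> mZ Sgs clt sW s1 k0 hB hY.
have [K hK] := stdA_bounds.
apply: (studentized_clt p_gt0 mZ Sgs clt hK sketched_gram_cvg sW s1
  (C := fun x => (k x.1 / l1 x.1) *: B x)).
- move: sketched_gram_unit hB; apply: filterS2 => x [px _] [Bp BB].
  have k0x := k0 _ px; have l0x := l1_gt0 px.
  split; first by apply: psdZ => //; rewrite divr_ge0 ?ltW.
  rewrite -scalemxAl -scalemxAr BB /stdA !linearZ /= trmx_mul tr_diag_mx.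
  rewrite -!scalemxAl !scalerA !mulmxA; congr (_ *: _).
  by field; rewrite !gt_eqF.
- move: sketched_gram_unit hY; apply: filterS2 => x [px _] ->.
  have l0x := l1_gt0 px.
  congr (_ *: _); rewrite -trmx_inv stdA_inv// linearZ /= trmx_mul trmxK svd_invLtr.
  rewrite -!scalemxAl -!scalemxAr -!scalemxAl scalerA divfK ?gt_eqF//; congr (_ *: _).
  by rewrite !mulmxA.
Qed.

Variable y : forall n, 'cV[R]_n.
Local Notation beta n := (ls_est (X n) (y n)).
Local Notation eps n := (residual (X n) (y n)).
Local Notation Xt n w := (S (m n) n w *m X n).
Local Notation yt n w := (S (m n) n w *m y n).

Let ebar : vecseq R := fun n => normalize (eps n).
Let xbar : vecseq R := fun n => normalize (X n *m beta n).

Lemma normalizeK n (v : 'cV[R]_n) : enorm (normalize v) = 1 ->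
  0 < enorm v /\ v = enorm v *: normalize v.
Proof.
have [->|v0] := eqVneq v 0.
  rewrite /normalize scaler0 -(scale0r 0) enormZ normr0 mul0r => /eqP.
  by rewrite eq_sym oner_eq0.
move=> _; split; first exact: enorm_gt0.
by rewrite /normalize scalerA divff ?scale1r// gt_eqF// enorm_gt0.
Qed.

Hypothesis cond_ebar : forall b : nat -> 'cV[R]_p, (forall n, enorm (b n) = 1) ->
  sat p condP (fun n => U n *m b n) ebar.

Lemma eps_pos n : (p < n)%N -> 0 < enorm (eps n) /\ eps n = enorm (eps n) *: ebar n.
Proof.
move=> pn; apply: normalizeK.
by have [_ h _] := cond_ebar (fun=> enorm_delta (Ordinal p_gt0)); exact: h.
Qed.

Lemma U_ebar n : (p < n)%N -> (U n)^T *m ebar n = 0.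
Proof.
move=> pn; rewrite /ebar /normalize -scalemxAr (residual_orthogonal _ (svd pn)).
by rewrite scaler0.
Qed.

Lemma sketch_solve_cross x : (p < x.1)%N -> G x \in unitmx ->
  (rt x.1 * (enorm (eps x.1))^-1) *: (ls_est (Xt x.1 x.2) (yt x.1 x.2) - beta x.1) =
  V x.1 *m invmx (L x.1) *m invmx (G x) *m cross ebar x.1 x.2.
Proof.
move=> px Gu; rewrite (sketch_solve_error _ (svd px))// /cross U_ebar// subr0.
by rewrite /ebar /normalize -!scalemxAr scalerA.
Qed.

(** The variance form is the limit itself, so W = M is deterministic, k = 1
    and s = 1. Both estimators are covered: their errors are
    V L^-1 G^-1 Z up to a scalar. *)
Lemma oracle_clt (Z v : nat -> T -> 'cV[R]_p) (c : nat -> R) (M : nat -> 'M[R]_p) :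
  (forall n i, measurable_fun setT (fun w => Z n w i ord0)) ->
  (forall n, (p < n)%N -> (M n)^T = M n) ->
  directional_clt P p Z M ->
  (forall x, (p < x.1)%N -> G x \in unitmx ->
    c x.1 *: v x.1 x.2 = V x.1 *m invmx (L x.1) *m invmx (G x) *m Z x.1 x.2) ->
  cvg_std_normal P (fun n w => c n *:
    (invmx (sqrtmx (V n *m invmx (L n) *m M n *m invmx (L n) *m (V n)^T)) *m v n w)).
Proof.
move=> mZ Ms clt vE.
apply: (@svd_clt Z M (fun x => M x.1)
  (fun x => invmx (sqrtmx (V x.1 *m invmx (L x.1) *m M x.1 *m invmx (L x.1) *m (V x.1)^T)))
  (fun=> 1) (fun=> 1)) => //.
- exact: small_subrr.
- exact: cvg_cst.
- apply: (@filterS _ (whp P) _ _ _ _ sketched_gram_unit) => x [px _].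
  have [Mp Mu] := Sg_psd Ms clt px; have sv := svd px.
  rewrite expr1n invr1 scale1r -(sandwich_inv' sv Mu).
  apply: inv_sqrtmxP; last first.
    by rewrite !unitmx_mul !unitmx_inv unitmx_tr (svd_Vunit sv) (svd_Lunit sv) Mu.
  have := psd_conj (V x.1 *m invmx (L x.1)) Mp.
  by rewrite trmx_mul svd_invLtr !mulmxA.
- apply: (@filterS _ (whp P) _ _ _ _ sketched_gram_unit) => x [px Gu].
  by rewrite !scale1r scalemxAr vE// !mulmxA.
Qed.

Theorem sketch_solve_clt (M : nat -> 'M[R]_p) :
  (forall n, (p < n)%N -> (M n)^T = M n) ->
  (forall b : nat -> 'cV[R]_p, (forall n, enorm (b n) = 1) ->
    forall n, (p < n)%N -> sigma2 (U n *m b n) (ebar n) = qform (M n) (b n) (b n)) ->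
  cvg_std_normal P (fun n w =>
    (rt n * (enorm (eps n))^-1) *:
    (invmx (sqrtmx (V n *m invmx (L n) *m M n *m invmx (L n) *m (V n)^T)) *m
     (ls_est (Xt n w) (yt n w) - beta n))).
Proof.
move=> Ms hs; apply: oracle_clt (cross_clt cond_ebar hs) _ => //.
- exact: measurable_cross.
- exact: sketch_solve_cross.
Qed.

Lemma sketched_gram_inv : small F (fun x => invmx (G x) - 1%:M).
Proof.
have := @small_inv _ _ F _ p (fun x => G x) (fun=> 1%:M) _ _ sketched_gram_cvg.
rewrite invmx1 => /(_ _ _)[]//; last exact: bnd_cst.
by apply: nearW => x; rewrite unitmx1.
Qed.

Lemma cross_cvg0 (a : vecseq R) : (forall b : nat -> 'cV[R]_p, (forall n, enorm (b n) = 1) ->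
    sat p condP (fun n => U n *m b n) a) ->
  small F (fun x => (U x.1)^T *m (Sn x)^T *m Sn x *m a x.1 - (U x.1)^T *m a x.1).
Proof.
move=> ha; apply: small_entries => i j.
have := sketch_err_cvg0 (ha (fun=> delta_mx i ord0) (fun=> enorm_delta i)).
apply: cvg_trans; apply: near_eq_cvg; apply: nearW => x.
rewrite sketch_errE !dotv_mull !dotv_delta !mulmxA (ord1 j).
by rewrite [RHS]mxE [X in _ = _ + X]mxE.
Qed.

(** The squared norm of the sketched residual, relative to |eps|^2, is
    ebar^T S^T S ebar - z^T G^-1 z with z = U^T S^T S ebar. The first term tends
    to 1 because the error of the pair (ebar, ebar) is bounded in probability
    after rescaling. The second one tends to 0, since ebar is orthogonal to the
    columns of U. *)
Lemma residual_ratio_cvg :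
  OP1 P (fun n w => rt n * err ebar ebar n w) -> unit_seq p ebar ->
  enorm (eps x.1) / enorm (residual (Xt x.1 x.2) (yt x.1 x.2)) @[x --> F] --> (1 : R).
Proof.
move=> hO ue.
pose z x := (U x.1)^T *m (Sn x)^T *m Sn x *m ebar x.1.
pose r x := (err ebar ebar x.1 x.2 + 1) - dotv (z x) (invmx (G x) *m z x).
have sz : small F z.
  apply: small_near (cross_cvg0 cond_ebar).
  apply: (@filterS _ (whp P) _ _ _ _ (whp_near P (nbhs_infty_gt p))) => x px.
  by rewrite U_ebar// subr0.
have e0 : err ebar ebar x.1 x.2 @[x --> F] --> (0 : R).
  have tY : tight P (fun n w => rt n * err ebar ebar n w).
    apply: OP1_tight => // n.
    by apply: measurable_funM => //; exact: measurable_sketch_err.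
  apply: cvg_trans (tightM_cvg0 tY (whp_cvg P rate_inv)).
  apply: near_eq_cvg; apply: (@filterS _ (whp P) _ _ _ _ (whp_near P rate_gt0)) => x rx.
  by rewrite mulrA mulVf ?mul1r// gt_eqF.
have q0 : dotv (z x) (invmx (G x) *m z x) @[x --> F] --> (0 : R).
  have bG : bnd F (fun x => invmx (G x)) by exact: small_sub_bnd (bnd_cst _ 1%:M) sketched_gram_inv.
  have s0 : small F (fun x => (z x)^T *m (invmx (G x) *m z x)).
    by apply: small_mul_l; [exact: bnd_tr (small_bnd _ sz)|exact: small_mul_l].
  apply/cvgr0Pnorm_lt => e ep; move/cvgr_lt : s0 => /(_ e ep) h.
  apply: (@filterS _ (whp P) _ _ _ _ h) => x; apply: le_lt_trans.
  exact: mx_entry_le.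
have r1 : r x @[x --> F] --> (1 : R).
  rewrite -[X in _ --> X](_ : (0 + 1) - 0 = 1); last by ring.
  by apply: cvgB => //; apply: cvgD => //; exact: cvg_cst.
have s1 : (Num.sqrt (r x))^-1 @[x --> F] --> (1 : R).
  rewrite -[X in _ --> X]invr1; apply: cvgV; first exact: oner_neq0.
  rewrite -[X in _ --> X]sqrtr1.
  by apply: continuous_cvg => //; exact: sqrt_continuous.
apply: cvg_trans s1; apply: near_eq_cvg.
apply: (@filterS _ (whp P) _ _ _ _ sketched_gram_unit) => x [px Gu].
have [ep eE] := eps_pos px.
have h : enorm (residual (Xt x.1 x.2) (yt x.1 x.2)) ^+ 2 = enorm (eps x.1) ^+ 2 * r x.
  rewrite (sketched_residual_norm _ (svd px))// /r sketch_errE -(enorm_sqr (ebar x.1)).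
  rewrite ue// expr1n subrK mulrBr.
  have eZ : eps x.1 = enorm (eps x.1) *: ebar x.1 by [].
  have zZ : (U x.1)^T *m (Sn x)^T *m Sn x *m eps x.1 = enorm (eps x.1) *: z x.
    by rewrite {1}eZ -scalemxAr.
  rewrite zZ -scalemxAr dotvZl [dotv _ (_ *: _)]dotvC dotvZl [dotv _ (z x)]dotvC.
  rewrite mulrA -expr2; congr (_ - _).
  rewrite {1 2}eZ -scalemxAr dotvZl dotvC dotvZl dotvC mulrA -expr2; congr (_ * _).
  by rewrite [RHS]dotv_mull mulmxA.
have -> : enorm (residual (Xt x.1 x.2) (yt x.1 x.2)) = enorm (eps x.1) * Num.sqrt (r x).
  rewrite -[LHS]ger0_norm ?enorm_ge0// -sqrtr_sqr h sqrtrM ?sqr_ge0// sqrtr_sqr.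
  by rewrite ger0_norm// enorm_ge0.
by rewrite invfM mulrA divff ?mul1r// gt_eqF.
Qed.

(** The matrix X^T S^T S X equals V L G L V^T, whose root is the random C of
    studentized_clt with W = G^-1, close to the limit form 1. The estimated
    residual norm enters through the scalar s. *)
Theorem sketch_solve_student :
  (forall b : nat -> 'cV[R]_p, (forall n, enorm (b n) = 1) ->
    forall n, (p < n)%N -> sigma2 (U n *m b n) (ebar n) = 1) ->
  OP1 P (fun n w => rt n * err ebar ebar n w) ->
  cvg_std_normal P (fun n w =>
    (rt n * (enorm (residual (Xt n w) (yt n w)))^-1) *:
    (sqrtmx ((Xt n w)^T *m Xt n w) *m (ls_est (Xt n w) (yt n w) - beta n))).
Proof.
move=> hs hO.
have ue : unit_seq p ebar by have [] := cond_ebar (fun=> enorm_delta (Ordinal p_gt0)).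
have clt : directional_clt P p (cross ebar) (fun=> 1%:M).
  apply: cross_clt => // b b1 n pn.
  by rewrite (hs b)// qformE mul1mx -enorm_sqr b1 expr1n.
apply: (@svd_clt (cross ebar) (fun=> 1%:M) (fun x => invmx (G x))
  (fun x => sqrtmx ((Xt x.1 x.2)^T *m Xt x.1 x.2)) (fun=> 1)
  (fun x => enorm (eps x.1) / enorm (residual (Xt x.1 x.2) (yt x.1 x.2)))) => //.
- exact: measurable_cross.
- by move=> n _; rewrite trmx1.
- exact: sketched_gram_inv.
- exact: residual_ratio_cvg.
- apply: (@filterS _ (whp P) _ _ _ _ sketched_gram_unit) => x [px Gu].
  have [Bp BB] := sqrtmxP (psd_gram (Xt x.1 x.2)); split => //.
  by rewrite BB expr1n invr1 scale1r invmxK (sketched_gram (svd px)).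
- apply: (@filterS _ (whp P) _ _ _ _ sketched_gram_unit) => x [px Gu].
  have [ep _] := eps_pos px.
  set B := sqrtmx _.
  have -> : B *m V x.1 *m invmx (L x.1) *m invmx (G x) *m cross ebar x.1 x.2 =
    B *m ((rt x.1 * (enorm (eps x.1))^-1) *: (ls_est (Xt x.1 x.2) (yt x.1 x.2) - beta x.1)).
    by rewrite sketch_solve_cross// !mulmxA.
  rewrite scale1r -scalemxAr scalerA; congr (_ *: _).
  by move: (enorm (residual _ _))^-1 => c; field; rewrite gt_eqF.
Qed.

Hypothesis cond_xbar : forall b : nat -> 'cV[R]_p, (forall n, enorm (b n) = 1) ->
  sat p condP (fun n => U n *m b n) xbar.

Lemma fit_pos n : (p < n)%N -> 0 < enorm (X n *m beta n) /\
  X n *m beta n = enorm (X n *m beta n) *: xbar n.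
Proof.
move=> pn; apply: normalizeK.
by have [_ h _] := cond_xbar (fun=> enorm_delta (Ordinal p_gt0)); exact: h.
Qed.

(** The fit lies in the span of U, so it is determined by these coordinates. *)
Definition fit_dir n : 'cV[R]_p := (U n)^T *m xbar n.

Lemma coef_fit_dir n : (p < n)%N -> L n *m (V n)^T *m beta n = enorm (X n *m beta n) *: fit_dir n.
Proof.
move=> pn; rewrite /fit_dir scalemxAr -(fit_pos pn).2.
by have [-> UU _ _ _] := svd pn; rewrite !mulmxA UU mul1mx.
Qed.

Lemma xbar_fit_dir n : (p < n)%N -> xbar n = U n *m fit_dir n.
Proof.
move=> pn; have [k0 kE] := fit_pos pn.
have : enorm (X n *m beta n) *: (U n *m fit_dir n) = X n *m beta n.
  rewrite scalemxAr -coef_fit_dir//; have [XE _ _ _ _] := svd pn.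
  by set b := ls_est _ _; rewrite XE !mulmxA.
by rewrite [in RHS]kE => /scalerI -> //; rewrite gt_eqF.
Qed.

Lemma enorm_fit_dir n : (p < n)%N -> enorm (fit_dir n) = 1.
Proof.
move=> pn; have [_ UU _ _ _] := svd pn.
have ux : enorm (xbar n) = 1.
  by have [_ h _] := cond_xbar (fun=> enorm_delta (Ordinal p_gt0)); exact: h.
apply/eqP; rewrite -(@eqrXn2 _ 2)// ?enorm_ge0// -ux !enorm_sqr.
by rewrite [in X in _ == X]xbar_fit_dir// dotv_mull mulmxA UU mul1mx.
Qed.

(** The error of the partial sketching estimator is
    - |X beta| V L^-1 G^-1 (G - 1) u, where u = fit_dir, and (G - 1) u is the
    centered sketched product of the fit with U: hence the sign. *)
Lemma partial_cross x : (p < x.1)%N -> G x \in unitmx ->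
  (rt x.1 * (enorm (X x.1 *m beta x.1))^-1) *: (partial_est (Xt x.1 x.2) (X x.1) (y x.1) - beta x.1) =
  V x.1 *m invmx (L x.1) *m invmx (G x) *m (- cross xbar x.1 x.2).
Proof.
move=> px Gu; have [k0 _] := fit_pos px.
rewrite (partial_error _ (svd px))// coef_fit_dir// -!scalemxAr -scalerN scalerA -mulrA mulVf ?gt_eqF// mulr1.
rewrite mulmxN scalerN; congr (- _); rewrite /cross -scalemxAr; congr (_ *: (_ *m _)).
by rewrite {1}xbar_fit_dir// mulmxBl mul1mx !mulmxA.
Qed.

Lemma measurable_opp_cross n i :
  measurable_fun setT (fun w => (- cross xbar n w) i ord0).
Proof.
under eq_fun do rewrite mxE.
by apply: measurableT_comp => //; exact: measurable_cross.
Qed.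

Theorem partial_clt (Mpa : nat -> 'M[R]_p) :
  (forall n, (p < n)%N -> (Mpa n)^T = Mpa n) ->
  (forall b : nat -> 'cV[R]_p, (forall n, enorm (b n) = 1) ->
    forall n, (p < n)%N -> sigma2 (U n *m b n) (xbar n) = qform (Mpa n) (b n) (b n)) ->
  cvg_std_normal P (fun n w =>
    (rt n * (enorm (X n *m beta n))^-1) *:
    (invmx (sqrtmx (V n *m invmx (L n) *m Mpa n *m invmx (L n) *m (V n)^T)) *m
     (partial_est (Xt n w) (X n) (y n) - beta n))).
Proof.
move=> Ms hs; apply: oracle_clt (opp_clt (cross_clt cond_xbar hs)) _ => //.
- exact: measurable_opp_cross.
- exact: partial_cross.
Qed.

(** Up to the factor |X beta|^2 and the conjugation by V L^-1, the studentizing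
    matrix is W = (u^T G^-1 u) G^-1 + (alpha + 1) G^-1 u u^T G^-1, where
    u = fit_dir. As G tends to 1, W tends to 1 + (alpha + 1) u u^T, which is
    the variance form prescribed by the one-dimensional variances. *)
Theorem partial_student (alpha : nat) :
  (forall b : nat -> 'cV[R]_p, (forall n, enorm (b n) = 1) ->
    forall n, (p < n)%N -> sigma2 (U n *m b n) (xbar n) =
      1 + alpha.+1%:R * dotv (U n *m b n) (xbar n) ^+ 2) ->
  cvg_std_normal P (fun n w => rt n *:
     (invmx (sqrtmx
        (enorm (Xt n w *m partial_est (Xt n w) (X n) (y n)) ^+ 2 *:
           invmx ((Xt n w)^T *m Xt n w) +
         alpha.+1%:R *: (partial_est (Xt n w) (X n) (y n) *m
           (partial_est (Xt n w) (X n) (y n))^T))) *m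
      (partial_est (Xt n w) (X n) (y n) - beta n))).
Proof.
move=> hs.
pose Sg n : 'M[R]_p := 1%:M + alpha.+1%:R *: (fit_dir n *m (fit_dir n)^T).
pose t x := dotv (fit_dir x.1) (invmx (G x) *m fit_dir x.1).
pose W x := t x *: invmx (G x) +
  alpha.+1%:R *: ((invmx (G x) *m fit_dir x.1) *m (invmx (G x) *m fit_dir x.1)^T).
have Sgs n : (Sg n)^T = Sg n.
  by rewrite /Sg linearD /= trmx1 linearZ /= trmx_mul trmxK.
have clt : directional_clt P p (cross xbar) Sg.
  apply: cross_clt => // b b1 n pn; rewrite (hs b)// qformE /Sg mulmxDl mul1mx.
  rewrite [RHS]dotvC dotvDl -enorm_sqr b1 expr1n; congr (_ + _).
  rewrite -scalemxAl dotvZl; congr (_ * _).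
  by rewrite [RHS]dotvC -qformE qform_outer dotv_mull dotvC.
have bu : bnd F (fun x => fit_dir x.1).
  apply: (@bnd_nat _ _ _ P _ _ fit_dir 1).
  apply: filterS (nbhs_infty_gt p) => n pn i j.
  by rewrite (ord1 j) -(enorm_fit_dir pn) enorm_entry.
have bG : bnd F (fun x => invmx (G x)) by exact: small_sub_bnd (bnd_cst _ 1%:M) sketched_gram_inv.
pose a x := invmx (G x) *m fit_dir x.1.
have sa : small F (fun x => a x - fit_dir x.1).
  apply: small_near (small_mul_r (whp_filter P) sketched_gram_inv bu).
  by apply: nearW => x; rewrite mulmxBl mul1mx.
have t1 : t x - 1 @[x --> F] --> (0 : R).
  have s0 := small_mul_l (whp_filter P) (bnd_tr (whp_filter P) bu) sa.
  apply/cvgr0Pnorm_lt => e ep; move/cvgr_lt : s0 => /(_ e ep) h.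
  have h' := whp_near P (nbhs_infty_gt p).
  move: h h'; apply: filterS2 => x h px; apply: le_lt_trans h.
  have -> : t x - 1 = ((fit_dir x.1)^T *m (a x - fit_dir x.1)) ord0 ord0.
    rewrite -[RHS]/(dotv _ _) dotvC dotvDl dotvNl -enorm_sqr enorm_fit_dir// expr1n.
    by rewrite dotvC.
  exact: mx_entry_le.
have sW : small F (fun x => W x - Sg x.1).
  have s1 : small F (fun x => (t x - 1)%:M *m invmx (G x)).
    by apply: small_mul_r => //; exact: small_scalar.
  have s2 : small F (fun x => alpha.+1%:R *: (a x *m (a x)^T - fit_dir x.1 *m (fit_dir x.1)^T)).
    apply: smallZ; apply: smallM_sub => //; first exact: bnd_tr.
    apply: small_near (small_tr (whp_filter P) sa).
    by apply: nearW => x; rewrite linearB.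
  apply: small_near (smallD (whp_filter P) (smallD (whp_filter P) s1 sketched_gram_inv) s2).
  apply: nearW => x; rewrite mul_scalar_mx scalerBl scale1r addrA subrK.
  by rewrite /W /Sg scalerBr opprD addrACA.
have Su n : (p < n)%N -> Sg n \in unitmx.
  by move=> pn; have [] := sherman_morrison (ler0n R alpha.+1) (enorm_fit_dir pn).
(* The inverse of Sg is 1 - (alpha + 1) / (alpha + 2) u u^T. *)
have bS : bnd F (fun x => invmx (Sg x.1)).
  apply: (@bnd_near _ _ _ _ _ _ _ (fun x => 1%:M + (- (alpha.+1%:R / (1 + alpha.+1%:R)))%:M *m (fit_dir x.1 *m (fit_dir x.1)^T))).
    apply: (@filterS _ (whp P) _ _ _ _ (whp_near P (nbhs_infty_gt p))) => x px.
    have [_ ->] := sherman_morrison (ler0n R alpha.+1) (enorm_fit_dir px).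
    by rewrite mul_scalar_mx scaleNr.
  apply: bndD; first exact: bnd_cst.
  by apply: bnd_mul; [exact: bnd_cst|apply: bnd_mul => //; exact: bnd_tr].
have [Wu _] : (\forall x \near F, W x \in unitmx) /\ small F (fun x => invmx (W x) - invmx (Sg x.1)).
  apply: small_inv => //.
  by apply: (@filterS _ (whp P) _ _ _ _ (whp_near P (nbhs_infty_gt p))) => x; exact: Su.
pose bp x := partial_est (Xt x.1 x.2) (X x.1) (y x.1).
pose kp n := enorm (X n *m beta n).
pose D x := enorm (Xt x.1 x.2 *m bp x) ^+ 2 *: invmx ((Xt x.1 x.2)^T *m Xt x.1 x.2) +
         alpha.+1%:R *: (bp x *m (bp x)^T).
have DE x : (p < x.1)%N -> G x \in unitmx ->
    D x = kp x.1 ^+ 2 *: (V x.1 *m invmx (L x.1) *m W x *m invmx (L x.1) *m (V x.1)^T).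
  move=> px Gu; have sv := svd px; have [XE UU VV _ _] := sv.
  have bpE : bp x = kp x.1 *: (V x.1 *m invmx (L x.1) *m a x).
    rewrite /bp (partial_estE _ sv)// coef_fit_dir// -scalemxAr; congr (_ *: _).
    by rewrite /a !mulmxA.
  have XbE : Xt x.1 x.2 *m bp x = kp x.1 *: (Sn x *m U x.1 *m a x).
    rewrite bpE -scalemxAr [in LHS]XE !mulmxA; congr (_ *: (_ *m _)).
    by rewrite -(mulmxA _ (V x.1)^T) VV mulmx1 mulmxK// (svd_Lunit sv).
  have nE : enorm (Xt x.1 x.2 *m bp x) ^+ 2 = kp x.1 ^+ 2 * t x.
    rewrite XbE enormZ exprMn real_normK ?num_real//; congr (_ * _).
    rewrite enorm_sqr dotv_mull.
    have -> : (Sn x *m U x.1)^T *m (Sn x *m U x.1 *m a x) = G x *m a x.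
      by rewrite trmx_mul !mulmxA.
    by rewrite {2}/a mulKVmx// dotvC.
  have WE : V x.1 *m invmx (L x.1) *m W x *m invmx (L x.1) *m (V x.1)^T =
    t x *: (V x.1 *m invmx (L x.1) *m invmx (G x) *m invmx (L x.1) *m (V x.1)^T) +
    alpha.+1%:R *: ((V x.1 *m invmx (L x.1) *m a x) *m (V x.1 *m invmx (L x.1) *m a x)^T).
    rewrite /W -/(a x) mulmxDr !mulmxDl -!scalemxAr -!scalemxAl; congr (_ + _ *: _).
    by rewrite !trmx_mul svd_invLtr !mulmxA.
  rewrite /D nE (sketched_gram sv) (sandwich_inv sv Gu) bpE.
  rewrite linearZ /= -scalemxAl -scalemxAr WE !scalerDr !scalerA; congr (_ + _ *: _).
  by ring.
apply: (@svd_clt (fun n w => - cross xbar n w) Sg W (fun x => invmx (sqrtmx (D x))) kp (fun=> 1)) => //.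
- exact: measurable_opp_cross.
- exact: opp_clt.
- exact: cvg_cst.
- by move=> n pn; have [] := fit_pos pn.
- move: sketched_gram_unit Wu; apply: filterS2 => x [px Gu] Wxu.
  have [k0 _] := fit_pos px; have sv := svd px.
  have Dp : psdmx (D x).
    apply: psdD; first by apply: psdZ; [exact: sqr_ge0|apply: psd_inv; exact: psd_gram].
    by apply: psdZ; [exact: ler0n|exact: psd_outer].
  have k20 : (kp x.1) ^+ 2 != 0 by rewrite expf_neq0// gt_eqF.
  have Du : D x \in unitmx.
    rewrite DE// unitmxZ ?unitfE// !unitmx_mul !unitmx_inv unitmx_tr.
    by rewrite (svd_Vunit sv) (svd_Lunit sv) Wxu.
  have [Bp BB] := inv_sqrtmxP Dp Du; split => //.
  by move: Du; rewrite BB DE// => Du; rewrite invmxZ// (sandwich_inv' sv Wxu).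
- move: sketched_gram_unit; apply: (@filterS _ (whp P)) => x [px Gu].
  have [k0 _] := fit_pos px.
  rewrite scale1r.
  have -> : invmx (sqrtmx (D x)) *m V x.1 *m invmx (L x.1) *m invmx (G x) *m (- cross xbar x.1 x.2) =
     invmx (sqrtmx (D x)) *m ((rt x.1 * (kp x.1)^-1) *: (bp x - beta x.1)).
    by rewrite partial_cross// !mulmxA.
  by rewrite -scalemxAr scalerA mulrCA divff ?mulr1// gt_eqF.
Qed.
End sketched_regression.

(** * The four limits *)

Theorem mainTheorem1 (R : realType) (d : measure_display)
    (T : measurableType d) (P : probability T R)
    (p : nat) (p_gt0 : (0 < p)%N)
    (m : nat -> nat) (tau : nat -> nat -> R)
    (X : forall n, 'M[R]_(n, p)) (y : forall n, 'cV[R]_n)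
    (U : forall n, 'M[R]_(n, p)) (l : nat -> 'rV[R]_p) (V : nat -> 'M[R]_p)
    (S : forall k n, T -> 'M[R]_(k, n))
    (condp condP : vecseq R -> vecseq R -> Prop)
    (sigma2 : forall n, 'cV[R]_n -> 'cV[R]_n -> R)
    (M Mpa : nat -> 'M[R]_p) :
  let beta n := ls_est (X n) (y n) in
  let eps n := residual (X n) (y n) in
  let ebar n := normalize (eps n) in
  let xbar n := normalize (X n *m beta n) in
  let L n := diag_mx (l n) in
  let Xt n w := S (m n) n w *m X n in
  let yt n w := S (m n) n w *m y n in
  let betas n w := ls_est (Xt n w) (yt n w) in
  let betapa n w := partial_est (Xt n w) (X n) (y n) in
  let epst n w := residual (Xt n w) (yt n w) in
  (* the asymptotic regime *)
  m n @[n --> \oo] --> \oo ->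
  (forall n, (p < n)%N -> (m n < n)%N) ->
  (forall k n, 0 < tau k n) ->
  (tau (m n) n / (m n)%:R) @[n --> \oo] --> (0 : R) ->
  (* the data and the sketching matrices *)
  (forall n, (p < n)%N -> is_svd (X n) (U n) (l n) (V n)) ->
  (forall k n (i : 'I_k) (j : 'I_n),
      measurable_fun [set: T] (fun w => S k n w i j : R)) ->
  (limn_esup (fun n =>
     (l n ord0 (Ordinal p_gt0) / l n ord0 (rev_ord (Ordinal p_gt0)))%:E)
   < +oo)%E ->
  (forall b : nat -> 'cV[R]_p, (forall n, enorm (b n) = 1) ->
     sat p condP (fun n => U n *m b n) (fun n => U n *m b n) /\
     sat p condP (fun n => U n *m b n) ebar) ->
  bounded_cond P p m tau S condp ->
  one_dim_cond P m tau S condP U ebar xbar sigma2 M Mpa ->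
  let xbar_satisfies_condP :=
    forall b : nat -> 'cV[R]_p, (forall n, enorm (b n) = 1) ->
      sat p condP (fun n => U n *m b n) xbar in
  (* (a) *)
  cvg_std_normal P (fun n w =>
    (rate m tau n * (enorm (eps n))^-1) *:
    (invmx (sqrtmx (V n *m invmx (L n) *m M n *m invmx (L n) *m (V n)^T)) *m
     (betas n w - beta n)))
  /\
  (* (b) *)
  (xbar_satisfies_condP ->
   cvg_std_normal P (fun n w =>
    (rate m tau n * (enorm (X n *m beta n))^-1) *:
    (invmx (sqrtmx (V n *m invmx (L n) *m Mpa n *m invmx (L n) *m (V n)^T)) *m
     (betapa n w - beta n))))
  /\
  (* (c) *)
  (forall alpha : nat, alpha = 0%N \/ alpha = 1%N ->
   one_dim_cond' P m tau S alpha condP U ebar xbar sigma2 M Mpa ->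
   (sat p condp ebar ebar ->
    cvg_std_normal P (fun n w =>
     (rate m tau n * (enorm (epst n w))^-1) *:
     (sqrtmx ((Xt n w)^T *m Xt n w) *m (betas n w - beta n))))
   /\
   (xbar_satisfies_condP ->
    cvg_std_normal P (fun n w =>
     rate m tau n *:
     (invmx (sqrtmx
        (enorm (Xt n w *m betapa n w) ^+ 2 *: invmx ((Xt n w)^T *m Xt n w) +
         alpha.+1%:R *: (betapa n w *m (betapa n w)^T))) *m
      (betapa n w - beta n))))).
Proof.
move=> beta eps ebar xbar L Xt yt betas betapa epst m_oo _ tau0 taum svd mS cond hP hB h1.
have [clt1 Msym sE] := h1.
move=> xP.
have condU b (b1 : forall n, enorm (b n) = 1) := (hP b b1).1.
have cond_e b (b1 : forall n, enorm (b n) = 1) := (hP b b1).2.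
split; [|split].
- apply: (sketch_solve_clt m_oo tau0 taum svd mS cond clt1 condU cond_e).
    by move=> n pn; have [] := Msym n pn.
  by move=> b b1 n pn; exact: (sE b b1).1 (cond_e b b1) n pn.
- move=> hx; apply: (partial_clt m_oo tau0 taum svd mS cond clt1 condU hx).
    by move=> n pn; have [] := Msym n pn.
  by move=> b b1 n pn; exact: (sE b b1).2 (hx b b1) n pn.
- move=> alpha _ [_ sE']; split=> [he|hx].
    apply: (sketch_solve_student m_oo tau0 taum svd mS cond clt1 condU cond_e).
      move=> b b1 n pn; rewrite (sE' _ _ (cond_e b b1) n pn).
      (* The residual is orthogonal to the columns of U, so the variances are 1. *)
      rewrite dotv_mull (U_ebar svd _ pn).
      by rewrite dotvC dotv0l expr0n mulr0 addr0.
    exact: hB.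
  apply: (partial_student m_oo tau0 taum svd mS cond clt1 condU hx).
  by move=> b b1 n pn; exact: sE' (hx b b1) n pn.
Qed.
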